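(* (Wick rule for a product of fields.) For each $n\in\mathbb N$, $$\omega(t_1)\dotsm\omega(t_n)=\sum_{\mathcal V\in\mathcal P^{(n)}_\pm}Q(\mathcal V;t_1,\dots,t_n)\,{:}\,\omega(t_1)\dotsm\omega(t_n)\,{:}_{\mathcal V},$$ the formula being understood after smearing with a function $f^{(n)}\in B_0(T^n\to\mathbb C)$. That is, for every $f^{(n)}\in B_0(T^n\to\mathbb C)$, the following equality holds in $L^2(\tau)$: $$\langle f^{(n)},\omega^{\otimes n}\rangle=\sum_{\mathcal V\in\mathcal P_\pm^{(n)}}\langle f^{(n)}_{\mathcal V},{:}\,\omega^{\otimes k(\mathcal V)}\,{:}\rangle .$$ Here, for $\mathcal V\in\mathcal P^{(n)}_\pm$ with blocks marked $+1$ denoted $A_1,\dots,A_k$, ordered so that $\max A_1<\dots<\max A_k$, and blocks marked $-1$ denoted $D_1,\dots,D_l$, we put $k(\mathcal V):=k$ and $$f^{(n)}_{\mathcal V}(s_1,\dots,s_k):=\lambda^{\sum_{a=1}^k(|A_a|-1)+\sum_{b=1}^l(|D_b|-2)}\int_{T^l}\sigma(du_1)\dotsm\sigma(du_l)\;f^{(n)}(t_1,\dots,t_n)\,Q(\mathcal V;t_1,\dots,t_n),$$ where in the integrand $t_i:=s_a$ if $i\in A_a$ and $t_i:=u_b$ if $i\in D_b$ (no integration if $l=0$).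
   Context: $T$ is a locally compact Polish space with Borel $\sigma$-algebra $\mathcal B(T)$, and $\sigma$ is a Radon non-atomic measure on $T$. $A\in\mathcal B(T^2)$ is a symmetric set containing the diagonal, with $\sigma^{\otimes2}(A)=0$; $Q:T^2\setminus A\to\{z\in\mathbb C:|z|=1\}$ is measurable with $Q(s,t)=\overline{Q(t,s)}$; for definiteness put $Q:=1$ on $A$ (values there do not matter). $\lambda\in\mathbb R$ is fixed; $\lambda^0:=1$ (also for $\lambda=0$). $B_0(T)$: real-valued bounded Borel functions on $T$ with compact support; $B_0(T^n\to\mathbb C)$: complex-valued bounded Borel functions on $T^n$ with compact support (constants for $n=0$). Fock space. $\mathcal H_{\mathbb C}:=L^2(T\to\mathbb C,\sigma)$, $\mathcal H_{\mathbb C}^{\otimes n}=L^2(T^n\to\mathbb C,\sigma^{\otimes n})$. On $\mathcal H_{\mathbb C}^{\otimes n}$ let $(\Psi_jf)(t_1,\dots,t_n)=Q(t_j,t_{j+1})f(t_1,\dots,t_{j+1},t_j,\dots,t_n)$; these extend to a unitary representation $\pi\mapsto\Psi_\pi$ of $S_n$ with $\Psi_{(j,j+1)}=\Psi_j$. $P_n:=\frac1{n!}\sum_{\pi\in S_n}\Psi_\pi$ (an orthogonal projection), $\mathcal H_{\mathbb C}^{\circledast n}:=P_n\mathcal H_{\mathbb C}^{\otimes n}$, $\mathcal H_{\mathbb C}^{\circledast0}:=\mathbb C$. $\mathcal F^Q(\mathcal H):=\bigoplus_{n\ge0}\mathcal H_{\mathbb C}^{\circledast n}n!$ (so $\|F\|^2=\sum_nn!\|f^{(n)}\|^2$),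 $\Omega:=(1,0,0,\dots)$, and $\mathcal F^Q_{\mathrm{fin}}(\mathcal H)$ is the subspace of finite sequences (convergence: uniformly finitely many non-zero components and componentwise convergence). For $f\in B_0(T)$ and $f^{(m)}\in\mathcal H_{\mathbb C}^{\circledast m}$: $a^+(f)f^{(m)}:=P_{m+1}(f\otimes f^{(m)})$; $a^-(f)$ is the restriction of $a^+(f)^*$ to $\mathcal F^Q_{\mathrm{fin}}(\mathcal H)$; $(a^0(f)f^{(m)})(t_1,\dots,t_m):=(f(t_1)+\dots+f(t_m))f^{(m)}(t_1,\dots,t_m)$. Put $\langle f,\omega\rangle:=a^+(f)+\lambda a^0(f)+a^-(f)=\int_T\sigma(dt)f(t)\omega(t)$. $\mathscr P$ is the complex unital $*$-algebra of operators on $\mathcal F^Q_{\mathrm{fin}}(\mathcal H)$ generated by $(\langle f,\omega\rangle)_{f\in B_0(T)}$; $\tau(p):=(p\Omega,\Omega)_{\mathcal F^Q(\mathcal H)}$; $L^2(\tau)$ is the completion of $\mathscr P/\mathscr P_0$ with respect to $(p_1,p_2)_{L^2(\tau)}:=\tau(p_2^*p_1)$, where $\mathscr P_0:=\{p:(p,p)_{L^2(\tau)}=0\}$. The map $Ip:=p\Omega$ extends to a unitary operator $I:L^2(\tau)\to\mathcal F^Q(\mathcal H)$. Monomials: for $f_i\in B_0(T)$, $\langle f_1\otimes\dots\otimes f_n,\omega^{\otimes n}\rangle:=\langle f_1,\omega\rangle\dotsm\langle f_n,\omega\rangle$. This is extended (by linearity and continuity) to operators $\langle f^{(n)},\omega^{\otimes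 n}\rangle$ on $\mathcal F^Q_{\mathrm{fin}}(\mathcal H)$, $f^{(n)}\in B_0(T^n\to\mathbb C)$: linear in $f^{(n)}$, and if $f_j\to f$ pointwise with $(f_j)$ uniformly bounded and supported in a common compact set, then $\langle f_j,\omega^{\otimes n}\rangle F\to\langle f,\omega^{\otimes n}\rangle F$ in $\mathcal F^Q_{\mathrm{fin}}(\mathcal H)$ for all $F$. Such an operator $p$ is identified with the element $I^{-1}(p\Omega)\in L^2(\tau)$. Orthogonal polynomials: $\mathscr P^{(n)}$ is the linear span of constants and of $\langle f_1,\omega\rangle\dotsm\langle f_k,\omega\rangle$, $k\le n$, $f_i\in B_0(T)$; $\mathscr{MP}^{(n)}$ is its closure in $L^2(\tau)$; $\mathscr{OP}^{(n)}:=\mathscr{MP}^{(n)}\ominus\mathscr{MP}^{(n-1)}$ for $n\ge1$, $\mathscr{OP}^{(0)}:=\mathscr{MP}^{(0)}$. $\langle f^{(n)},{:}\,\omega^{\otimes n}\,{:}\rangle$ denotes the orthogonal projection of $\langle f^{(n)},\omega^{\otimes n}\rangle$ onto $\mathscr{OP}^{(n)}$ (for $n=0$: the constant $f^{(0)}$). Marked partitions: $\mathcal P^{(n)}_\pm$ is the set of all partitions $\mathcal V$ of $\{1,\dots,n\}$ whose blocks $B$ carry a mark $m(B)\in\{+1,-1\}$, with singletons always marked $+1$. ${:}\,\omega(t_1)\dotsm\omega(t_n)\,{:}_{\mathcal V}$ is obtained from ${:}\,\omega(t_1)\dotsm\omega(t_n)\,{:}$ by: for each block $\{i_1<\dots<i_k\}$,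 $k\ge2$, marked $+1$, removing $\omega(t_{i_1}),\dots,\omega(t_{i_{k-1}})$ and multiplying by $\lambda^{k-1}\delta(t_{i_1},\dots,t_{i_k})$; for each block marked $-1$, removing $\omega(t_{i_1}),\dots,\omega(t_{i_k})$ and multiplying by $\lambda^{k-2}\delta(t_{i_1},\dots,t_{i_k})$, where $\delta$ is the delta function: $\int_{T^k}\sigma(dt_1)\dotsm\sigma(dt_k)g(t_1,\dots,t_k)\delta(t_1,\dots,t_k)=\int_T\sigma(dt)g(t,\dots,t)$. Further, $$Q(\mathcal V;t_1,\dots,t_n):=\prod_{\substack{B_1,B_2\in\mathcal V\\ m(B_1)=m(B_2)=-1\\ \min B_1<\min B_2<\max B_1<\max B_2}}Q(t_{\min B_2},t_{\max B_1})\times\prod_{\substack{B_1,B_2\in\mathcal V\\ m(B_1)=+1,\ m(B_2)=-1\\ \min B_2<\max B_1<\max B_2}}Q(t_{\min B_2},t_{\max B_1}).$$ *)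

(* Defs.v *)
From HB Require Import structures.
From mathcomp Require Import all_boot all_order all_algebra all_fingroup.
From mathcomp Require Import all_classical all_reals all_analysis.
From mathcomp Require Import complex zify.

Set Implicit Arguments.
Unset Strict Implicit.
Unset Printing Implicit Defensive.

Import Order.TTheory GRing.Theory Num.Theory numFieldNormedType.Exports.

Local Open Scope classical_set_scope.
Local Open Scope complex_scope.
Local Open Scope ring_scope.

Notation borel T := (g_sigma_algebraType (@open T)).

Section space.
Context {R : realType} {T : completePseudoMetricType R}.

(* A Hausdorff pseudometric is a metric; completeness is part of the type. *)
Definition polish : Prop :=
  hausdorff_space T /\ exists2 D : set T, countable D & dense D.

Definition radon (mu : {measure set (borel T) -> \bar R}) : Prop :=
  (forall K : set T, compact K -> (mu K < +oo)%E) /\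
  (forall B : set (borel T), measurable B ->
     mu B = ereal_sup [set mu K | K in [set K : set T | compact K /\ K `<=` B]]).

Definition non_atomic (mu : {measure set (borel T) -> \bar R}) : Prop :=
  forall B : set (borel T), measurable B -> (0 < mu B)%E ->
    exists C : set (borel T),
      [/\ measurable C, C `<=` B, (0 < mu C)%E & (mu C < mu B)%E].

End space.
Arguments polish {R} T.

Section complex_functions.
Context {R : realType} {d : measure_display} {X : measurableType d}.

Definition cmeasurable (D : set X) (f : X -> R[i]) : Prop :=
  measurable_fun D (fun x => complex.Re (f x)) /\
  measurable_fun D (fun x => complex.Im (f x)).

Definition cintegral (mu : set X -> \bar R) (f : X -> R[i]) : R[i] :=
  fine (\int[mu]_x (complex.Re (f x))%:E)%E +i*
  fine (\int[mu]_x (complex.Im (f x))%:E)%E.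

Definition normsq (z : R[i]) : R := complex.Re z ^+ 2 + complex.Im z ^+ 2.

Definition sqnorm (mu : set X -> \bar R) (f : X -> R[i]) : \bar R :=
  (\int[mu]_x (normsq (f x))%:E)%E.

End complex_functions.

Section sequences.
Context {R : realType}.

Definition ccvg (u : nat -> R[i]) (z : R[i]) : Prop :=
  complex.Re (u j) @[j --> \oo] --> complex.Re z /\
  complex.Im (u j) @[j --> \oo] --> complex.Im z.

Definition cseries (u : nat -> R[i]) : R[i] :=
  limn (series (fun n => complex.Re (u n))) +i*
  limn (series (fun n => complex.Im (u n))).

End sequences.

(* [fvec R T] collects the families (F^(0), F^(1), ...) of functions on T^n.
   Elements of the Fock space are represented by such families, and two of them
   are the same vector when they agree up to [feq], i.e. almost everywhere. *)
Definition fvec (R : realType) (T : Type) := forall n : nat, n.-tuple T -> R[i].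

Section fvec_lmod.
Context {R : realType} {T : Type}.
Implicit Types F G H : fvec R T.

HB.instance Definition _ := gen_eqMixin (fvec R T).
HB.instance Definition _ := gen_choiceMixin (fvec R T).

Let fvec0 : fvec R T := fun n t => 0.
Let fvecN F : fvec R T := fun n t => - F n t.
Let fvecD F G : fvec R T := fun n t => F n t + G n t.
Let fvecZ (c : R[i]) F : fvec R T := fun n t => c * F n t.

Let ext F G : (forall n t, F n t = G n t) -> F = G.
Proof. by move=> FG; apply: functional_extensionality_dep => n; apply/funext. Qed.

Let fvecDA : associative fvecD.
Proof. by move=> F G H; apply: ext => n t; rewrite /fvecD addrA. Qed.
Let fvecDC : commutative fvecD.
Proof. by move=> F G; apply: ext => n t; rewrite /fvecD addrC. Qed.
Let fvec0D : left_id fvec0 fvecD.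
Proof. by move=> F; apply: ext => n t; rewrite /fvecD add0r. Qed.
Let fvecND : left_inverse fvec0 fvecN fvecD.
Proof. by move=> F; apply: ext => n t; rewrite /fvecD addNr. Qed.

HB.instance Definition _ :=
  GRing.isZmodule.Build (fvec R T) fvecDA fvecDC fvec0D fvecND.

Let fvecZA a b F : fvecZ a (fvecZ b F) = fvecZ (a * b) F.
Proof. by apply: ext => n t; rewrite /fvecZ mulrA. Qed.
Let fvec1Z : left_id 1 fvecZ.
Proof. by move=> F; apply: ext => n t; rewrite /fvecZ mul1r. Qed.
Let fvecZDr : right_distributive fvecZ +%R.
Proof. by move=> a F G; apply: ext => n t; rewrite /fvecZ mulrDr. Qed.
Let fvecZDl F : {morph fvecZ^~ F : a b / a + b}.
Proof. by move=> a b; apply: ext => n t; rewrite /fvecZ mulrDl. Qed.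

HB.instance Definition _ :=
  GRing.Zmodule_isLmodule.Build R[i] (fvec R T) fvecZA fvec1Z fvecZDr fvecZDl.

End fvec_lmod.

Section powers.
Context {R : realType} {T : completePseudoMetricType R}.
Variable sigma : {measure set (borel T) -> \bar R}.

(* sigma^{(x) n} on T^n, with the product sigma-algebra of [n.-tuple]; T being
   second countable, this is the Borel sigma-algebra of T^n. *)
Fixpoint sigman (n : nat) : set (n.-tuple (borel T)) -> \bar R :=
  match n with
  | 0 => \d_ ([tuple] : 0.-tuple (borel T))
  | m.+1 => pushforward (sigma \x @sigman m)%E
              (fun x : borel T * m.-tuple (borel T) =>
                 [tuple of x.1 :: x.2] : m.+1.-tuple (borel T))
  end.

Definition L2 n (f : n.-tuple T -> R[i]) : Prop :=
  @cmeasurable R _ (n.-tuple (borel T)) setT f /\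
  (sqnorm (@sigman n) f < +oo)%E.

Definition ip2 n (f g : n.-tuple T -> R[i]) : R[i] :=
  cintegral (@sigman n) (fun t => f t * (g t)^*).

Definition aeq n (f g : n.-tuple T -> R[i]) : Prop :=
  {ae (@sigman n), forall t : n.-tuple (borel T), f t = g t}.

Definition B0 (f : T -> R) : Prop :=
  [/\ measurable_fun (setT : set (borel T)) f,
      exists C : R, forall x, `|f x| <= C
    & exists2 K : set T, compact K & forall x, ~ K x -> f x = 0].

Definition supported_in n (K : set {ptws 'I_n -> T}) (f : n.-tuple T -> R[i]) :=
  forall t, ~ K (tnth t) -> f t = 0.

Definition B0n n (f : n.-tuple T -> R[i]) : Prop :=
  [/\ @cmeasurable R _ (n.-tuple (borel T)) setT f,
      exists C : R, forall t, `|f t| <= C%:C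
    & exists2 K : set {ptws 'I_n -> T}, compact K & supported_in K f].

End powers.

Definition commutation_kernel {R : realType} {T : completePseudoMetricType R}
    (sigma : {measure set (borel T) -> \bar R})
    (A : set (borel T * borel T)) (Q : T -> T -> R[i]) : Prop :=
  [/\ measurable A, (sigma \x sigma)%E A = 0%E,
      forall s t, A (s, t) -> A (t, s) & forall t, A (t, t)] /\
  [/\ cmeasurable (~` A) (fun x => Q x.1 x.2),
      forall s t, ~ A (s, t) -> `|Q s t| = 1,
      forall s t, ~ A (s, t) -> Q s t = (Q t s)^*
    & forall s t, A (s, t) -> Q s t = 1].

Section symmetrization.
Context {R : realType} {T : Type}.
Variable Q : T -> T -> R[i].

(* The representation of S_n determined by the adjacent transpositions: one
   factor Q(t_a, t_b) for each a < b that pi^-1 puts in the opposite order.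
   See [Psi_adjacent] and [Psi_comp]. *)
Definition Psi n (p : 'S_n) (f : n.-tuple T -> R[i]) : n.-tuple T -> R[i] :=
  fun t =>
    (\prod_(a < n) \prod_(b < n | (a < b)%N && ((p^-1)%g b < (p^-1)%g a)%N)
       Q (tnth t a) (tnth t b))
    * f [tuple tnth t (p i) | i < n].

Definition Psym n (f : n.-tuple T -> R[i]) : n.-tuple T -> R[i] :=
  fun t => (n`!%:R)^-1 * \sum_(p : 'S_n) Psi p f t.

Lemma Psi_adjacent n (j k : 'I_n) (f : n.-tuple T -> R[i]) (t : n.-tuple T) :
  k = j.+1 :> nat ->
  Psi (tperm j k) f t =
    Q (tnth t j) (tnth t k) * f [tuple tnth t (tperm j k i) | i < n].
Proof.
move=> kj; rewrite /Psi tpermV; congr (_ * _).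
have inv (a b : 'I_n) :
    (a < b)%N && (tperm j k b < tperm j k a)%N = (a == j) && (b == k).
  apply/andP/andP => [[ab]|[/eqP-> /eqP->]]; last first.
    by rewrite tpermL tpermR kj ltnS leqnn.
  move=> ba; suff [-> ->] : a = j /\ b = k by rewrite !eqxx.
  have neq (x y : 'I_n) : x <> y -> x <> y :> nat by move=> + /val_inj.
  move: ab ba; case: (tpermP j k b) => [->|->|/neq bj /neq bk];
    case: (tpermP j k a) => [->|->|/neq aj /neq ak] //; lia.
rewrite (bigD1 j)//= (bigD1 k)/=; last by rewrite inv !eqxx.
rewrite big1 ?mulr1; last first.
  by move=> b; rewrite inv eqxx/= andbN.
rewrite big1 ?mulr1// => a aj; apply: big_pred0 => b.
by rewrite inv (negbTE aj).
Qed.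

Lemma Psi_comp n (p r : 'S_n) (f : n.-tuple T -> R[i]) :
  (forall s t, Q s t * Q t s = 1) ->
  Psi p (Psi r f) = Psi (r * p)%g f.
Proof.
move=> QQ; apply/funext => t; rewrite /Psi mulrA; congr (_ * _); last first.
  by congr f; apply: eq_from_tnth => i; rewrite !tnth_mktuple permM.
pose X a b := Q (tnth t a) (tnth t b).
pose s := (r * p)%g.
have -> : \prod_(a < n) \prod_(b < n | (a < b)%N && ((r^-1)%g b < (r^-1)%g a)%N)
      Q (tnth [tuple tnth t (p i) | i < n] a) (tnth [tuple tnth t (p i) | i < n] b)
    = \prod_(a < n) \prod_(b < n | ((p^-1)%g a < (p^-1)%g b)%N
        && ((s^-1)%g b < (s^-1)%g a)%N) X a b.
  rewrite [RHS](reindex_inj (@perm_inj _ p)); apply: eq_bigr => a _.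
  rewrite [RHS](reindex_inj (@perm_inj _ p)); apply: eq_big => [b|b _].
    by rewrite /s invMg !permM !permK.
  by rewrite !tnth_mktuple.
have split3 : forall (P : rel 'I_n), irreflexive P ->
    \prod_(a < n) \prod_(b < n | P a b) X a b =
    \prod_(a < n) \prod_(b < n | (a < b)%N)
      ((if P a b then X a b else 1) * (if P b a then X b a else 1)).
  move=> P Pirr; under [RHS]eq_bigr do rewrite big_split/=.
  rewrite big_split/= [X in _ = _ * X](exchange_big_dep xpredT)//= -big_split/=.
  apply: eq_bigr => a _; rewrite big_mkcond (bigID (fun b : 'I_n => (a < b)%N))/=.
  congr (_ * _); rewrite (bigID (fun b : 'I_n => (b < a)%N))/= [X in _ * X]big1 ?mulr1.
    by apply: eq_bigl => b; case: ltngtP.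
  move=> b; rewrite -!leqNgt => /andP[ba ab].
  have -> : a = b by apply/val_inj/eqP; rewrite /= eqn_leq ab ba.
  by rewrite Pirr.
rewrite -/s.
rewrite (split3 (fun a b => (a < b)%N && ((p^-1)%g b < (p^-1)%g a)%N));
  last by move=> a; rewrite ltnn.
rewrite (split3 (fun a b => ((p^-1)%g a < (p^-1)%g b)%N
                            && ((s^-1)%g b < (s^-1)%g a)%N));
  last by move=> a; rewrite ltnn.
rewrite (split3 (fun a b => (a < b)%N && ((s^-1)%g b < (s^-1)%g a)%N));
  last by move=> a; rewrite ltnn.
rewrite -big_split/=; apply: eq_bigr => a _.
rewrite -big_split/=; apply: eq_bigr => b ab.
rewrite ab (ltnNge b a) (ltnW ab)/= mulr1.
have ne (q : 'S_n) : (q a < q b)%N = ~~ (q b < q a)%N.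
  have : q a <> q b :> nat by move/val_inj/perm_inj => abE; rewrite abE ltnn in ab.
  by lia.
rewrite !ne; case: ltnP => _; case: ltnP => _; rewrite /= ?mulr1 ?mul1r //.
exact: QQ.
Qed.

End symmetrization.

Section fock.
Context {R : realType} {T : completePseudoMetricType R}.
Variable sigma : {measure set (borel T) -> \bar R}.
Variables (Q : T -> T -> R[i]) (lambda : R).
Local Notation fvec := (fvec R T).

Definition feq (F G : fvec) : Prop := forall n, aeq sigma (F n) (G n).

(* Membership in the range of the projection P_n on L^2(T^n). *)
Definition Qsymmetric n (f : n.-tuple T -> R[i]) : Prop :=
  L2 sigma f /\
  exists2 g : n.-tuple T -> R[i], L2 sigma g & aeq sigma f (Psym Q g).

Definition fnorm2 (F : fvec) : \bar R :=
  (\sum_(0 <= n <oo)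
     ((n`!)%:R)%:E * @sqnorm R _ (n.-tuple (borel T)) (sigman sigma (n:=n)) (F n))%E.

Definition fip (F G : fvec) : R[i] :=
  cseries (fun n => n`!%:R * ip2 sigma (F n) (G n)).

Definition is_fock (F : fvec) : Prop :=
  (forall n, Qsymmetric (F n)) /\ (fnorm2 F < +oo)%E.

Definition is_fin (F : fvec) : Prop :=
  (forall n, Qsymmetric (F n)) /\
  exists N, forall n, (N <= n)%N -> aeq sigma (F n) (fun=> 0).

Definition fin_cvg (F : nat -> fvec) (G : fvec) : Prop :=
  (exists N, forall j n, (N <= n)%N -> aeq sigma (F j n) (fun=> 0)) /\
  forall n, sqnorm (sigman sigma (n:=n))
              ((F j - G) n : n.-tuple (borel T) -> R[i]) @[j --> \oo] --> 0%E.

Definition vacuum : fvec := fun n _ => (n == 0)%:R.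

(* Operators on F_fin are represented by maps on [fvec], of which only the
   values on [is_fin] vectors, up to [feq], are relevant. *)
Definition is_operator (p : fvec -> fvec) : Prop :=
  [/\ forall F, is_fin F -> is_fin (p F),
      forall F G, is_fin F -> is_fin G -> feq F G -> feq (p F) (p G)
    & forall (c : R[i]) F G, is_fin F -> is_fin G ->
        feq (p (c *: F + G)) (c *: p F + p G)].

Definition is_adjoint (p q : fvec -> fvec) : Prop :=
  is_operator q /\
  forall F G, is_fin F -> is_fin G -> fip (p F) G = fip F (q G).

Definition a_plus (f : T -> R) (F : fvec) : fvec := fun n =>
  match n with
  | 0 => fun=> 0
  | m.+1 => Psym Q (fun t : m.+1.-tuple T =>
                      (f (thead t))%:C * F m [tuple of behead t])
  end.

Definition a_zero (f : T -> R) (F : fvec) : fvec :=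
  fun n t => (\sum_(i < n) f (tnth t i))%:C * F n t.

(* The value at F of the adjoint of [a_plus f]: the Fock vector G (unique up to
   [feq]) with (a_plus f H, F) = (H, G) for every H in F_fin. *)
Definition a_minus (f : T -> R) (F : fvec) : fvec :=
  xget 0 [set G | is_fock G /\
    forall H, is_fin H -> fip (a_plus f H) F = fip H G].

Definition fieldop (f : T -> R) (F : fvec) : fvec :=
  a_plus f F + lambda%:C *: a_zero f F + a_minus f F.

Inductive field_algebra : (fvec -> fvec) -> Prop :=
  | field_algebra_field f : B0 f -> field_algebra (fieldop f)
  | field_algebra_one : field_algebra idfun
  | field_algebra_add p q :
      field_algebra p -> field_algebra q -> field_algebra (fun F => p F + q F)
  | field_algebra_scale (c : R[i]) p :
      field_algebra p -> field_algebra (fun F => c *: p F)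
  | field_algebra_mul p q :
      field_algebra p -> field_algebra q -> field_algebra (p \o q)
  | field_algebra_star p q :
      field_algebra p -> is_adjoint p q -> field_algebra q.

Definition field_monomial (s : seq (T -> R)) : fvec -> fvec :=
  foldr (fun f p => fieldop f \o p) idfun s.

Definition algebra_upto (n : nat) : set (fvec -> fvec) :=
  [set p | exists (m : nat) (c : 'I_m -> R[i]) (s : 'I_m -> seq (T -> R)),
     (forall i, (size (s i) <= n)%N /\ forall f, f \in s i -> B0 f) /\
     p = (fun F => \sum_(i < m) c i *: field_monomial (s i) F)].

Definition tau (p : fvec -> fvec) : R[i] := fip (p vacuum) vacuum.

(* (L, ip) is a Hilbert space in which iota realizes the completion of the
   polynomials modulo the null space of (p1, p2) |-> tau (p2^* p1). *)
Definition is_L2tau (L : completeNormedModType R[i]) (ip : {dot L for Num.conj})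
    (iota : (fvec -> fvec) -> L) : Prop :=
  [/\ forall x : L, `|x| ^+ 2 = ip x x,
      forall (c : R[i]) p q, field_algebra p -> field_algebra q ->
        iota (fun F => c *: p F + q F) = c *: iota p + iota q,
      forall p1 p2 p2', field_algebra p1 -> field_algebra p2 -> is_adjoint p2 p2' ->
        ip (iota p1) (iota p2) = tau (p2' \o p1)
    & closure (iota @` field_algebra) = setT].

(* The family f^(n) |-> <f^(n), omega^{(x) n}>. *)
Definition is_monomial_extension
    (W : forall n, (n.-tuple T -> R[i]) -> fvec -> fvec) : Prop :=
  [/\ forall n f, B0n f -> is_operator (W n f),
      forall n (f : 'I_n -> T -> R), (forall i, B0 (f i)) ->
        forall F, is_fin F ->
          feq (W n (fun t => \prod_(i < n) (f i (tnth t i))%:C) F)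
              (field_monomial [seq f i | i <- enum 'I_n] F),
      forall n (c : R[i]) f g, B0n f -> B0n g ->
        forall F, is_fin F ->
          feq (W n (fun t => c * f t + g t) F) (c *: W n f F + W n g F)
    & forall n (fj : nat -> n.-tuple T -> R[i]) (f : n.-tuple T -> R[i]) (C : R)
             (K : set {ptws 'I_n -> T}),
        (forall j, B0n (fj j)) -> B0n f -> compact K ->
        (forall j, supported_in K (fj j)) ->
        (forall j t, `|fj j t| <= C%:C) ->
        (forall t, ccvg (fj ^~ t) (f t)) ->
        forall F, is_fin F -> fin_cvg (fun j => W n (fj j) F) (W n f F)].

Section chaos.
Variables (L : completeNormedModType R[i]) (ip : {dot L for Num.conj}).
Variable iota : (fvec -> fvec) -> L.
Variable W : forall n, (n.-tuple T -> R[i]) -> fvec -> fvec.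

(* I x = F, for I the continuous extension of p |-> p Omega. *)
Definition I_graph (x : L) (F : fvec) : Prop :=
  is_fock F /\ exists p : nat -> fvec -> fvec,
    [/\ forall j, field_algebra (p j), iota (p j) @[j --> \oo] --> x
      & fnorm2 (p j vacuum - F) @[j --> \oo] --> 0%E].

Definition I_inv (F : fvec) : L := xget 0 [set x | I_graph x F].

(* The operator <f^(n), omega^{(x) n}> as an element of L^2(tau). *)
Definition monomial_elt n (f : n.-tuple T -> R[i]) : L := I_inv (W f vacuum).

Definition MP (n : nat) : set L := closure (iota @` algebra_upto n).

Definition OP (n : nat) : set L :=
  match n with
  | 0 => MP 0
  | m.+1 => [set x | MP m.+1 x /\ forall y, MP m y -> ip x y = 0]
  end.

Definition orth_proj (S : set L) (x : L) : L :=
  xget 0 [set y | S y /\ forall z, S z -> ip (x - y) z = 0].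

(* <f^(n), :omega^{(x) n}:>; for n = 0 this is the constant f^(0), the
   projection being the identity on constants. *)
Definition wick n (f : n.-tuple T -> R[i]) : L :=
  orth_proj (OP n) (monomial_elt f).

End chaos.
End fock.

(* A marked partition of {0, ..., n-1} is given by the pair of its set of blocks
   marked +1 and its set of blocks marked -1. *)
Section marked_partitions.
Context {n : nat}.
Implicit Types (B : {set 'I_n}) (V : {set {set 'I_n}} * {set {set 'I_n}}).

Definition marked_partition V : bool :=
  [&& finset.partition (V.1 :|: V.2) [set: 'I_n]%SET, [disjoint V.1 & V.2]
    & [forall B in V.2, (1 < #|B|)%N]].

Definition bmin B : nat := \big[minn/n]_(i in B) (i : nat).
Definition bmax B : nat := \max_(i in B) (i : nat).

(* Position of B among the blocks of P ordered by their maxima. *)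
Definition block_rank (P : {set {set 'I_n}}) B : nat :=
  #|[set B' in P | (bmax B' < bmax B)%N]%SET|.

(* The truncated subtractions are exact on marked partitions. *)
Definition lambda_exponent V : nat :=
  (\sum_(B in V.1) (#|B| - 1) + \sum_(B in V.2) (#|B| - 2))%N.

Context {R : realType} {T : completePseudoMetricType R}.
Variable sigma : {measure set (borel T) -> \bar R}.
Variables (Q : T -> T -> R[i]) (lambda : R).

Definition Qpartition V (t : n.-tuple T) : R[i] :=
  (\prod_(B1 in V.2) \prod_(B2 in V.2 |
       [&& (bmin B1 < bmin B2)%N, (bmin B2 < bmax B1)%N
         & (bmax B1 < bmax B2)%N])
     Q (nth point t (bmin B2)) (nth point t (bmax B1)))
  * (\prod_(B1 in V.1) \prod_(B2 in V.2 |
       (bmin B2 < bmax B1)%N && (bmax B1 < bmax B2)%N)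
     Q (nth point t (bmin B2)) (nth point t (bmax B1))).

(* The point t with t_i = s_a for i in A_a and t_i = u_b for i in D_b.  The
   blocks D_b are also ordered by their maxima; u is integrated out. *)
Definition assemble V (s : #|V.1|.-tuple T) (u : #|V.2|.-tuple T) : n.-tuple T :=
  [tuple let B := finset.pblock (V.1 :|: V.2) i in
         if B \in V.1 then nth point s (block_rank V.1 B)
         else nth point u (block_rank V.2 B) | i < n].

Definition smear (f : n.-tuple T -> R[i]) V (s : #|V.1|.-tuple T) : R[i] :=
  lambda%:C ^+ lambda_exponent V *
  cintegral (sigman sigma (n:=#|V.2|))
    (fun u : #|V.2|.-tuple (borel T) =>
       f (assemble s u) * Qpartition V (assemble s u)).

End marked_partitions.

(* Main.v *)
From HB Require Import structures.
Require Import Defs.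
From mathcomp Require Import all_boot all_order all_algebra all_fingroup.
From mathcomp Require Import all_classical all_reals all_analysis measurable_realfun.
From mathcomp Require Import complex zify ring lra.

(* Since Q = 1 on A, the relation Q(s,t) Q(t,s) = 1 holds everywhere, so all the
   identities between kernels below are pointwise.

   Let W_n f be the vector <f, omega^n> Omega and P_k the Q-symmetrization. The
   core is the identity W_n f = sum_V P_k(V) f_V in the Fock space. For a product
   f = f_1 x ... x f_n it is proved by induction, applying the field <f_0, omega>
   to the vectors P_k f_V: creation adds the singleton {0} to V, lambda a^0 puts
   the point 0 into one of the blocks marked +1, and annihilation puts 0 into
   such a block and changes its mark to -1. Every marked partition of one more
   point arises exactly once in this way. Moving annihilation inside P_k gives a
   sum over the slots a < k of integrals over the a-th variable x with the factor
   prod_(b < a) Q(x, s_b), and these are exactly the factors by which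
   Q(V; t) changes. A monotone class argument with bounded pointwise limits
   extends the identity to all bounded f with compact support.

   In the L^2 space of tau it remains to see that P_k g corresponds to the projection
   of <g, omega^k> onto OP^(k). It is orthogonal to the polynomials of degree < k
   because their vacuum vectors have no component of degree k, and it belongs to
   MP^(k) by induction on k: in the identity for g, the partition into singletons
   contributes P_k g and every other one has fewer than k blocks marked +1. *)

(** Only the action on the vacuum matters, and every new field acts from the left. The new point 0
    is smaller than all the others, so joining a block never alters the relative order of the block
    maxima; this is why the blocks marked +1 are ordered by their maxima. If a block A marked +1 is
    contracted with 0, the new block has minimum 0 and the maximum of A. Each factor that A had with
    a block marked -1 survives as a crossing of two blocks marked -1: the second product in Q(V; t)
    stores in advance the crossings of a block that may be contracted later. The only new factors
    pair the new block with the blocks marked +1 on the left of A.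

    Several objects are fixed only through a choice ([a_minus], [I_inv], [orth_proj]). Each is tied
    to an explicit one by a uniqueness argument: separation by inner products, approximation by
    polynomials, orthogonality. Fubini's theorem needs a sigma-finite measure, which is drawn from
    local compactness and separability at the end. *)

Set Implicit Arguments.
Unset Strict Implicit.
Unset Printing Implicit Defensive.

Import Order.TTheory GRing.Theory Num.Theory numFieldNormedType.Exports.

Local Open Scope classical_set_scope.
Local Open Scope complex_scope.
Local Open Scope ring_scope.

(** * Complex numbers and complex-valued integrals *)

Section complex_facts.
Context {R : realType}.
Implicit Types z w : R[i].

Lemma complex_ext z w :
  complex.Re z = complex.Re w -> complex.Im z = complex.Im w -> z = w.
Proof. by case: z w => [a b] [c d] /= -> ->. Qed.

Lemma cReD z w : complex.Re (z + w) = complex.Re z + complex.Re w.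
Proof. by case: z w => [a b] [c d]. Qed.
Lemma cImD z w : complex.Im (z + w) = complex.Im z + complex.Im w.
Proof. by case: z w => [a b] [c d]. Qed.
Lemma cReN z : complex.Re (- z) = - complex.Re z.
Proof. by case: z. Qed.
Lemma cImN z : complex.Im (- z) = - complex.Im z.
Proof. by case: z. Qed.
Lemma cReM z w : complex.Re (z * w) =
  complex.Re z * complex.Re w - complex.Im z * complex.Im w.
Proof. by case: z w => [a b] [c d]. Qed.
Lemma cImM z w : complex.Im (z * w) =
  complex.Re z * complex.Im w + complex.Im z * complex.Re w.
Proof. by case: z w => [a b] [c d]. Qed.
Lemma cReJ z : complex.Re z^* = complex.Re z.
Proof. by case: z. Qed.
Lemma cImJ z : complex.Im z^* = - complex.Im z.
Proof. by case: z. Qed.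

Lemma conj_realc (a : R) : (a%:C)^* = a%:C.
Proof. by apply: complex_ext; rewrite ?cReJ ?cImJ//= oppr0. Qed.

Lemma normsq_ge0 z : 0 <= normsq z.
Proof. by rewrite addr_ge0 ?sqr_ge0. Qed.

Lemma normsqM z w : normsq (z * w) = normsq z * normsq w.
Proof. by rewrite /normsq cReM cImM; ring. Qed.

Lemma normsqJ z : normsq z^* = normsq z.
Proof. by rewrite /normsq cReJ cImJ sqrrN. Qed.

Lemma normsqN z : normsq (- z) = normsq z.
Proof. by rewrite /normsq cReN cImN !sqrrN. Qed.

Lemma normsq0 : normsq (0 : R[i]) = 0.
Proof. by rewrite /normsq /= expr0n addr0. Qed.

Lemma normsq1 : normsq (1 : R[i]) = 1.
Proof. by rewrite /normsq /= expr0n addr0 expr1n. Qed.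

Lemma normsq_real (a : R) : normsq a%:C = a ^+ 2.
Proof. by rewrite /normsq /= expr0n addr0. Qed.

Lemma normsqE z : (normsq z)%:C = `|z| ^+ 2.
Proof. exact: add_Re2_Im2. Qed.

Lemma mul_conjc_normsq z : z * z^* = (normsq z)%:C.
Proof. by rewrite normsqE sqr_normc. Qed.

Lemma normsq_eq0 z : normsq z = 0 -> z = 0.
Proof.
move=> z0; apply/eqP; rewrite -normr_eq0 -sqrf_eq0 -normsqE z0; exact/eqP.
Qed.

Lemma normsqD_le z w : normsq (z + w) <= 2 * (normsq z + normsq w).
Proof.
rewrite /normsq cReD cImD.
have : 0 <= (complex.Re z - complex.Re w) ^+ 2 by exact: sqr_ge0.
have : 0 <= (complex.Im z - complex.Im w) ^+ 2 by exact: sqr_ge0.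
nra.
Qed.

Lemma Re2_le_normsq z : complex.Re z ^+ 2 <= normsq z.
Proof. by rewrite lerDl sqr_ge0. Qed.
Lemma Im2_le_normsq z : complex.Im z ^+ 2 <= normsq z.
Proof. by rewrite lerDr sqr_ge0. Qed.

Lemma norm_le_sqr (a b : R) : 0 <= b -> a ^+ 2 <= b ^+ 2 -> `|a| <= b.
Proof.
move=> b0 ab; rewrite -(ler_pXn2r (n:=2))// ?nnegrE//.
by rewrite real_normK ?num_real.
Qed.

Lemma normc_le_normsq (C : R) z : 0 <= C -> `|z| <= C%:C <-> normsq z <= C ^+ 2.
Proof.
move=> C0; rewrite -lecR normsqE rmorphXn /=.
by rewrite ler_pXn2r// nnegrE ?normr_ge0// lecR.
Qed.

End complex_facts.

Section almost_everywhere.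
Context {R : realType} {d : measure_display} {X : measurableType d}.
Variable mu : {measure set X -> \bar R}.

Lemma ae_mono (P P' : X -> Prop) : (forall x, P x -> P' x) ->
  {ae mu, forall x, P x} -> {ae mu, forall x, P' x}.
Proof. exact: filterS. Qed.

Lemma ae_forall_fin (I : finType) (P : I -> X -> Prop) :
  (forall i, {ae mu, forall x, P i x}) -> {ae mu, forall x, forall i, P i x}.
Proof. exact: filter_forall. Qed.

End almost_everywhere.

Section complex_measurability.
Context {R : realType} {d : measure_display} {X : measurableType d}.
Implicit Types f g : X -> R[i].

Lemma eq_cmeasurable f g : (forall x, f x = g x) ->
  cmeasurable setT f -> cmeasurable setT g.
Proof. by move=> /funext->. Qed.

Lemma cmeasurable_cst (c : R[i]) : cmeasurable setT (fun _ : X => c).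
Proof. by split; exact: measurable_cst. Qed.

Lemma cmeasurableD f g : cmeasurable setT f -> cmeasurable setT g ->
  cmeasurable setT (fun x => f x + g x).
Proof.
move=> [mf1 mf2] [mg1 mg2]; split.
- by under eq_fun do rewrite cReD; exact: measurable_funD.
- by under eq_fun do rewrite cImD; exact: measurable_funD.
Qed.

Lemma cmeasurableM f g : cmeasurable setT f -> cmeasurable setT g ->
  cmeasurable setT (fun x => f x * g x).
Proof.
move=> [mf1 mf2] [mg1 mg2]; split.
- by under eq_fun do rewrite cReM; apply: measurable_funB; exact: measurable_funM.
- by under eq_fun do rewrite cImM; apply: measurable_funD; exact: measurable_funM.
Qed.

Lemma cmeasurableJ f : cmeasurable setT f -> cmeasurable setT (fun x => (f x)^*).
Proof.
move=> [mf1 mf2]; split.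
- by under eq_fun do rewrite cReJ.
- by under eq_fun do rewrite cImJ; exact: measurableT_comp.
Qed.

Lemma cmeasurable_real (f : X -> R) :
  measurable_fun setT f -> cmeasurable setT (fun x => (f x)%:C).
Proof. by move=> mf; split => //=; exact: measurable_cst. Qed.

Lemma cmeasurable_prod (I : Type) (r : seq I) (P : pred I) (F : I -> X -> R[i]) :
  (forall i, P i -> cmeasurable setT (F i)) ->
  cmeasurable setT (fun x => \prod_(i <- r | P i) F i x).
Proof.
move=> mF; elim: r => [|i r IH].
  by apply: eq_cmeasurable (cmeasurable_cst 1) => x; rewrite big_nil.
have [Pi|/negbTE Pi] := boolP (P i); last first.
  by apply: eq_cmeasurable IH => x; rewrite big_cons Pi.
apply: eq_cmeasurable (cmeasurableM (mF _ Pi) IH) => x.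
by rewrite big_cons Pi.
Qed.

Lemma measurable_normsq f : cmeasurable setT f ->
  measurable_fun setT (fun x => normsq (f x)).
Proof.
by move=> [mf1 mf2]; apply: measurable_funD; exact: measurable_funX.
Qed.

End complex_measurability.

Lemma cmeasurable_comp {R : realType} d1 d2 (X : measurableType d1)
    (Y : measurableType d2) (f : Y -> R[i]) (h : X -> Y) :
  cmeasurable setT f -> measurable_fun setT h ->
  cmeasurable setT (fun x => f (h x)).
Proof.
move=> [mf1 mf2] mh; split.
- exact: (measurableT_comp mf1 mh).
- exact: (measurableT_comp mf2 mh).
Qed.

Section complex_integrable.
Context {R : realType} {d : measure_display} {X : measurableType d}.
Variables (mu : set X -> \bar R) (f : X -> R[i]).

Definition cintegrable : Prop :=
  mu.-integrable setT (fun x => (complex.Re (f x))%:E) /\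
  mu.-integrable setT (fun x => (complex.Im (f x))%:E).

Definition cL2 : Prop := cmeasurable setT f /\ (sqnorm mu f < +oo)%E.

End complex_integrable.

Section complex_integral.
Context {R : realType} {d : measure_display} {X : measurableType d}.
Variable mu : {measure set X -> \bar R}.
Implicit Types f g : X -> R[i].
Local Notation cintegrable := (cintegrable mu).
Local Notation cL2 := (cL2 mu).

Lemma cintegrable_meas f : cintegrable f -> cmeasurable setT f.
Proof.
by move=> [/measurable_int/measurable_EFinP ? /measurable_int/measurable_EFinP ?].
Qed.

Lemma eq_cintegrable f g : (forall x, f x = g x) -> cintegrable f -> cintegrable g.
Proof. by move=> /funext->. Qed.

Lemma eq_cintegral f g : (forall x, f x = g x) -> cintegral mu f = cintegral mu g.
Proof. by move=> /funext->. Qed.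

Lemma cintegrableD f g : cintegrable f -> cintegrable g ->
  cintegrable (fun x => f x + g x).
Proof.
move=> [f1 f2] [g1 g2]; split.
- by under eq_fun do rewrite cReD EFinD; exact: integrableD.
- by under eq_fun do rewrite cImD EFinD; exact: integrableD.
Qed.

Lemma cintegrableZ (c : R[i]) f : cintegrable f -> cintegrable (fun x => c * f x).
Proof.
move=> [f1 f2]; split.
- under eq_fun do rewrite cReM EFinB !EFinM.
  by apply: integrableB => //; exact: integrableZl.
- under eq_fun do rewrite cImM EFinD !EFinM.
  by apply: integrableD => //; exact: integrableZl.
Qed.

Lemma cintegrableJ f : cintegrable f -> cintegrable (fun x => (f x)^*).
Proof.
move=> [f1 f2]; split.
- by under eq_fun do rewrite cReJ.
- by under eq_fun do rewrite cImJ EFinN; exact: integrableN.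
Qed.

Lemma cintegrable0 : cintegrable (fun=> 0).
Proof. by split; exact: integrable0. Qed.

Lemma cintegrable_sum (I : Type) (r : seq I) (P : pred I) (F : I -> X -> R[i]) :
  (forall i, P i -> cintegrable (F i)) ->
  cintegrable (fun x => \sum_(i <- r | P i) F i x).
Proof.
move=> mF; elim: r => [|i r IH].
  by apply: eq_cintegrable cintegrable0 => x; rewrite big_nil.
have [Pi|/negbTE Pi] := boolP (P i); last first.
  by apply: eq_cintegrable IH => x; rewrite big_cons Pi.
by apply: eq_cintegrable (cintegrableD (mF _ Pi) IH) => x; rewrite big_cons Pi.
Qed.

Lemma le_cintegrable f (g : X -> R) : cmeasurable setT f ->
  (forall x, normsq (f x) <= g x ^+ 2) -> (forall x, 0 <= g x) ->
  mu.-integrable setT (fun x => (g x)%:E) -> cintegrable f.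
Proof.
move=> [mf1 mf2] fg g0 ig; split; apply: (le_integrable _ _ _ ig) => //;
  try exact/measurable_EFinP.
- move=> x _ /=; rewrite lee_fin (ger0_norm (g0 x)); apply: norm_le_sqr => //.
  exact: le_trans (Re2_le_normsq _) (fg x).
- move=> x _ /=; rewrite lee_fin (ger0_norm (g0 x)); apply: norm_le_sqr => //.
  exact: le_trans (Im2_le_normsq _) (fg x).
Qed.

Lemma cintegral0 : cintegral mu (fun=> 0) = 0.
Proof. by rewrite /cintegral /= integral0. Qed.

Lemma cintegralD f g : cintegrable f -> cintegrable g ->
  cintegral mu (fun x => f x + g x) = cintegral mu f + cintegral mu g.
Proof.
move=> [f1 f2] [g1 g2]; apply: complex_ext; rewrite ?cReD ?cImD /=.
- under eq_integral do rewrite cReD EFinD.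
  by rewrite integralD// fineD//; exact: integrable_fin_num.
- under eq_integral do rewrite cImD EFinD.
  by rewrite integralD// fineD//; exact: integrable_fin_num.
Qed.

Lemma cintegralZ (c : R[i]) f : cintegrable f ->
  cintegral mu (fun x => c * f x) = c * cintegral mu f.
Proof.
move=> [f1 f2].
have Z1 (r : R) := RintegralZl r measurableT f1.
have Z2 (r : R) := RintegralZl r measurableT f2.
have I1 (r : R) : mu.-integrable setT (EFin \o (fun x => r * complex.Re (f x))).
  exact: (integrableZl measurableT r f1).
have I2 (r : R) : mu.-integrable setT (EFin \o (fun x => r * complex.Im (f x))).
  exact: (integrableZl measurableT r f2).
apply: complex_ext; rewrite ?cReM ?cImM /=.
- under eq_integral do rewrite cReM.
  by move: (RintegralB measurableT (I1 (complex.Re c)) (I2 (complex.Im c)));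
    rewrite Z1 Z2.
- under eq_integral do rewrite cImM.
  by move: (RintegralD measurableT (I2 (complex.Re c)) (I1 (complex.Im c)));
    rewrite Z1 Z2.
Qed.

Lemma cintegral_sum (I : Type) (r : seq I) (P : pred I) (F : I -> X -> R[i]) :
  (forall i, P i -> cintegrable (F i)) ->
  cintegral mu (fun x => \sum_(i <- r | P i) F i x) =
  \sum_(i <- r | P i) cintegral mu (F i).
Proof.
move=> mF; elim: r => [|i r IH].
  rewrite big_nil; apply: etrans cintegral0.
  by apply: eq_cintegral => x; rewrite big_nil.
rewrite big_cons; have [Pi|/negbTE Pi] := boolP (P i); last first.
  by rewrite -IH; apply: eq_cintegral => x; rewrite big_cons Pi.
rewrite -IH -cintegralD; [|exact: mF|exact: cintegrable_sum].
by apply: eq_cintegral => x; rewrite big_cons Pi.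
Qed.

Lemma cintegralJ f : cintegrable f ->
  cintegral mu (fun x => (f x)^*) = (cintegral mu f)^*.
Proof.
move=> [f1 f2]; apply: complex_ext; rewrite ?cReJ ?cImJ /=.
- by under eq_integral do rewrite cReJ.
- under eq_integral do rewrite cImJ EFinN.
  by rewrite integralN ?fineN//; exact: integrable_add_def.
Qed.

Lemma ae_eq_cintegral f g : cmeasurable setT f -> cmeasurable setT g ->
  {ae mu, forall x, f x = g x} -> cintegral mu f = cintegral mu g.
Proof.
move=> [mf1 mf2] [mg1 mg2] fg; apply: complex_ext => /=; congr fine.
- apply: ae_eq_integral => //; try exact/measurable_EFinP.
  by apply: filterS fg => x /= -> _.
- apply: ae_eq_integral => //; try exact/measurable_EFinP.
  by apply: filterS fg => x /= -> _.
Qed.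

Lemma sqnorm_ge0 f : (0 <= sqnorm mu f)%E.
Proof. by apply: integral_ge0 => x _; rewrite lee_fin normsq_ge0. Qed.

Lemma ae_eq_sqnorm f g : cmeasurable setT f -> cmeasurable setT g ->
  {ae mu, forall x, f x = g x} -> sqnorm mu f = sqnorm mu g.
Proof.
move=> mf mg fg; apply: ae_eq_integral => //;
  try exact/measurable_EFinP/measurable_normsq.
by apply: filterS fg => x /= -> _.
Qed.

Lemma sqnorm_eq0 f : cmeasurable setT f ->
  sqnorm mu f = 0%E <-> {ae mu, forall x, f x = 0}.
Proof.
move=> mf; have mn : measurable_fun setT (fun x => (normsq (f x))%:E).
  exact/measurable_EFinP/measurable_normsq.
have := ae_eq_integral_abs mu measurableT mn.
under eq_integral do rewrite gee0_abs ?lee_fin ?normsq_ge0//.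
move=> [h1 h2]; split => [/h1|h].
  by apply: filterS => x /= /(_ I) [/normsq_eq0].
by apply: h2; apply: filterS h => x /= -> _; rewrite normsq0.
Qed.

Lemma sqnormZ (c : R[i]) f : cmeasurable setT f ->
  sqnorm mu (fun x => c * f x) = ((normsq c)%:E * sqnorm mu f)%E.
Proof.
move=> mf; rewrite /sqnorm; under eq_integral do rewrite normsqM EFinM.
rewrite ge0_integralZl_EFin ?normsq_ge0//.
- by move=> x _; rewrite lee_fin normsq_ge0.
- exact/measurable_EFinP/measurable_normsq.
Qed.

(** Convexity of the square, used in place of Minkowski's inequality: squared norms are kept
    throughout, and a factor 2 does no harm to finiteness or to limits equal to zero. *)
Lemma sqnormD_le f g : cmeasurable setT f -> cmeasurable setT g ->
  (sqnorm mu (fun x => (f x + g x)%R) <= 2%:E * (sqnorm mu f + sqnorm mu g))%E.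
Proof.
move=> mf mg.
have nn h (x : X) : setT x -> (0 <= (normsq (h x : R[i]))%:E)%E.
  by move=> _; rewrite lee_fin normsq_ge0.
have mn h : cmeasurable setT h -> measurable_fun setT (fun x : X => (normsq (h x))%:E).
  by move=> mh; exact/measurable_EFinP/measurable_normsq.
rewrite /sqnorm -ge0_integralD//; [|exact: nn|exact: mn|exact: nn|exact: mn].
rewrite -ge0_integralZl_EFin//; last 2 first.
- by move=> x _; rewrite adde_ge0// nn.
- by apply: emeasurable_funD; exact: mn.
apply: ge0_le_integral => //.
- exact: nn.
- by apply: mn; exact: cmeasurableD.
- by apply: measurable_funeM; apply: emeasurable_funD; exact: mn.
- by move=> x _; rewrite -EFinD -EFinM lee_fin normsqD_le.
Qed.

Lemma cL2_0 : cL2 (fun=> 0).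
Proof.
split; first exact: cmeasurable_cst.
by rewrite (sqnorm_eq0 (cmeasurable_cst 0)).2 ?ltry//; exact: aeW.
Qed.

Lemma eq_cL2 f g : (forall x, f x = g x) -> cL2 f -> cL2 g.
Proof. by move=> /funext->. Qed.

Lemma cL2D f g : cL2 f -> cL2 g -> cL2 (fun x => f x + g x).
Proof.
move=> [mf foo] [mg goo]; split; first exact: cmeasurableD.
apply: le_lt_trans (sqnormD_le mf mg) _.
by rewrite lte_mul_pinfty ?lee_fin// lte_add_pinfty.
Qed.

Lemma cL2Z (c : R[i]) f : cL2 f -> cL2 (fun x => c * f x).
Proof.
move=> [mf foo]; split; first exact: cmeasurableM (cmeasurable_cst c) mf.
by rewrite sqnormZ// lte_mul_pinfty ?lee_fin ?normsq_ge0.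
Qed.

Lemma cL2_sum (I : Type) (r : seq I) (P : pred I) (F : I -> X -> R[i]) :
  (forall i, P i -> cL2 (F i)) ->
  cL2 (fun x => \sum_(i <- r | P i) F i x).
Proof.
move=> mF; elim: r => [|i r IH].
  by apply: eq_cL2 cL2_0 => x; rewrite big_nil.
have [Pi|/negbTE Pi] := boolP (P i); last first.
  by apply: eq_cL2 IH => x; rewrite big_cons Pi.
by apply: eq_cL2 (cL2D (mF _ Pi) IH) => x; rewrite big_cons Pi.
Qed.

Lemma cL2M_bounded (b f : X -> R[i]) (C : R) : cmeasurable setT b ->
  (forall x, normsq (b x) <= C) -> cL2 f -> cL2 (fun x => b x * f x).
Proof.
move=> mb bC [mf foo]; split; first exact: cmeasurableM.
have C0 (x : X) : 0 <= C := le_trans (normsq_ge0 _) (bC x).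
(* C bounds the squared modulus, so the dominating function is f times the square root of C. *)
have mC : cmeasurable setT (fun x => (Num.sqrt C)%:C * f x).
  exact: cmeasurableM (cmeasurable_cst _) mf.
apply: (@le_lt_trans _ _ (sqnorm mu (fun x => (Num.sqrt C)%:C * f x))).
  apply: ge0_le_integral => //.
  - by move=> x _; rewrite lee_fin normsq_ge0.
  - by apply/measurable_EFinP/measurable_normsq; exact: cmeasurableM.
  - exact/measurable_EFinP/measurable_normsq.
  - move=> x _; rewrite lee_fin !normsqM ler_wpM2r ?normsq_ge0//.
    by rewrite normsq_real sqr_sqrtr ?bC// (C0 x).
by rewrite sqnormZ// lte_mul_pinfty ?lee_fin ?normsq_ge0.
Qed.

Lemma cL2_sqr_integrable f : cL2 f ->
  mu.-integrable setT (fun x => (normsq (f x))%:E).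
Proof.
move=> [mf foo]; apply/integrableP; split.
  exact/measurable_EFinP/measurable_normsq.
by under eq_integral do rewrite gee0_abs ?lee_fin ?normsq_ge0//.
Qed.

Lemma cL2_ip_integrable f g : cL2 f -> cL2 g ->
  cintegrable (fun x => f x * (g x)^*).
Proof.
move=> f2 g2; have [[mf _] [mg _]] := (f2, g2).
apply: (le_cintegrable (g := fun x => normsq (f x) + normsq (g x))).
- by apply: cmeasurableM => //; exact: cmeasurableJ.
- move=> x; rewrite normsqM normsqJ.
  by have := normsq_ge0 (f x); have := normsq_ge0 (g x); nra.
- by move=> x; rewrite addr_ge0 ?normsq_ge0.
- under eq_fun do rewrite EFinD.
  by apply: integrableD => //; exact: cL2_sqr_integrable.
Qed.

Lemma ip_self f : cL2 f ->
  cintegral mu (fun x => f x * (f x)^*) = (fine (sqnorm mu f))%:C.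
Proof.
move=> f2; apply: complex_ext => /=.
- by congr fine; apply: eq_integral => x _; rewrite mul_conjc_normsq.
- by under eq_integral do rewrite mul_conjc_normsq; rewrite integral0.
Qed.

Lemma sqnorm_fin f : cL2 f -> sqnorm mu f \is a fin_num.
Proof. by move=> [_ foo]; rewrite ge0_fin_numE// sqnorm_ge0. Qed.

End complex_integral.

(** * Tuples, sigma-finiteness and Fubini's theorem *)

Section tuple_maps.
Context d (Y : measurableType d).

Definition tcons n (x : Y * n.-tuple Y) : n.+1.-tuple Y := [tuple of x.1 :: x.2].

Definition tuncons n (t : n.+1.-tuple Y) : Y * n.-tuple Y :=
  (thead t, [tuple of behead t]).

Lemma measurable_tcons n : measurable_fun setT (@tcons n).
Proof. by apply: measurable_cons. Qed.

Lemma measurable_thead n : measurable_fun setT (fun t : n.+1.-tuple Y => thead t).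
Proof. exact: measurable_tnth. Qed.

Lemma measurable_tuncons n : measurable_fun setT (@tuncons n).
Proof.
by apply: measurable_fun_pair; [exact: measurable_thead|exact: measurable_behead].
Qed.

Lemma tunconsK n : cancel (@tuncons n) (@tcons n).
Proof. by move=> t; rewrite [RHS]tuple_eta; exact/val_inj. Qed.

Lemma tconsK n : cancel (@tcons n) (@tuncons n).
Proof. by case=> x t; rewrite /tuncons /tcons /=; congr pair; exact/val_inj. Qed.

End tuple_maps.
Arguments tcons {d Y n}.
Arguments tuncons {d Y n}.

(** The exhaustions are taken nondecreasing, so that two coordinates found at stages i and j both
    lie in the sets of stage [maxn i j], and the products of sets of equal stage cover the space. *)
Lemma product_measure_sigma_finite d1 d2 (X : measurableType d1)
    (Y : measurableType d2) (R : realType)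
    (m1 : {sigma_finite_measure set X -> \bar R})
    (m2 : {sigma_finite_measure set Y -> \bar R}) :
  sigma_finite setT (m1 \x m2)%E.
Proof.
have /sigma_finiteP[F [FT ndF Foo]] := sigma_finiteT m1.
have /sigma_finiteP[G [GT ndG Goo]] := sigma_finiteT m2.
exists (fun n => F n `*` G n).
  rewrite -setXTT FT GT; apply/seteqP; split=> [[x y] [[/= i _ Fx] [j _ Gy]]|].
    exists (maxn i j) => //; split => /=.
    - by move: x Fx; exact/subsetPset/ndF/leq_maxl.
    - by move: y Gy; exact/subsetPset/ndG/leq_maxr.
  by move=> [x y] [i _ []/= ? ?]; split; exists i.
move=> i; have [? ?] := Foo i; have [? ?] := Goo i.
split; first exact: measurableX.
by rewrite product_measure1E// lte_mul_pinfty// ge0_fin_numE.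
Qed.

(** The left inverse c' transports an exhaustion: the preimage under c of the preimage under c' of F
    i is F i, so the transported set has the measure of F i. *)
Lemma pushforward_sigma_finite d1 d2 (X : measurableType d1)
    (Y : measurableType d2) (R : realType)
    (P : {measure set X -> \bar R}) (c : X -> Y) (c' : Y -> X) :
  sigma_finite setT P ->
  measurable_fun setT c -> measurable_fun setT c' -> cancel c c' ->
  [/\ pushforward P c set0 = 0%E, forall A, (0 <= pushforward P c A)%E,
     semi_sigma_additive (pushforward P c)
   & sigma_finite setT (pushforward P c)].
Proof.
move=> [F FT Ffin] mc mc' cK.
have mcA A : measurable A -> measurable (c @^-1` A).
  by move=> mA; rewrite -[X in measurable X]setTI; exact: mc.
split.
- by rewrite /pushforward preimage_set0 measure0.
- by move=> A; rewrite /pushforward measure_ge0.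
- move=> G mG tG mUG; rewrite /pushforward preimage_bigcup.
  apply: measure_semi_sigma_additive.
  + by move=> k; exact: mcA.
  + apply/trivIsetP => /= i j _ _ ij; rewrite -preimage_setI.
    by move/trivIsetP : tG => /(_ _ _ _ _ ij) ->//; rewrite preimage_set0.
  + by rewrite -preimage_bigcup; exact: mcA.
- exists (fun i => c' @^-1` F i).
    by rewrite -preimage_bigcup -FT preimage_setT.
  move=> i; have [mF PF] := Ffin i; split.
    by rewrite -[X in measurable X]setTI; exact: mc'.
  rewrite /pushforward (_ : _ @^-1` _ = F i)//.
  by rewrite -comp_preimage; apply/funext => x /=; rewrite cK.
Qed.

Section sigma_power.
Context {R : realType} {T : completePseudoMetricType R}.
Variable sigma : {sigma_finite_measure set (borel T) -> \bar R}.
Local Notation bT := (borel T).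

(** The four properties go through one induction, because the facts on the product measure at stage
    n+1 require stage n to be a sigma-finite measure. *)
Lemma sigman_measure n :
  [/\ @sigman R T sigma n set0 = 0%E, forall A, (0 <= @sigman R T sigma n A)%E,
     semi_sigma_additive (@sigman R T sigma n)
   & sigma_finite setT (@sigman R T sigma n)].
Proof.
elim: n => [|n [IH0 IHge IHadd IHfin]] /=.
  split.
  - by rewrite measure0.
  - by move=> A; rewrite measure_ge0.
  - exact: measure_semi_sigma_additive.
  - exact: sigma_finiteT.
(* The induction hypotheses are packed into a local sigma-finite measure convertible to [sigman]. *)
pose m0 := isMeasure.Build _ _ _ (@sigman R T sigma n) IH0 IHge IHadd.
pose m' : {measure set (n.-tuple bT) -> \bar R} := HB.pack (@sigman R T sigma n) m0.
pose m1 := Measure_isSigmaFinite.Build _ _ _ m' IHfin.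
pose m : {sigma_finite_measure set (n.-tuple bT) -> \bar R} :=
  HB.pack (@sigman R T sigma n) m0 m1.
rewrite -[@sigman R T sigma n]/(m : set _ -> \bar R).
apply: pushforward_sigma_finite (product_measure_sigma_finite sigma m) _ _ _.
- exact: measurable_tcons.
- exact: measurable_tuncons.
- exact: tconsK.
Qed.

Section instances.
Variable n : nat.
Let sn := @sigman R T sigma n.
Let sn0 : sn set0 = 0%E. Proof. by have [] := sigman_measure n. Qed.
Let sn_ge0 A : (0 <= sn A)%E. Proof. by have [] := sigman_measure n. Qed.
Let sn_additive : semi_sigma_additive sn.
Proof. by have [] := sigman_measure n. Qed.
Let sn_sigma_finite : sigma_finite setT sn.
Proof. by have [] := sigman_measure n. Qed.

HB.instance Definition _ := isMeasure.Build _ _ _ (@sigman R T sigma n)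
  sn0 sn_ge0 sn_additive.
HB.instance Definition _ := Measure_isSigmaFinite.Build _ _ _ (@sigman R T sigma n)
  sn_sigma_finite.
End instances.

Lemma ge0_integral_sigmanS n (f : n.+1.-tuple bT -> \bar R) :
  measurable_fun setT f -> (forall t, (0 <= f t)%E) ->
  (\int[@sigman R T sigma n.+1]_t f t =
   \int[sigma]_x \int[@sigman R T sigma n]_t f (tcons (x, t)))%E.
Proof.
move=> mf f0 /=.
rewrite (ge0_integral_pushforward (@measurable_tcons _ bT n)
  (product_measure1 sigma (@sigman R T sigma n)))//.
rewrite preimage_setT fubini_tonelli1//.
  exact: measurableT_comp mf (@measurable_tcons _ bT n).
by move=> x; exact: f0.
Qed.

Lemma ge0_integral_sigmanS_swap n (f : n.+1.-tuple bT -> \bar R) :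
  measurable_fun setT f -> (forall t, (0 <= f t)%E) ->
  (\int[@sigman R T sigma n.+1]_t f t =
   \int[@sigman R T sigma n]_t \int[sigma]_x f (tcons (x, t)))%E.
Proof.
move=> mf f0 /=.
rewrite (ge0_integral_pushforward (@measurable_tcons _ bT n)
  (product_measure1 sigma (@sigman R T sigma n)))//.
rewrite preimage_setT fubini_tonelli2//.
  exact: measurableT_comp mf (@measurable_tcons _ bT n).
by move=> x; exact: f0.
Qed.

End sigma_power.

Section complex_fubini.
Context {R : realType} d1 d2 (X : measurableType d1) (Y : measurableType d2).

(** The positive and the negative part are treated separately by Tonelli, so measurability in x
    holds without integrability. *)
Lemma measurable_Rintegral_section (m2 : {sigma_finite_measure set Y -> \bar R})
    (g : X * Y -> R) : measurable_fun setT g ->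
  measurable_fun setT (fun x => fine (\int[m2]_y (g (x, y))%:E)%E).
Proof.
move=> /measurable_EFinP mg; apply: measurableT_comp; first exact: fine_measurable.
under eq_fun do rewrite integralE.
apply: emeasurable_funB.
- under eq_fun => x.
    under eq_integral do rewrite (funepos_comp (EFin \o g) (pair x))/=.
    over.
  apply: (measurable_fun_fubini_tonelli_F ((EFin \o g)^\+)%E) => //.
  exact: measurable_funepos.
- under eq_fun => x.
    under eq_integral do rewrite (funeneg_comp (EFin \o g) (pair x))/=.
    over.
  apply: (measurable_fun_fubini_tonelli_F ((EFin \o g)^\-)%E) => //.
  exact: measurable_funeneg.
Qed.

Lemma cmeasurable_cintegral (m2 : {sigma_finite_measure set Y -> \bar R})
    (f : X * Y -> R[i]) : cmeasurable setT f ->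
  cmeasurable setT (fun x => cintegral m2 (fun y => f (x, y))).
Proof.
move=> [mf1 mf2]; split => /=.
- exact: (measurable_Rintegral_section m2 mf1).
- exact: (measurable_Rintegral_section m2 mf2).
Qed.

Variables (m1 : {sigma_finite_measure set X -> \bar R}).
Variables (m2 : {sigma_finite_measure set Y -> \bar R}).

(** [fine] changes the inner integral only where it is infinite, which happens on a null set of
    x. *)
Lemma Rfubini1 (g : X * Y -> R) :
  (m1 \x m2)%E.-integrable setT (fun z => (g z)%:E) ->
  (fine (\int[m1]_x (fine (\int[m2]_y (g (x, y))%:E))%:E) =
   fine (\int[m1 \x m2]_z (g z)%:E))%E.
Proof.
move=> ig; have mg : measurable_fun setT g.
  by move/measurable_int : ig => /measurable_EFinP.
rewrite -(integral12_prod_meas1 ig); congr fine.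
apply: ae_eq_integral => //.
- exact/measurable_EFinP/(measurable_Rintegral_section m2 mg).
- exact: measurable_fubini_F ig.
- have := integrable_ae measurableT (integrable_fubini_F ig).
  by apply: filterS => x h _; rewrite fineK//; exact: h.
Qed.

Lemma cfubini1 (f : X * Y -> R[i]) : cintegrable (m1 \x m2)%E f ->
  cintegral m1 (fun x => cintegral m2 (fun y => f (x, y))) =
  cintegral (m1 \x m2)%E f.
Proof.
move=> [f1 f2]; apply: complex_ext => /=.
- exact: (Rfubini1 f1).
- exact: (Rfubini1 f2).
Qed.

End complex_fubini.

Section complex_fubini_swap.
Context {R : realType} d1 d2 (X : measurableType d1) (Y : measurableType d2).
Variables (m1 : {sigma_finite_measure set X -> \bar R}).
Variables (m2 : {sigma_finite_measure set Y -> \bar R}).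

Lemma Rfubini2 (g : X * Y -> R) :
  (m1 \x m2)%E.-integrable setT (fun z => (g z)%:E) ->
  (fine (\int[m2]_y (fine (\int[m1]_x (g (x, y))%:E))%:E) =
   fine (\int[m1 \x m2]_z (g z)%:E))%E.
Proof.
move=> ig; have mg : measurable_fun setT g.
  by move/measurable_int : ig => /measurable_EFinP.
rewrite -(integral21_prod_meas1 ig); congr fine.
apply: ae_eq_integral => //.
- have mgs : measurable_fun setT (fun z : Y * X => g (z.2, z.1)).
    by apply: (measurableT_comp mg); exact: measurable_fun_pair.
  exact/measurable_EFinP/(measurable_Rintegral_section m1 mgs).
- exact: measurable_fubini_G ig.
- apply: filterS (ae_integrable2 ig) => y h _; rewrite fineK//.
  exact: integrable_fin_num.
Qed.

Lemma cfubini2 (f : X * Y -> R[i]) : cintegrable (m1 \x m2)%E f ->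
  cintegral m2 (fun y => cintegral m1 (fun x => f (x, y))) =
  cintegral (m1 \x m2)%E f.
Proof.
move=> [f1 f2]; apply: complex_ext => /=.
- exact: (Rfubini2 f1).
- exact: (Rfubini2 f2).
Qed.

Lemma ae_cintegrable2 (f : X * Y -> R[i]) : cintegrable (m1 \x m2)%E f ->
  {ae m2, forall y, cintegrable m1 (fun x => f (x, y))}.
Proof.
move=> [/ae_integrable2 f1 /ae_integrable2 f2].
by apply: filterS2 f1 f2 => x; split.
Qed.

End complex_fubini_swap.

Section complex_pushforward.
Context {R : realType} d1 d2 (X : measurableType d1) (Y : measurableType d2).
Variables (mu : {measure set X -> \bar R}) (c : X -> Y).
Hypothesis mc : measurable_fun setT c.

Lemma cintegrable_pushforward (f : Y -> R[i]) : cmeasurable setT f ->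
  cintegrable (pushforward mu c) f -> cintegrable mu (f \o c).
Proof.
move=> [mf1 mf2] [/integrableP[_ f1] /integrableP[_ f2]].
split; apply/integrableP; split.
- exact/measurable_EFinP/(measurableT_comp mf1 mc).
- move: f1; rewrite ge0_integral_pushforward//.
  by apply: measurableT_comp => //; exact/measurable_EFinP.
- exact/measurable_EFinP/(measurableT_comp mf2 mc).
- move: f2; rewrite ge0_integral_pushforward//.
  by apply: measurableT_comp => //; exact/measurable_EFinP.
Qed.

Lemma cintegral_pushforward (f : Y -> R[i]) : cmeasurable setT f ->
  cintegrable mu (f \o c) -> 
  cintegral (pushforward mu c) f = cintegral mu (f \o c).
Proof.
move=> [mf1 mf2] [f1 f2]; apply: complex_ext => /=.
- by rewrite (integral_pushforward mc)//; exact/measurable_EFinP.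
- by rewrite (integral_pushforward mc)//; exact/measurable_EFinP.
Qed.

End complex_pushforward.

Section rectangles.
Context d (Y : measurableType d) (n : nat).

Definition rect (B : 'I_n -> set Y) : set (n.-tuple Y) :=
  [set t | forall i, B i (tnth t i)].

Lemma measurable_rect (B : 'I_n -> set Y) :
  (forall i, measurable (B i)) -> measurable (rect B).
Proof.
move=> mB.
have -> : rect B = \bigcap_(i in [set: 'I_n]) ((@tnth n Y ^~ i) @^-1` B i).
  by apply/seteqP; split => [t tB i _|t tB i]; exact: tB.
apply: fin_bigcap_measurable => // i _; rewrite -[X in measurable X]setTI.
exact: measurable_tnth.
Qed.

Definition rectangle : set (set (n.-tuple Y)) :=
  [set A | exists2 B : 'I_n -> set Y, forall i, measurable (B i) & A = rect B].

Lemma measurable_rectangle_gen :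
  @measurable _ (n.-tuple Y) = <<s rectangle >>.
Proof.
apply/seteqP; split.
  apply: smallest_sub; first exact: smallest_sigma_algebra.
  move=> A; rewrite -bigcup_seq /= => -[i /= _ [B mB <-]].
  (* A coordinate cylinder is a rectangle whose other sides are the whole space. *)
  apply: sub_sigma_algebra; exists (fun j => if j == i then B else setT).
    by move=> j; case: ifP.
  apply/seteqP; split => [t [_ Bt] j|t /(_ i)].
    by case: eqP => [->//|].
  by rewrite eqxx.
apply: smallest_sub; first exact: sigma_algebra_measurable.
by move=> _ [B mB ->]; exact: measurable_rect.
Qed.

Lemma rectangle_setI_closed : setI_closed rectangle.
Proof.
move=> _ _ [B mB ->] [C mC ->]; exists (fun i => B i `&` C i).
  by move=> i; exact: measurableI.
by apply/seteqP; split => [t [Bt Ct] i|t BCt]; split => // i; have [] := BCt i.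
Qed.

Definition tuperm (p : 'S_n) (t : n.-tuple Y) : n.-tuple Y :=
  [tuple tnth t (p i) | i < n].

Lemma measurable_tuperm p : measurable_fun setT (tuperm p).
Proof.
apply/measurable_fun_tnthP => i.
rewrite (_ : _ \o _ = (@tnth n Y ^~ (p i))); first exact: measurable_tnth.
by apply/funext => t; rewrite /= tnth_mktuple.
Qed.

Lemma tuperm1 t : tuperm 1%g t = t.
Proof. by apply: eq_from_tnth => i; rewrite tnth_mktuple perm1. Qed.

End rectangles.

(** * Powers of the measure *)
Section sigma_power_invariance.
Context {R : realType} {T : completePseudoMetricType R}.
Variable sigma : {sigma_finite_measure set (borel T) -> \bar R}.
Local Notation bT := (borel T).

Lemma sigman_rect n (B : 'I_n -> set bT) : (forall i, measurable (B i)) ->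
  @sigman R T sigma n (rect B) = (\prod_(i < n) sigma (B i))%E.
Proof.
elim: n B => [|n IH] B mB.
  rewrite big_ord0 /= diracE mem_set//.
  by case.
rewrite big_ord_recl -(IH (fun i => B (lift ord0 i)))//.
rewrite -[LHS]/((sigma \x @sigman R T sigma n)%E (tcons @^-1` rect B)).
rewrite -product_measure1E//; last exact: measurable_rect.
congr (_ _); apply/seteqP; split => [[x t] /= Bt|[x t] /= [Bx Bt] i].
  split; first by have := Bt ord0.
  by move=> i; have := Bt (lift ord0 i); rewrite tnthS.
by have [j ->|->] := unliftP ord0 i; rewrite ?tnthS.
Qed.

(** Rectangles form a generating class stable under intersection, and the cubes over an exhaustion
    of T have finite measure. *)
Lemma sigman_unique n (m : {measure set (n.-tuple bT) -> \bar R}) :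
  (forall B, (forall i, measurable (B i)) -> m (rect B) = (\prod_(i < n) sigma (B i))%E) ->
  forall A, measurable A -> m A = @sigman R T sigma n A.
Proof.
move=> mE; have /sigma_finiteP[F [FT ndF Ffin]] := sigma_finiteT sigma.
apply: (measure_unique (@rectangle _ bT n) (fun k => rect (fun=> F k))).
- exact: measurable_rectangle_gen.
- exact: rectangle_setI_closed.
- by move=> k; exists (fun=> F k) => // i; have [] := Ffin k.
- apply/seteqP; split => // t _.
  have h (i : 'I_n) : exists k, F k (tnth t i).
    by have : setT (tnth t i) by []; rewrite FT => -[k _ Fk]; exists k.
  (* The exhaustion is nondecreasing, so the largest of the n stages serves all coordinates at
     once. *)
  pose k := \max_(i < n) xget 0%N [set k | F k (tnth t i)].
  exists k => // i; have [k0 Fk0] := h i.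
  have : F (xget 0%N [set k | F k (tnth t i)]) (tnth t i) by exact: xgetPex (h i).
  by apply/subsetPset/ndF; exact: leq_bigmax.
- by move=> A [B mB ->]; rewrite mE//; exact/esym/sigman_rect.
- move=> k; rewrite mE; last by move=> _; have [] := Ffin k.
  rewrite -ge0_fin_numE; last by apply: prode_ge0.
  by apply: prode_fin_num => i _; rewrite ge0_fin_numE//; have [] := Ffin k.
Qed.

(** On rectangles a permutation only reorders the factors of a product, and [sigman_unique] extends
    this. Together with the unimodular cocycle it makes every [Psi] unitary. *)
Lemma sigman_tuperm n (p : 'S_n) A : measurable A ->
  pushforward (@sigman R T sigma n) (tuperm p) A = @sigman R T sigma n A.
Proof.
pose m := measure_function_pushforward__canonical__measure_function_Measure
  (@sigman R T sigma n) (@measurable_tuperm _ bT n p).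
apply: (sigman_unique (m := m)) => B mB.
rewrite [LHS]/(pushforward _ _ _) /pushforward.
rewrite (_ : _ @^-1` _ = rect (fun i => B ((p^-1)%g i))).
  transitivity (\prod_(i < n) sigma (B ((p^-1)%g i)))%E; first exact: sigman_rect.
  rewrite (reindex_inj (@perm_inj _ p)) /=.
  by apply: eq_bigr => i _; rewrite permK.
apply/seteqP; split => t h i.
  by have := h ((p^-1)%g i); rewrite tnth_mktuple permKV.
by rewrite tnth_mktuple; have := h (p i); rewrite permK.
Qed.

Lemma integral_pushforward_tuperm n (p : 'S_n) (f : n.-tuple bT -> \bar R) :
  (\int[pushforward (@sigman R T sigma n) (tuperm p)]_t f t =
   \int[@sigman R T sigma n]_t f t)%E.
Proof.
pose m := measure_function_pushforward__canonical__measure_function_Measure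
  (@sigman R T sigma n) (@measurable_tuperm _ bT n p).
rewrite -[LHS]/(integral m setT f).
by apply: eq_measure_integral => A mA _; exact: sigman_tuperm.
Qed.

Lemma ge0_integral_tuperm n (p : 'S_n) (f : n.-tuple bT -> \bar R) :
  measurable_fun setT f -> (forall t, (0 <= f t)%E) ->
  (\int[@sigman R T sigma n]_t f (tuperm p t) =
   \int[@sigman R T sigma n]_t f t)%E.
Proof.
move=> mf f0; rewrite -[RHS](integral_pushforward_tuperm p) (ge0_integral_pushforward
  (@measurable_tuperm _ bT n p))//.
Qed.

Lemma cintegrable_tuperm n (p : 'S_n) (f : n.-tuple bT -> R[i]) :
  cintegrable (@sigman R T sigma n) f ->
  cintegrable (@sigman R T sigma n) (fun t => f (tuperm p t)).
Proof.
have mp := @measurable_tuperm _ bT n p.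
have H (g : n.-tuple bT -> R) :
    (@sigman R T sigma n).-integrable setT (fun t => (g t)%:E) ->
    (@sigman R T sigma n).-integrable setT (fun t => (g (tuperm p t))%:E).
  move=> /integrableP[mg gi]; apply/integrableP; split.
    exact: (measurableT_comp mg mp).
  rewrite (@ge0_integral_tuperm n p (fun t => `|(g t)%:E|%E))//.
  by apply: measurableT_comp.
by move=> [/(H (fun t => complex.Re (f t))) f1 /(H (fun t => complex.Im (f t))) f2].
Qed.

Lemma cintegral_tuperm n (p : 'S_n) (f : n.-tuple bT -> R[i]) :
  cintegrable (@sigman R T sigma n) f ->
  cintegral (@sigman R T sigma n) (fun t => f (tuperm p t)) =
  cintegral (@sigman R T sigma n) f.
Proof.
move=> fi; have mp := @measurable_tuperm _ bT n p.
have := cintegral_pushforward mp (cintegrable_meas fi) (cintegrable_tuperm p fi).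
by move=> <-; rewrite /cintegral !integral_pushforward_tuperm.
Qed.

Lemma cmeasurable_tuperm n (p : 'S_n) (f : n.-tuple bT -> R[i]) :
  cmeasurable setT f -> cmeasurable setT (fun t : n.-tuple bT => f (tuperm p t)).
Proof. by move=> mf; apply: cmeasurable_comp mf _; exact: measurable_tuperm. Qed.

Lemma sqnorm_tuperm n (p : 'S_n) (f : n.-tuple bT -> R[i]) :
  cmeasurable setT f ->
  sqnorm (@sigman R T sigma n) (fun t => f (tuperm p t)) =
  sqnorm (@sigman R T sigma n) f.
Proof.
move=> mf; apply: (@ge0_integral_tuperm n p (fun t => (normsq (f t))%:E)).
  exact/measurable_EFinP/measurable_normsq.
by move=> t; rewrite lee_fin normsq_ge0.
Qed.

Lemma ae_tuperm n (p : 'S_n) (P : n.-tuple bT -> Prop) :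
  {ae @sigman R T sigma n, forall t, P t} ->
  {ae @sigman R T sigma n, forall t, P (tuperm p t)}.
Proof.
move=> [N [mN N0 PN]]; exists (tuperm p @^-1` N); split.
- by rewrite -[X in measurable X]setTI; exact: measurable_tuperm.
- by rewrite -[LHS]/(pushforward _ _ _) sigman_tuperm.
- by move=> t /= Pt; apply: PN.
Qed.

Lemma sqnorm_sigmanS n (f : n.+1.-tuple bT -> R[i]) : cmeasurable setT f ->
  (sqnorm (@sigman R T sigma n.+1) f =
   \int[@sigman R T sigma n]_t sqnorm sigma (fun x => f (tcons (x, t))))%E.
Proof.
move=> mf; rewrite /sqnorm ge0_integral_sigmanS_swap//.
  exact/measurable_EFinP/measurable_normsq.
by move=> t; rewrite lee_fin normsq_ge0.
Qed.

Section integrable.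
Variables (n : nat) (f : n.+1.-tuple bT -> R[i]).
Hypothesis fi : cintegrable (@sigman R T sigma n.+1) f.

Let mf : cmeasurable setT f. Proof. exact: cintegrable_meas fi. Qed.

Lemma cintegrable_sigmanS :
  cintegrable (sigma \x @sigman R T sigma n)%E (fun z => f (tcons z)).
Proof.
exact: (@cintegrable_pushforward _ _ _ _ _
  (product_measure1 sigma (@sigman R T sigma n)) _ (@measurable_tcons _ bT n) _ mf fi).
Qed.

Lemma cintegral_sigmanS :
  cintegral (@sigman R T sigma n.+1) f =
  cintegral sigma (fun x => cintegral (@sigman R T sigma n) (fun t => f (tcons (x, t)))).
Proof.
rewrite (cfubini1 cintegrable_sigmanS).
exact: (@cintegral_pushforward _ _ _ _ _
  (product_measure1 sigma (@sigman R T sigma n)) _ (@measurable_tcons _ bT n) _ mf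
  cintegrable_sigmanS).
Qed.

Lemma cintegral_sigmanS_swap :
  cintegral (@sigman R T sigma n.+1) f =
  cintegral (@sigman R T sigma n) (fun t => cintegral sigma (fun x => f (tcons (x, t)))).
Proof.
rewrite (cfubini2 cintegrable_sigmanS).
exact: (@cintegral_pushforward _ _ _ _ _
  (product_measure1 sigma (@sigman R T sigma n)) _ (@measurable_tcons _ bT n) _ mf
  cintegrable_sigmanS).
Qed.

Lemma ae_cintegrable_sigmanS :
  {ae @sigman R T sigma n, forall t, cintegrable sigma (fun x => f (tcons (x, t)))}.
Proof. exact: (ae_cintegrable2 cintegrable_sigmanS). Qed.

End integrable.

End sigma_power_invariance.

(** * The Q-symmetric Fock space *)
Section symmetrization_theory.
Context {R : realType} {T : completePseudoMetricType R}.
Variable sigma : {sigma_finite_measure set (borel T) -> \bar R}.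
Local Notation bT := (borel T).
Variable Q : T -> T -> R[i].
Hypothesis mQ : cmeasurable setT (fun z : bT * bT => Q z.1 z.2).
Hypothesis Qnorm : forall s t, normsq (Q s t) = 1.
Hypothesis Qconj : forall s t, Q s t = (Q t s)^*.

Lemma kernel_mulC s t : Q s t * Q t s = 1.
Proof. by rewrite [Q t s]Qconj mul_conjc_normsq Qnorm. Qed.

Definition cocycle n (p : 'S_n) (t : n.-tuple T) : R[i] :=
  \prod_(a < n) \prod_(b < n | (a < b)%N && ((p^-1)%g b < (p^-1)%g a)%N)
    Q (tnth t a) (tnth t b).

Lemma PsiE n (p : 'S_n) (f : n.-tuple T -> R[i]) (t : n.-tuple T) :
  Psi Q p f t = cocycle p t * f (@tuperm _ bT n p t).
Proof. by []. Qed.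

Lemma normsq_prod (I : Type) (r : seq I) (P : pred I) (F : I -> R[i]) :
  (forall i, P i -> normsq (F i) = 1) -> normsq (\prod_(i <- r | P i) F i) = 1.
Proof.
move=> F1; elim/big_ind : _ => //; first exact: normsq1.
by move=> x y x1 y1; rewrite normsqM x1 y1 mulr1.
Qed.

Lemma normsq_cocycle n (p : 'S_n) t : normsq (cocycle p t) = 1.
Proof.
by apply: normsq_prod => a _; apply: normsq_prod => b _; exact: Qnorm.
Qed.

Lemma cmeasurable_kernel d (X : measurableType d) (g h : X -> bT) :
  measurable_fun setT g -> measurable_fun setT h ->
  cmeasurable setT (fun x => Q (g x) (h x)).
Proof.
move=> mg mh; apply: (cmeasurable_comp (h := fun x => (g x, h x)) mQ).
exact: measurable_fun_pair.
Qed.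

Lemma cmeasurable_cocycle n (p : 'S_n) :
  @cmeasurable R _ (n.-tuple bT) setT (cocycle p).
Proof.
apply: cmeasurable_prod => a _; apply: cmeasurable_prod => b _.
by apply: cmeasurable_kernel; exact: measurable_tnth.
Qed.

Lemma cmeasurable_Psi n (p : 'S_n) (f : n.-tuple bT -> R[i]) :
  cmeasurable setT f -> @cmeasurable R _ (n.-tuple bT) setT (Psi Q p f).
Proof.
move=> mf; apply: cmeasurableM (cmeasurable_cocycle p) _.
exact: cmeasurable_tuperm.
Qed.

Lemma sqnorm_Psi n (p : 'S_n) (f : n.-tuple bT -> R[i]) : cmeasurable setT f ->
  sqnorm (@sigman R T sigma n) (Psi Q p f : n.-tuple bT -> _) =
  sqnorm (@sigman R T sigma n) f.
Proof.
move=> mf; rewrite -(sqnorm_tuperm sigma p mf); apply: eq_integral => t _.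
by rewrite PsiE normsqM normsq_cocycle mul1r.
Qed.

Lemma L2_Psi n (p : 'S_n) (f : n.-tuple bT -> R[i]) :
  L2 sigma f -> L2 sigma (Psi Q p f).
Proof.
by move=> [mf foo]; split; [exact: cmeasurable_Psi|rewrite sqnorm_Psi].
Qed.

Lemma aeq_refl n (f : n.-tuple T -> R[i]) : aeq sigma f f.
Proof. exact: aeW. Qed.

Lemma aeq_sym n (f g : n.-tuple T -> R[i]) : aeq sigma f g -> aeq sigma g f.
Proof. exact: filterS. Qed.

Lemma aeq_trans n (g f h : n.-tuple T -> R[i]) :
  aeq sigma f g -> aeq sigma g h -> aeq sigma f h.
Proof. by apply: filterS2 => t -> ->. Qed.

Lemma aeq_lin n (c : R[i]) (f f' g g' : n.-tuple T -> R[i]) :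
  aeq sigma f f' -> aeq sigma g g' ->
  aeq sigma (fun t => c * f t + g t) (fun t => c * f' t + g' t).
Proof. by apply: filterS2 => t -> ->. Qed.

Lemma aeq_Psi n (p : 'S_n) (f g : n.-tuple T -> R[i]) :
  aeq sigma f g -> aeq sigma (Psi Q p f) (Psi Q p g).
Proof.
move=> /(ae_tuperm p); apply: filterS => t fg.
by rewrite !PsiE fg.
Qed.

Lemma Psi1 n (f : n.-tuple T -> R[i]) : Psi Q 1%g f = f.
Proof.
apply/funext => t; rewrite PsiE /cocycle big1 ?mul1r.
  by rewrite (@tuperm1 _ bT).
move=> a _; rewrite big1// => b /andP[ab]; rewrite invg1 !perm1.
by rewrite ltnNge (ltnW ab).
Qed.

Lemma PsiK n (p : 'S_n) (f : n.-tuple T -> R[i]) :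
  Psi Q p (Psi Q (p^-1)%g f) = f.
Proof. by rewrite Psi_comp ?mulVg ?Psi1//; exact: kernel_mulC. Qed.

Lemma L2_lin n (c : R[i]) (f g : n.-tuple bT -> R[i]) :
  L2 sigma f -> L2 sigma g -> L2 sigma (fun t => c * f t + g t).
Proof. by move=> f2 g2; apply: (@cL2D _ _ _ (@sigman R T sigma n)) (cL2Z c f2) g2. Qed.

Lemma ip2_lin n (c : R[i]) (f g h : n.-tuple bT -> R[i]) :
  L2 sigma f -> L2 sigma g -> L2 sigma h ->
  ip2 sigma (fun t => c * f t + g t) h = c * ip2 sigma f h + ip2 sigma g h.
Proof.
move=> f2 g2 h2; rewrite /ip2 -cintegralZ -?cintegralD//.
- by apply: eq_cintegral => t; rewrite mulrDl mulrA.
- exact/cintegrableZ/cL2_ip_integrable.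
- exact: cL2_ip_integrable.
- exact: cL2_ip_integrable.
Qed.

Lemma ip2C n (f g : n.-tuple bT -> R[i]) :
  L2 sigma f -> L2 sigma g -> ip2 sigma f g = (ip2 sigma g f)^*.
Proof.
move=> f2 g2; rewrite /ip2 -cintegralJ//; last exact: cL2_ip_integrable.
by apply: eq_cintegral => t; rewrite rmorphM/= conjCK mulrC.
Qed.

Lemma ip2_linr n (c : R[i]) (f g h : n.-tuple bT -> R[i]) :
  L2 sigma f -> L2 sigma g -> L2 sigma h ->
  ip2 sigma h (fun t => c * f t + g t) = c^* * ip2 sigma h f + ip2 sigma h g.
Proof.
move=> f2 g2 h2; rewrite ip2C//; last exact: L2_lin.
by rewrite ip2_lin// rmorphD rmorphM/= -!ip2C.
Qed.

Lemma ip2_ae n (f f' g g' : n.-tuple bT -> R[i]) :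
  L2 sigma f -> L2 sigma f' -> L2 sigma g -> L2 sigma g' ->
  aeq sigma f f' -> aeq sigma g g' -> ip2 sigma f g = ip2 sigma f' g'.
Proof.
move=> [f2 _] [f2' _] [g2 _] [g2' _] ff gg; apply: ae_eq_cintegral.
- by apply: cmeasurableM => //; exact: cmeasurableJ.
- by apply: cmeasurableM => //; exact: cmeasurableJ.
- by apply: filterS2 ff gg => t -> ->.
Qed.

Lemma ip2_Psi n (p : 'S_n) (f g : n.-tuple bT -> R[i]) :
  L2 sigma f -> L2 sigma g ->
  ip2 sigma (Psi Q p f) (Psi Q p g) = ip2 sigma f g.
Proof.
move=> f2 g2; rewrite /ip2 -[RHS](cintegral_tuperm p); last exact: cL2_ip_integrable.
apply: eq_cintegral => t; rewrite !PsiE rmorphM/= mulrACA mul_conjc_normsq.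
by rewrite normsq_cocycle mul1r.
Qed.

Lemma ip2_Psi_adj n (p : 'S_n) (f g : n.-tuple bT -> R[i]) :
  L2 sigma f -> L2 sigma g ->
  ip2 sigma (Psi Q p f) g = ip2 sigma f (Psi Q (p^-1)%g g).
Proof.
by move=> f2 g2; rewrite -{1}(PsiK p g) ip2_Psi//; exact: L2_Psi.
Qed.

Lemma L2_sum n (I : Type) (r : seq I) (F : I -> n.-tuple bT -> R[i]) :
  (forall i, L2 sigma (F i)) -> L2 sigma (fun t => \sum_(i <- r) F i t).
Proof. by move=> F2; apply: (@cL2_sum _ _ _ (@sigman R T sigma n)) => i _; exact: F2. Qed.

Lemma L2_Psym n (f : n.-tuple bT -> R[i]) : L2 sigma f -> L2 sigma (Psym Q f).
Proof. by move=> f2; apply: cL2Z; apply: L2_sum => p; exact: L2_Psi. Qed.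

Lemma Psym_lin n (c : R[i]) (f g : n.-tuple T -> R[i]) t :
  Psym Q (fun t => c * f t + g t) t = c * Psym Q f t + Psym Q g t.
Proof.
rewrite /Psym [c * _]mulrCA -mulrDr; congr (_ * _).
rewrite mulr_sumr -big_split/=.
by apply: eq_bigr => p _; rewrite !PsiE mulrDr mulrCA.
Qed.

Lemma aeq_Psym n (f g : n.-tuple T -> R[i]) :
  aeq sigma f g -> aeq sigma (Psym Q f) (Psym Q g).
Proof.
move=> fg; have := @ae_forall_fin _ _ _ (@sigman R T sigma n) _
  (fun (p : 'S_n) t => Psi Q p f t = Psi Q p g t) (fun p => aeq_Psi p fg).
apply: ae_mono => t h; rewrite /Psym; congr (_ * _).
by apply: eq_bigr.
Qed.

Lemma fact_neq0 n : n`!%:R != 0 :> R[i].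
Proof. by rewrite pnatr_eq0 -lt0n fact_gt0. Qed.

(** An average over the whole group absorbs one more translation. *)
Lemma Psi_Psym n (p : 'S_n) (f : n.-tuple T -> R[i]) : Psi Q p (Psym Q f) = Psym Q f.
Proof.
apply/funext => t; rewrite {1}PsiE /Psym mulrCA mulr_sumr; congr (_ * _).
rewrite [RHS](reindex_inj (@mulIg _ p)) /=; apply: eq_bigr => q _.
by rewrite -(Psi_comp _ _ _ kernel_mulC).
Qed.

Lemma Psym_fixed n (f : n.-tuple T -> R[i]) t :
  (forall p : 'S_n, Psi Q p f t = f t) -> Psym Q f t = f t.
Proof.
move=> pf; rewrite /Psym (eq_bigr (fun=> f t))//.
rewrite sumr_const card_Sn -[f t *+ _]mulr_natl mulrA mulVf ?mul1r//.
Qed.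

Lemma Psym_idem n (f : n.-tuple T -> R[i]) : Psym Q (Psym Q f) = Psym Q f.
Proof. by apply/funext => t; apply: Psym_fixed => p; rewrite Psi_Psym. Qed.

Lemma ip2_suml n (I : Type) (r : seq I) (F : I -> n.-tuple bT -> R[i])
    (g : n.-tuple bT -> R[i]) : (forall i, L2 sigma (F i)) -> L2 sigma g ->
  ip2 sigma (fun t => \sum_(i <- r) F i t) g = \sum_(i <- r) ip2 sigma (F i) g.
Proof.
move=> F2 g2; rewrite /ip2 -cintegral_sum.
  by apply: eq_cintegral => t; rewrite mulr_suml.
by move=> i _; exact: cL2_ip_integrable (F2 i) g2.
Qed.

Lemma ip2Z n (c : R[i]) (f g : n.-tuple bT -> R[i]) : L2 sigma f -> L2 sigma g ->
  ip2 sigma (fun t => c * f t) g = c * ip2 sigma f g.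
Proof.
move=> f2 g2; rewrite /ip2 -cintegralZ; last exact: cL2_ip_integrable.
by apply: eq_cintegral => t; rewrite mulrA.
Qed.

Lemma ip2_sumr n (I : Type) (r : seq I) (F : I -> n.-tuple bT -> R[i])
    (g : n.-tuple bT -> R[i]) : (forall i, L2 sigma (F i)) -> L2 sigma g ->
  ip2 sigma g (fun t => \sum_(i <- r) F i t) = \sum_(i <- r) ip2 sigma g (F i).
Proof.
move=> F2 g2; rewrite ip2C ?ip2_suml//; last exact: L2_sum.
by rewrite rmorph_sum/=; apply: eq_bigr => i _; rewrite -ip2C.
Qed.

Lemma ip2Zr n (c : R[i]) (f g : n.-tuple bT -> R[i]) : L2 sigma f -> L2 sigma g ->
  ip2 sigma f (fun t => c * g t) = c^* * ip2 sigma f g.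
Proof.
move=> f2 g2; rewrite ip2C//; last exact: cL2Z.
by rewrite ip2Z// rmorphM/= -ip2C.
Qed.

(** The adjoint of [Psi] at p is [Psi] at the inverse of p, and inversion permutes the group, so the
    average is self-adjoint. *)
Lemma ip2_Psym n (f g : n.-tuple bT -> R[i]) : L2 sigma f -> L2 sigma g ->
  ip2 sigma (Psym Q f) g = ip2 sigma f (Psym Q g).
Proof.
move=> f2 g2; rewrite /Psym ip2Z//; last by apply: L2_sum => p; exact: L2_Psi.
rewrite ip2Zr//; last by apply: L2_sum => p; exact: L2_Psi.
rewrite fmorphV/= conjC_nat; congr (_ * _).
rewrite ip2_suml// ?ip2_sumr//; [|by move=> p; exact: L2_Psi..].
rewrite [RHS](reindex_inj invg_inj); apply: eq_bigr => p _.
by rewrite ip2_Psi_adj.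
Qed.

(** The range of an idempotent is its set of fixed points; in this form the condition no longer
    involves an auxiliary g. *)
Lemma QsymmetricP n (f : n.-tuple T -> R[i]) :
  Qsymmetric sigma Q f <-> L2 sigma f /\ aeq sigma f (Psym Q f).
Proof.
split=> [[f2 [g g2 fg]]|[f2 fPf]]; last by split => //; exists f.
split => //; apply: (aeq_trans fg); apply: aeq_sym.
by have := aeq_Psym fg; rewrite Psym_idem.
Qed.

Lemma Qsymmetric_Psym n (f : n.-tuple T -> R[i]) : L2 sigma f ->
  Qsymmetric sigma Q (Psym Q f).
Proof. by move=> f2; split; [exact: L2_Psym|exists f => //; exact: aeq_refl]. Qed.

Lemma Qsymmetric_lin n (c : R[i]) (f g : n.-tuple T -> R[i]) :
  Qsymmetric sigma Q f -> Qsymmetric sigma Q g ->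
  Qsymmetric sigma Q (fun t => c * f t + g t).
Proof.
move=> /QsymmetricP[f2 fP] /QsymmetricP[g2 gP]; apply/QsymmetricP.
split; first exact: L2_lin.
apply: (aeq_trans (aeq_lin c fP gP)); apply: aeW => t.
by rewrite Psym_lin.
Qed.

(** Used for a^0: a symmetric multiplier commutes with every [Psi], hence with the projection. *)
Lemma Psym_mul_symmetric n (w f : n.-tuple T -> R[i]) t :
  (forall (p : 'S_n) t, w (@tuperm _ bT n p t) = w t) ->
  Psym Q (fun t => w t * f t) t = w t * Psym Q f t.
Proof.
move=> wp; rewrite /Psym mulrCA; congr (_ * _); rewrite mulr_sumr.
by apply: eq_bigr => p _; rewrite !PsiE wp mulrCA.
Qed.

End symmetrization_theory.

(** * A Cauchy-Schwarz inequality and finite series *)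

Section cauchy_schwarz.
Context {R : realType} {d : measure_display} {X : measurableType d}.
Variable mu : {measure set X -> \bar R}.

(* A Cauchy-Schwarz inequality with the non-optimal factor [a + 1], which
   spares the case distinction on a vanishing [a]. *)
Lemma sqr_Rintegral_le (g h k : X -> R) :
  measurable_fun setT g -> measurable_fun setT h ->
  mu.-integrable setT (fun x => (g x ^+ 2)%:E) ->
  mu.-integrable setT (fun x => (k x)%:E) ->
  (forall x, h x ^+ 2 <= k x) ->
  (\int[mu]_x (g x * h x)) ^+ 2 <=
    (\int[mu]_x (g x ^+ 2) + 1) * \int[mu]_x (k x).
Proof.
move=> mg mh ig ik hk.
have k0 x : 0 <= k x by exact: le_trans (sqr_ge0 _) (hk x).
have amgm e x : 0 < e -> 2 * `|g x * h x| <= e * g x ^+ 2 + e^-1 * k x.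
  move=> e0; have ee : e * e^-1 = 1 by rewrite mulfV ?gt_eqF.
  have ei0 : 0 < e^-1 by rewrite invr_gt0.
  have : 0 <= e^-1 * (e * `|g x| - `|h x|) ^+ 2 by rewrite mulr_ge0 ?sqr_ge0// ltW.
  have : e^-1 * h x ^+ 2 <= e^-1 * k x by rewrite ler_pM2l.
  rewrite normrM -(real_normK (num_real (g x))) -(real_normK (num_real (h x))).
  move: (`|g x|) (`|h x|) => u v H1 H2.
  have -> : e * u ^+ 2 = e^-1 * (e * u) ^+ 2.
    by rewrite exprMn [e ^+ 2]expr2 !mulrA mulVf ?gt_eqF// mul1r.
  have E : e^-1 * (e * u - v) ^+ 2 =
      e^-1 * (e * u) ^+ 2 + e^-1 * v ^+ 2 - 2 * (e * e^-1) * (u * v) by ring.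
  by move: H2; rewrite E ee; lra.
have igh : mu.-integrable setT (fun x => (g x * h x)%:E).
  have igk : mu.-integrable setT (fun x => (g x ^+ 2)%:E + (k x)%:E)%E.
    exact: integrableD.
  apply: (le_integrable _ _ _ igk) => //.
    exact/measurable_EFinP/measurable_funM.
  move=> x _; rewrite -EFinD /= lee_fin.
  rewrite [leRHS]ger0_norm ?addr_ge0 ?sqr_ge0//.
  have := amgm 1 x ltr01; rewrite invr1 !mul1r.
  by have := normr_ge0 (g x * h x); lra.
set r := Rintegral _ _ _; set a := Rintegral _ _ _; set b := Rintegral _ _ _.
have a0 : 0 <= a by apply: Rintegral_ge0 => x _; exact: sqr_ge0.
have b0 : 0 <= b by apply: Rintegral_ge0 => x _; exact: k0.
have key e : 0 < e -> 2 * `|r| <= e * a + e^-1 * b.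
  move=> e0; rewrite -!RintegralZl// -RintegralD//; last 2 first.
  - exact: (integrableZl measurableT e ig).
  - exact: (integrableZl measurableT e^-1 ik).
  apply: (@le_trans _ _ (\int[mu]_x (2 * `|g x * h x|))).
    rewrite RintegralZl//; last exact: (integrable_norm igh).
    by rewrite ler_pM2l// le_normr_Rintegral.
  apply: le_Rintegral => //.
  - exact: (integrableZl measurableT 2 (integrable_norm igh)).
  - apply: (integrableD measurableT (integrableZl measurableT e ig)
      (integrableZl measurableT e^-1 ik)).
  - by move=> x _; exact: amgm.
have [r0|r0] := eqVneq r 0; first by rewrite r0 expr0n mulr_ge0 ?addr_ge0.
have rp : 0 < `|r| by rewrite normr_gt0.
have a1 : 0 < a + 1 by lra.
have := key (`|r| / (a + 1)) (divr_gt0 rp a1).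
rewrite invf_div => {}key.
have : `|r| * (2 * `|r|) <= `|r| * (`|r| / (a + 1) * a + (a + 1) / `|r| * b).
  by rewrite ler_pM2l.
rewrite [X in _ <= X](_ : _ = `|r| ^+ 2 * (a / (a + 1)) + (a + 1) * b); last first.
  by field; rewrite !gt_eqF.
have : `|r| ^+ 2 * (a / (a + 1)) <= `|r| ^+ 2 * 1.
  by rewrite ler_pM2l ?exprn_gt0// ler_pdivrMr// mul1r; lra.
by rewrite -[r ^+ 2](real_normK (num_real r)); nra.
Qed.

(** The factor 2 comes from estimating the real and the imaginary part separately. The summand 1
    keeps the constant positive, so that the right-hand side is infinite whenever the norm of h is,
    even for g = 0. *)
Lemma normsq_cintegral_le (g : X -> R) (h : X -> R[i]) :
  measurable_fun setT g -> mu.-integrable setT (fun x => (g x ^+ 2)%:E) ->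
  cmeasurable setT h ->
  ((normsq (cintegral mu (fun x => (g x)%:C * h x)%R))%:E <=
   (2 * (\int[mu]_x (g x ^+ 2)%R + 1))%:E * sqnorm mu h)%E.
Proof.
move=> mg ig mh; set a := Rintegral _ _ _.
have a0 : 0 <= a by apply: Rintegral_ge0 => x _; exact: sqr_ge0.
have c0 : 0 < 2 * (a + 1) by lra.
have [hoo|] := ltP (sqnorm mu h) +oo%E; last first.
  by rewrite leye_eq => /eqP ->; rewrite gt0_muley ?lte_fin// leey.
have h2 : cL2 mu h by [].
have := cL2_sqr_integrable h2; move=> ik; case: mh => mh1 mh2.
have := sqr_Rintegral_le mg mh1 ig ik (fun x => Re2_le_normsq (h x)).
have := sqr_Rintegral_le mg mh2 ig ik (fun x => Im2_le_normsq (h x)).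
rewrite -/a -(fineK (sqnorm_fin h2)) -EFinM lee_fin.
rewrite -[fine (sqnorm mu h)]/(\int[mu]_x normsq (h x)) [in X in _ -> _ -> X]/normsq.
have -> : complex.Re (cintegral mu (fun x => (g x)%:C * h x)) =
    \int[mu]_x (g x * complex.Re (h x)).
  by apply: eq_Rintegral => x _; rewrite cReM /= mul0r subr0.
have -> : complex.Im (cintegral mu (fun x => (g x)%:C * h x)) =
    \int[mu]_x (g x * complex.Im (h x)).
  by apply: eq_Rintegral => x _; rewrite cImM /= mul0r addr0.
lra.
Qed.

End cauchy_schwarz.

Lemma cseries_fin {R : realType} (u : nat -> R[i]) N :
  (forall n, (N <= n)%N -> u n = 0) -> cseries u = \sum_(n < N) u n.
Proof.
move=> u0.
have H (v : nat -> R) : (forall n, (N <= n)%N -> v n = 0) ->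
    limn (series v) = \sum_(n < N) v n.
  move=> v0; apply/cvg_lim => //; apply/cvg_ballP => e e0; exists N => // n /= Nn.
  rewrite /series /= (big_cat_nat _ Nn)//= [X in _ + X]big1_seq ?addr0.
    by rewrite big_mkord; exact: ballxx.
  by move=> i; rewrite mem_index_iota => /and3P[_ Ni _]; exact: v0.
rewrite /cseries !H; try by move=> n /u0->.
elim: N {u0 H} => [|N IH]; first by rewrite !big_ord0.
by rewrite !big_ord_recr /= -IH; case: (u N) => a b.
Qed.

Lemma nneseries_fin {R : realType} (u : nat -> \bar R) N :
  (forall n, (N <= n)%N -> u n = 0%E) ->
  (\sum_(0 <= n <oo) u n = \sum_(n < N) u n)%E.
Proof.
move=> u0; apply/cvg_lim => //; apply: cvg_near_cst; exists N => // n /= Nn.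
rewrite (big_cat_nat _ Nn)//= [X in (_ + X)%E]big1_seq ?adde0 ?big_mkord//.
by move=> i; rewrite mem_index_iota => /and3P[_ Ni _]; exact: u0.
Qed.

(** * Inner product and norm of the Fock space *)

Section fock_space.
Context {R : realType} {T : completePseudoMetricType R}.
Variable sigma : {sigma_finite_measure set (borel T) -> \bar R}.
Local Notation bT := (borel T).
Local Notation fvec := (fvec R T).
Implicit Types F G H : fvec.

Lemma fvec_lin (c : R[i]) F G n t : (c *: F + G) n t = c * F n t + G n t.
Proof. by []. Qed.

Lemma fvec_ext F G : (forall n t, F n t = G n t) -> F = G.
Proof. by move=> FG; apply: functional_extensionality_dep => n; apply/funext. Qed.

Definition l2 F : Prop := forall n, L2 sigma (F n).
Definition bdd N F : Prop := forall n, (N <= n)%N -> aeq sigma (F n) (fun=> 0).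

Lemma feq_refl F : feq sigma F F.
Proof. by move=> n; exact: aeq_refl. Qed.
Lemma feq_sym F G : feq sigma F G -> feq sigma G F.
Proof. by move=> FG n; apply: aeq_sym; exact: FG. Qed.
Lemma feq_trans G F H : feq sigma F G -> feq sigma G H -> feq sigma F H.
Proof. by move=> FG GH n; apply: aeq_trans (FG n) (GH n). Qed.
Lemma feq_lin (c : R[i]) F F' G G' : feq sigma F F' -> feq sigma G G' ->
  feq sigma (c *: F + G) (c *: F' + G').
Proof. by move=> FF GG n; exact: aeq_lin (FF n) (GG n). Qed.

Lemma l2_0 : l2 0.
Proof. by move=> n; exact: (@cL2_0 _ _ _ (@sigman R T sigma n)). Qed.

Lemma l2_lin (c : R[i]) F G : l2 F -> l2 G -> l2 (c *: F + G).
Proof. by move=> F2 G2 n; exact: L2_lin (F2 n) (G2 n). Qed.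

Lemma bdd_le N M F : (N <= M)%N -> bdd N F -> bdd M F.
Proof. by move=> NM FN n Mn; apply: FN; exact: leq_trans NM Mn. Qed.

Lemma bdd_lin (c : R[i]) N F G : bdd N F -> bdd N G -> bdd N (c *: F + G).
Proof.
move=> FN GN n Nn; apply: aeq_trans (aeq_lin c (FN n Nn) (GN n Nn)) _.
by apply: aeW => t; rewrite mulr0 addr0.
Qed.

Lemma ip20 n (g : n.-tuple bT -> R[i]) : ip2 sigma (fun=> 0) g = 0.
Proof.
rewrite /ip2 -[RHS](@cintegral0 _ _ _ (@sigman R T sigma n)).
by apply: eq_cintegral => t; rewrite mul0r.
Qed.

(** One finite vector cuts the series to a finite sum; the other may be any square integrable
    family, as happens when a Fock vector is tested against finite ones. *)
Lemma fipEl N F G : l2 F -> l2 G -> bdd N F ->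
  fip sigma F G = \sum_(n < N) n`!%:R * ip2 sigma (F n) (G n).
Proof.
move=> F2 G2 FN; apply: cseries_fin => n Nn.
rewrite (ip2_ae (F2 n) (l2_0 n) (G2 n) (G2 n) (FN n Nn) (aeq_refl _ _)).
by rewrite ip20 mulr0.
Qed.

Lemma fipEr N F G : l2 F -> l2 G -> bdd N G ->
  fip sigma F G = \sum_(n < N) n`!%:R * ip2 sigma (F n) (G n).
Proof.
move=> F2 G2 GN; apply: cseries_fin => n Nn.
rewrite (ip2_ae (F2 n) (F2 n) (G2 n) (l2_0 n) (aeq_refl _ _) (GN n Nn)).
by rewrite ip2C ?ip20 ?rmorph0 ?mulr0//; exact: l2_0.
Qed.

Lemma fip_linl (c : R[i]) N F G H : l2 F -> l2 G -> l2 H -> bdd N H ->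
  fip sigma (c *: F + G) H = c * fip sigma F H + fip sigma G H.
Proof.
move=> F2 G2 H2 HN; rewrite !(@fipEr N)//; last exact: l2_lin.
rewrite mulr_sumr -big_split; apply: eq_bigr => n _ /=.
by rewrite (ip2_lin c (F2 n) (G2 n) (H2 n)) mulrDr mulrCA.
Qed.

Lemma fip_linr (c : R[i]) N F G H : l2 F -> l2 G -> l2 H -> bdd N H ->
  fip sigma H (c *: F + G) = c^* * fip sigma H F + fip sigma H G.
Proof.
move=> F2 G2 H2 HN; rewrite !(@fipEl N)//; last exact: l2_lin.
rewrite mulr_sumr -big_split; apply: eq_bigr => n _ /=.
by rewrite (ip2_linr c (F2 n) (G2 n) (H2 n)) mulrDr mulrCA.
Qed.

Lemma fipC N F G : l2 F -> l2 G -> bdd N F ->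
  fip sigma F G = (fip sigma G F)^*.
Proof.
move=> F2 G2 FN; rewrite (fipEl F2 G2 FN) (fipEr G2 F2 FN) rmorph_sum /=.
apply: eq_bigr => n _; rewrite rmorphM/= conjC_nat.
by rewrite (ip2C (F2 n) (G2 n)).
Qed.

Lemma fip_feq N F F' G G' : l2 F -> l2 F' -> l2 G -> l2 G' -> bdd N G ->
  feq sigma F F' -> feq sigma G G' -> fip sigma F G = fip sigma F' G'.
Proof.
move=> F2 F2' G2 G2' GN FF GG; have GN' : bdd N G'.
  by move=> n Nn; apply: aeq_trans (aeq_sym (GG n)) (GN n Nn).
rewrite (fipEr F2 G2 GN) (fipEr F2' G2' GN'); apply: eq_bigr => n _.
by rewrite (ip2_ae (F2 n) (F2' n) (G2 n) (G2' n) (FF n) (GG n)).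
Qed.

Lemma fnorm2E N F : l2 F -> bdd N F ->
  fnorm2 sigma F = (\sum_(n < N) (n`!%:R)%:E * sqnorm (@sigman R T sigma n) (F n))%E.
Proof.
move=> F2 FN; apply: nneseries_fin => n Nn.
by rewrite (sqnorm_eq0 _ (F2 n).1).2 ?mule0//; exact: FN.
Qed.

Lemma fnorm2_ge0 F : (0 <= fnorm2 sigma F)%E.
Proof.
apply: nneseries_ge0 => n _ _; apply: mule_ge0; first by rewrite lee_fin.
exact: (@sqnorm_ge0 _ _ _ (@sigman R T sigma n)).
Qed.

Lemma fnorm2_fin N F : l2 F -> bdd N F -> fnorm2 sigma F \is a fin_num.
Proof.
move=> F2 FN; rewrite (fnorm2E F2 FN); apply/sum_fin_numP => n _ _.
by rewrite fin_numM// (@sqnorm_fin _ _ _ (@sigman R T sigma n) _ (F2 n)).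
Qed.

Lemma fip_self N F : l2 F -> bdd N F ->
  fip sigma F F = (fine (fnorm2 sigma F))%:C.
Proof.
move=> F2 FN; rewrite (fipEl F2 F2 FN) (fnorm2E F2 FN).
rewrite -sum_fine; last first.
  move=> n _; rewrite fin_numM//; exact: (@sqnorm_fin _ _ _ (@sigman R T sigma n) _ (F2 n)).
rewrite rmorph_sum/=; apply: eq_bigr => n _.
rewrite fineM//; last exact: (@sqnorm_fin _ _ _ (@sigman R T sigma n) _ (F2 n)).
rewrite rmorphM/= rmorph_nat; congr (_ * _).
exact: (@ip_self _ _ _ (@sigman R T sigma n) _ (F2 n)).
Qed.

Lemma fnorm2D_le N F G : l2 F -> l2 G -> bdd N F -> bdd N G ->
  (fnorm2 sigma (F + G)%R <= 2%:E * (fnorm2 sigma F + fnorm2 sigma G))%E.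
Proof.
move=> F2 G2 FN GN.
have E : F + G = 1 *: F + G by rewrite scale1r.
have FG2 : l2 (F + G) by rewrite E; exact: l2_lin.
have FGN : bdd N (F + G) by rewrite E; exact: bdd_lin.
rewrite (fnorm2E FG2 FGN) (fnorm2E F2 FN) (fnorm2E G2 GN).
rewrite -big_split/= ge0_sume_distrr; last first.
  move=> n _; apply: adde_ge0; (apply: mule_ge0; first by rewrite lee_fin);
    exact: (@sqnorm_ge0 _ _ _ (@sigman R T sigma n)).
apply: lee_sum => n _.
rewrite -muleDr//; last first.
  by rewrite ge0_adde_def// inE (@sqnorm_ge0 _ _ _ (@sigman R T sigma n)).
rewrite muleCA; apply: lee_wpmul2l; first by rewrite lee_fin.
exact: (@sqnormD_le _ _ _ (@sigman R T sigma n) _ _ (F2 n).1 (G2 n).1).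
Qed.

Lemma fnorm2Z (c : R[i]) N F : l2 F -> bdd N F ->
  fnorm2 sigma (c *: F) = ((normsq c)%:E * fnorm2 sigma F)%E.
Proof.
move=> F2 FN.
have E : c *: F = c *: F + 0 by rewrite addr0.
have cF2 : l2 (c *: F) by rewrite E; apply: l2_lin => //; exact: l2_0.
have cFN : bdd N (c *: F).
  by rewrite E; apply: bdd_lin => // n Nn; exact: aeq_refl.
rewrite (fnorm2E F2 FN) (fnorm2E cF2 cFN) ge0_sume_distrr; last first.
  move=> n _; apply: mule_ge0; first by rewrite lee_fin.
  exact: (@sqnorm_ge0 _ _ _ (@sigman R T sigma n)).
apply: eq_bigr => n _; rewrite muleCA; congr (_ * _)%E.
exact: (@sqnormZ _ _ _ (@sigman R T sigma n) c _ (F2 n).1).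
Qed.

Lemma feq_fnorm2 F G : l2 F -> l2 G -> feq sigma F G ->
  fnorm2 sigma F = fnorm2 sigma G.
Proof.
move=> F2 G2 FG; apply: eq_eseriesr => n _; congr (_ * _)%E.
exact: (ae_eq_sqnorm (F2 n).1 (G2 n).1 (FG n)).
Qed.

Section symmetric.
Variable Q : T -> T -> R[i].
Hypothesis mQ : cmeasurable setT (fun z : bT * bT => Q z.1 z.2).
Hypothesis Qnorm : forall s t, normsq (Q s t) = 1.
Hypothesis Qconj : forall s t, Q s t = (Q t s)^*.

Lemma is_fin_l2 F : is_fin sigma Q F -> l2 F.
Proof. by move=> [FQ _] n; have [] := FQ n. Qed.

Lemma is_fin_bdd F : is_fin sigma Q F -> exists N, bdd N F.
Proof. by move=> [_ [N FN]]; exists N. Qed.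

Lemma is_fin_lin (c : R[i]) F G :
  is_fin sigma Q F -> is_fin sigma Q G -> is_fin sigma Q (c *: F + G).
Proof.
move=> [FQ [N FN]] [GQ [M GM]]; split.
  by move=> n; exact: (Qsymmetric_lin Qnorm Qconj c (FQ n) (GQ n)).
exists (maxn N M); apply: bdd_lin.
  exact: bdd_le (leq_maxl _ _) FN.
exact: bdd_le (leq_maxr _ _) GM.
Qed.

Lemma Qsymmetric0 n : Qsymmetric sigma Q (fun _ : n.-tuple T => 0).
Proof.
apply/(QsymmetricP sigma Qnorm Qconj); split; first exact: (l2_0 n).
apply: aeW => t; rewrite /Psym big1 ?mulr0// => p _.
by rewrite /Psi mulr0.
Qed.

Lemma is_fin0 : is_fin sigma Q 0.
Proof.
split; first by move=> n; exact: Qsymmetric0.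
by exists 0%N => n _; exact: aeq_refl.
Qed.

Lemma is_finD F G :
  is_fin sigma Q F -> is_fin sigma Q G -> is_fin sigma Q (F + G).
Proof. by move=> fF fG; rewrite -[F]scale1r; exact: is_fin_lin. Qed.

Lemma is_finZ (c : R[i]) F : is_fin sigma Q F -> is_fin sigma Q (c *: F).
Proof. by move=> fF; rewrite -[c *: F]addr0; apply: is_fin_lin => //; exact: is_fin0. Qed.

Lemma is_finB F G :
  is_fin sigma Q F -> is_fin sigma Q G -> is_fin sigma Q (F - G).
Proof.
by move=> fF fG; apply: is_finD => //; rewrite -scaleN1r; exact: is_finZ.
Qed.

Lemma is_fin_fock F : is_fin sigma Q F -> is_fock sigma Q F.
Proof.
move=> fF; split; first by case: fF.
have [N FN] := is_fin_bdd fF.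
by rewrite -ge0_fin_numE ?fnorm2_ge0// (fnorm2_fin (is_fin_l2 fF) FN).
Qed.

Lemma is_fock_l2 F : is_fock sigma Q F -> l2 F.
Proof. by move=> [FQ _] n; have [] := FQ n. Qed.

Lemma fip_fin_linl (c : R[i]) F G H : l2 F -> l2 G -> is_fin sigma Q H ->
  fip sigma (c *: F + G) H = c * fip sigma F H + fip sigma G H.
Proof.
move=> F2 G2 fH; have [N HN] := is_fin_bdd fH.
exact: fip_linl F2 G2 (is_fin_l2 fH) HN.
Qed.

Lemma fip_fin_linr (c : R[i]) F G H : l2 F -> l2 G -> is_fin sigma Q H ->
  fip sigma H (c *: F + G) = c^* * fip sigma H F + fip sigma H G.
Proof.
move=> F2 G2 fH; have [N HN] := is_fin_bdd fH.
exact: fip_linr F2 G2 (is_fin_l2 fH) HN.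
Qed.

Lemma fip_finC F G : is_fin sigma Q F -> l2 G ->
  fip sigma F G = (fip sigma G F)^*.
Proof.
move=> fF G2; have [N FN] := is_fin_bdd fF.
exact: fipC (is_fin_l2 fF) G2 FN.
Qed.

Definition single n F : fvec := fun m t => if m == n then F m t else 0.

Lemma is_fin_single n F : Qsymmetric sigma Q (F n) -> is_fin sigma Q (single n F).
Proof.
move=> FQ; split => [m|].
  rewrite /single; have [->|_] := eqVneq m n; first by [].
  exact: Qsymmetric0.
exists n.+1 => m nm; rewrite /single.
by rewrite gtn_eqF//; exact: aeq_refl.
Qed.

(* Testing against the single components [G n - G' n] separates vectors. *)
Lemma fip_separates G G' : is_fock sigma Q G -> is_fock sigma Q G' ->
  (forall H, is_fin sigma Q H -> fip sigma H G = fip sigma H G') ->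
  feq sigma G G'.
Proof.
move=> fG fG' E n.
have G2 := is_fock_l2 fG; have G2' := is_fock_l2 fG'.
pose D : fvec := -1 *: G' + G.
have D2 : l2 D by exact: l2_lin.
have DQ : Qsymmetric sigma Q (D n).
  exact: (Qsymmetric_lin Qnorm Qconj (-1) (fG'.1 n) (fG.1 n)).
have fD := is_fin_single DQ.
have : fip sigma (single n D) D = 0.
  rewrite /D fip_fin_linr//.
  by rewrite E// rmorphN rmorph1 mulN1r addNr.
have sB : bdd n.+1 (single n D).
  by move=> m nm; rewrite /single gtn_eqF//; exact: aeq_refl.
rewrite (fipEl (is_fin_l2 fD) D2 sB) big_ord_recr /= big1 ?add0r; last first.
  by move=> m _; rewrite /single ltn_eqF// ip20 mulr0.
rewrite /single eqxx => /eqP; rewrite mulf_eq0 (negbTE (fact_neq0 _))/= => /eqP.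
rewrite /ip2 (@ip_self _ _ _ (@sigman R T sigma n) _ (D2 n)) => /(congr1 (@complex.Re _)) /= D0.
have : sqnorm (@sigman R T sigma n) (D n) = 0%E.
  by rewrite -(fineK (sqnorm_fin (D2 n))) D0.
move/(sqnorm_eq0 _ (D2 n).1); apply: ae_mono => t.
by rewrite /D fvec_lin mulN1r => /eqP; rewrite addrC subr_eq0 => /eqP.
Qed.

End symmetric.

End fock_space.

(** * Creation and annihilation on square integrable kernels *)

Section creation_annihilation.
Context {R : realType} {T : completePseudoMetricType R}.
Variable sigma : {sigma_finite_measure set (borel T) -> \bar R}.
Local Notation bT := (borel T).

(** Square integrability bounds [tensor] and [fcontract]; boundedness of f is what [a_zero]
    requires. *)
Definition admissible (f : T -> R) : Prop :=
  [/\ measurable_fun (setT : set bT) f, exists C : R, forall x, `|f x| <= C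
    & sigma.-integrable (setT : set bT) (fun x => (f x ^+ 2)%:E)].

Variable f : T -> R.
Hypothesis fadm : admissible f.

Let mf : measurable_fun (setT : set bT) f. Proof. by case: fadm. Qed.
Let f2 : sigma.-integrable (setT : set bT) (fun x => (f x ^+ 2)%:E).
Proof. by case: fadm. Qed.

Definition tensor m (F : m.-tuple T -> R[i]) : m.+1.-tuple T -> R[i] :=
  fun t => (f (thead t))%:C * F [tuple of behead t].

(** The adjoint of [tensor], see [ip2_tensor]; f is real, so no conjugate appears. *)
Definition fcontract m (F : m.+1.-tuple T -> R[i]) : m.-tuple T -> R[i] :=
  fun t => cintegral sigma (fun x : bT => (f x)%:C * F (@tcons _ bT m (x, t))).

Lemma tensor_tcons m (F : m.-tuple T -> R[i]) x t :
  tensor F (@tcons _ bT m (x, t)) = (f x)%:C * F t.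
Proof.
by rewrite /tensor; congr (_ * F _); exact/val_inj.
Qed.

Lemma cmeasurable_tensor m (F : m.-tuple bT -> R[i]) : cmeasurable setT F ->
  @cmeasurable R _ (m.+1.-tuple bT) setT (tensor F).
Proof.
move=> mF; apply: cmeasurableM.
  by apply: cmeasurable_real; apply: (measurableT_comp mf); exact: measurable_thead.
by apply: (cmeasurable_comp mF); exact: measurable_behead.
Qed.

Lemma sqnorm_tensor m (F : m.-tuple bT -> R[i]) : cmeasurable setT F ->
  sqnorm (@sigman R T sigma m.+1) (tensor F : m.+1.-tuple bT -> _) =
  ((\int[sigma]_x (f x ^+ 2)%:E) * sqnorm (@sigman R T sigma m) F)%E.
Proof.
move=> mF; rewrite /sqnorm ge0_integral_sigmanS; last 2 first.
- exact/measurable_EFinP/measurable_normsq/cmeasurable_tensor.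
- by move=> t; rewrite lee_fin normsq_ge0.
rewrite -ge0_integralZr//; last 3 first.
- exact: (measurable_int _ f2).
- by move=> x _; rewrite lee_fin sqr_ge0.
- exact: (@sqnorm_ge0 _ _ _ (@sigman R T sigma m)).
apply: eq_integral => x _; rewrite -ge0_integralZl_EFin ?sqr_ge0//.
- apply: eq_integral => t _; rewrite tensor_tcons normsqM normsq_real.
  by rewrite EFinM.
- by move=> t _; rewrite lee_fin normsq_ge0.
- exact/measurable_EFinP/measurable_normsq.
Qed.

Lemma L2_tensor m (F : m.-tuple T -> R[i]) :
  L2 sigma F -> L2 sigma (tensor F).
Proof.
move=> [mF Foo]; split; first exact: cmeasurable_tensor.
rewrite sqnorm_tensor// lte_mul_pinfty//.
- by apply: integral_ge0 => x _; rewrite lee_fin sqr_ge0.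
- exact: integrable_fin_num.
Qed.

Lemma cmeasurable_fcontract m (F : m.+1.-tuple bT -> R[i]) : cmeasurable setT F ->
  @cmeasurable R _ (m.-tuple bT) setT (fcontract F).
Proof.
move=> mF.
apply: (@cmeasurable_cintegral _ _ _ (m.-tuple bT) bT sigma
  (fun z => (f z.2)%:C * F (tcons (z.2, z.1)))).
apply: cmeasurableM.
  by apply: cmeasurable_real; exact: measurableT_comp.
apply: (cmeasurable_comp mF); apply: (measurableT_comp (@measurable_tcons _ bT m)).
exact: measurable_fun_pair.
Qed.

Lemma cmeasurable_section m (F : m.+1.-tuple bT -> R[i]) t : cmeasurable setT F ->
  cmeasurable setT (fun x : bT => F (tcons (x, t))).
Proof.
move=> mF; apply: (cmeasurable_comp mF).
apply: (measurableT_comp (@measurable_tcons _ bT m)).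
exact: measurable_fun_pair.
Qed.

Definition fcontract_bound : R := 2 * (\int[sigma]_x (f x ^+ 2) + 1).

Lemma fcontract_bound_ge0 : 0 <= fcontract_bound.
Proof.
have : 0 <= \int[sigma]_x (f x ^+ 2) by apply: Rintegral_ge0 => x _; exact: sqr_ge0.
by rewrite /fcontract_bound; lra.
Qed.

(** Cauchy-Schwarz in the first variable for each fixed t, then Tonelli in t. *)
Lemma sqnorm_fcontract m (F : m.+1.-tuple bT -> R[i]) : cmeasurable setT F ->
  (sqnorm (@sigman R T sigma m) (fcontract F : m.-tuple bT -> _) <=
   fcontract_bound%:E * sqnorm (@sigman R T sigma m.+1) F)%E.
Proof.
move=> mF; have mn : measurable_fun setT (fun t : m.-tuple bT =>
    sqnorm sigma (fun x => F (tcons (x, t)))).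
  apply: (@measurable_fun_fubini_tonelli_F _ _ (m.-tuple bT) bT _ sigma
    (fun z => (normsq (F (tcons (z.2, z.1))))%:E)).
    apply/measurable_EFinP/measurable_normsq/(cmeasurable_comp mF).
    apply: (measurableT_comp (@measurable_tcons _ bT m)).
    exact: measurable_fun_pair.
  by move=> z; rewrite lee_fin normsq_ge0.
rewrite (sqnorm_sigmanS sigma mF) -ge0_integralZl_EFin ?fcontract_bound_ge0//; last first.
  by move=> t _; exact: sqnorm_ge0.
apply: ge0_le_integral => //.
- by move=> t _; rewrite lee_fin normsq_ge0.
- exact/measurable_EFinP/measurable_normsq/cmeasurable_fcontract.
- exact: measurable_funeM.
- by move=> t _; apply: normsq_cintegral_le => //; exact: cmeasurable_section.
Qed.

Lemma L2_fcontract m (F : m.+1.-tuple T -> R[i]) :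
  L2 sigma F -> L2 sigma (fcontract F).
Proof.
move=> [mF Foo]; split; first exact: cmeasurable_fcontract.
apply: le_lt_trans (sqnorm_fcontract mF) _.
by rewrite lte_mul_pinfty// lee_fin fcontract_bound_ge0.
Qed.

Lemma ip2_tensor m (H : m.-tuple T -> R[i]) (F : m.+1.-tuple T -> R[i]) :
  L2 sigma H -> L2 sigma F ->
  ip2 sigma (tensor H) F = ip2 sigma H (fcontract F).
Proof.
move=> H2 F2; have iHF := cL2_ip_integrable (L2_tensor H2) F2.
rewrite /ip2 (cintegral_sigmanS_swap iHF).
have [mH _] := H2; have [mF _] := F2.
apply: ae_eq_cintegral.
- apply: (@cmeasurable_cintegral _ _ _ (m.-tuple bT) bT sigma
    (fun z => tensor H (tcons (z.2, z.1)) * (F (tcons (z.2, z.1)))^*)).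
  have mc : measurable_fun setT (fun z : m.-tuple bT * bT => @tcons _ bT m (z.2, z.1)).
    apply: (measurableT_comp (@measurable_tcons _ bT m)).
    exact: measurable_fun_pair.
  apply: cmeasurableM; last by apply: cmeasurableJ; exact: cmeasurable_comp mF mc.
  exact: cmeasurable_comp (cmeasurable_tensor mH) mc.
- by apply: cmeasurableM => //; apply: cmeasurableJ; exact: cmeasurable_fcontract.
move: (ae_cintegrable_sigmanS iHF); apply: ae_mono => t it.
(* Fubini gives integrability in x only for the product with H t. Where H t is nonzero it can be
   divided out; where it vanishes both sides are 0. *)
have [H0|H0] := eqVneq (H t) 0.
  rewrite H0 mul0r -[RHS](@cintegral0 _ _ _ sigma); apply: eq_cintegral => x.
  by rewrite tensor_tcons H0 mulr0 mul0r.
have iF : cintegrable sigma (fun x : bT => (f x)%:C * F (@tcons _ bT m (x, t))).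
  apply: eq_cintegrable (cintegrableJ (cintegrableZ (H t)^-1 it)) => x.
  rewrite tensor_tcons [(H t)^-1 * _]mulrA [(f x)%:C * _]mulrC.
  by rewrite [(H t)^-1 * _]mulrA mulVf// mul1r rmorphM/= conjCK conj_realc.
rewrite /fcontract -cintegralJ// -cintegralZ; last exact: cintegrableJ.
apply: eq_cintegral => x; rewrite tensor_tcons rmorphM/= mulrA; congr (_ * _).
by rewrite mulrC conj_realc.
Qed.

End creation_annihilation.

Lemma linear_combination3 {R : pzRingType} (V : lmodType R) (c l : R)
    (a a' b b' d d' : V) : l * c = c * l ->
  (c *: a + a') + l *: (c *: b + b') + (c *: d + d') =
  c *: (a + l *: b + d) + (a' + l *: b' + d').
Proof.
by move=> lc; rewrite !scalerDr !scalerA lc [c *: a + a' + _]addrACA [LHS]addrACA.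
Qed.

(** * Field operators on finite vectors *)

Section field_operators.
Context {R : realType} {T : completePseudoMetricType R}.
Variable sigma : {sigma_finite_measure set (borel T) -> \bar R}.
Local Notation bT := (borel T).
Local Notation fvec := (fvec R T).
Implicit Types F G H : fvec.
Variable Q : T -> T -> R[i].
Hypothesis mQ : cmeasurable setT (fun z : bT * bT => Q z.1 z.2).
Hypothesis Qnorm : forall s t, normsq (Q s t) = 1.
Hypothesis Qconj : forall s t, Q s t = (Q t s)^*.

Section one_field.
Variable f : T -> R.
Hypothesis fadm : admissible sigma f.

Lemma a_plusS F m : @a_plus R T Q f F m.+1 = Psym Q (tensor f (F m)).
Proof. by []. Qed.

Lemma a_plus_lin (c : R[i]) F G :
  a_plus Q f (c *: F + G) = c *: a_plus Q f F + a_plus Q f G.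
Proof.
apply: fvec_ext => -[|n] t; rewrite fvec_lin; first by rewrite /= mulr0 addr0.
rewrite !a_plusS -Psym_lin; congr (Psym Q _ t).
by apply/funext => u; rewrite /tensor fvec_lin mulrDr mulrCA.
Qed.

Lemma bdd_a_plus N F : l2 sigma F -> bdd sigma N F -> bdd sigma N.+1 (a_plus Q f F).
Proof.
move=> F2 FN [//|n] nN.
have -> : (fun=> 0) = Psym Q (fun _ : n.+1.-tuple T => 0) :> (n.+1.-tuple T -> R[i]).
  by apply/funext => t; rewrite /Psym big1 ?mulr0// => p _; rewrite /Psi mulr0.
apply: aeq_Psym; apply/(sqnorm_eq0 (@sigman R T sigma n.+1)).
  by have [] := L2_tensor fadm (F2 n).
rewrite (sqnorm_tensor fadm (F2 n).1).
by rewrite (sqnorm_eq0 _ (F2 n).1).2 ?mule0//; exact: FN.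
Qed.

Lemma is_fin_a_plus F : is_fin sigma Q F -> is_fin sigma Q (a_plus Q f F).
Proof.
move=> fF; have F2 := is_fin_l2 fF; split.
  move=> [|n]; first exact: (Qsymmetric0 sigma Qnorm Qconj).
  by apply: (Qsymmetric_Psym mQ Qnorm); exact: L2_tensor.
by have [N FN] := is_fin_bdd fF; exists N.+1; exact: bdd_a_plus.
Qed.

(** Almost everywhere equality is passed from T^n to T^(n+1) by the norm identity [sqnorm_tensor],
    applied to the difference. *)
Lemma a_plus_feq F G : l2 sigma F -> l2 sigma G ->
  feq sigma F G -> feq sigma (a_plus Q f F) (a_plus Q f G).
Proof.
move=> F2 G2 FG [|n]; first exact: aeq_refl.
apply: aeq_Psym.
pose D : n.-tuple T -> R[i] := fun t => -1 * G n t + F n t.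
have D2 : L2 sigma D := L2_lin (-1) (G2 n) (F2 n).
have : aeq sigma (tensor f D) (fun=> 0).
  apply/(sqnorm_eq0 (@sigman R T sigma n.+1)).
    by have [] := L2_tensor fadm D2.
  rewrite (sqnorm_tensor fadm D2.1) (sqnorm_eq0 _ D2.1).2 ?mule0//.
  by move: (FG n); apply: ae_mono => t FGt; rewrite /D FGt mulN1r addNr.
apply: ae_mono => t; rewrite /tensor /D mulrDr mulN1r mulrN => /eqP.
by rewrite addrC subr_eq0 => /eqP.
Qed.

Lemma tuperm_sum n (p : 'S_n) (t : n.-tuple T) :
  \sum_(i < n) f (tnth (@tuperm _ bT n p t) i) = \sum_(i < n) f (tnth t i).
Proof.
rewrite [RHS](reindex_inj (@perm_inj _ p)); apply: eq_bigr => i _.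
by rewrite tnth_mktuple.
Qed.

Lemma L2_a_zero F n : L2 sigma (F n) -> L2 sigma (@a_zero R T f F n).
Proof.
move=> F2; have [mf [C fC] _] := fadm.
apply: (@cL2M_bounded _ _ _ (@sigman R T sigma n) _ _ ((n%:R * C) ^+ 2)) F2.
  apply: cmeasurable_real; apply: measurable_sum => i.
  by apply: (measurableT_comp mf); exact: measurable_tnth.
move=> t; rewrite normsq_real -[leLHS]real_normK ?num_real//.
have S : `|\sum_(i < n) f (tnth t i)| <= n%:R * C.
  apply: le_trans (ler_norm_sum _ _ _) _.
  apply: (@le_trans _ _ (\sum_(i < n) C)); first by apply: ler_sum => i _; exact: fC.
  by rewrite sumr_const card_ord mulr_natl.
by rewrite ler_pXn2r// nnegrE (le_trans _ S).
Qed.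

Lemma Qsymmetric_a_zero F n :
  Qsymmetric sigma Q (F n) -> Qsymmetric sigma Q (@a_zero R T f F n).
Proof.
move=> /(QsymmetricP sigma Qnorm Qconj)[F2 FP].
apply/(QsymmetricP sigma Qnorm Qconj); split; first exact: L2_a_zero.
apply: (ae_mono _ FP) => t Ft; rewrite /a_zero {1}Ft.
by rewrite Psym_mul_symmetric// => p u; rewrite tuperm_sum.
Qed.

Lemma a_zero_lin (c : R[i]) F G :
  a_zero f (c *: F + G) = c *: a_zero f F + a_zero f G.
Proof. by apply: fvec_ext => n t; rewrite /a_zero !fvec_lin mulrDr mulrCA. Qed.

Lemma a_zero_feq F G : feq sigma F G -> feq sigma (a_zero f F) (a_zero f G).
Proof. by move=> FG n; apply: (ae_mono _ (FG n)) => t Ft; rewrite /a_zero Ft. Qed.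

Lemma is_fin_a_zero F : is_fin sigma Q F -> is_fin sigma Q (a_zero f F).
Proof.
move=> [FQ [N FN]]; split; first by move=> n; exact: Qsymmetric_a_zero.
by exists N => n nN; apply: (ae_mono _ (FN n nN)) => t Ft; rewrite /a_zero Ft mulr0.
Qed.

Lemma fip_a_zero F G : is_fin sigma Q F -> is_fin sigma Q G ->
  fip sigma (a_zero f F) G = fip sigma F (a_zero f G).
Proof.
move=> fF fG; have [N FN] := is_fin_bdd fF.
rewrite (fipEl (is_fin_l2 (is_fin_a_zero fF)) (is_fin_l2 fG) (N := N)); last first.
  by move=> n nN; apply: (ae_mono _ (FN n nN)) => t Ft; rewrite /a_zero Ft mulr0.
rewrite (fipEl (is_fin_l2 fF) (is_fin_l2 (is_fin_a_zero fG)) FN).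
apply: eq_bigr => n _; congr (_ * _); apply: (@eq_cintegral _ _ _ (@sigman R T sigma n)) => t.
by rewrite /a_zero rmorphM/= conj_realc mulrCA mulrA.
Qed.

(** Explicit kernel of the annihilation operator. The factor n+1 is the ratio (n+1)!/n! of the
    weights in the Fock norm, and [Psym] makes each component Q-symmetric by construction. *)
Definition annih F : fvec :=
  fun n => Psym Q (fun t => n.+1%:R * fcontract sigma f (F n.+1) t).

Lemma bdd_annih N F : l2 sigma F -> bdd sigma N F -> bdd sigma N (annih F).
Proof.
move=> F2 FN n nN.
have -> : (fun=> 0) = Psym Q (fun _ : n.-tuple T => 0) :> (n.-tuple T -> R[i]).
  by apply/funext => t; rewrite /Psym big1 ?mulr0// => p _; rewrite /Psi mulr0.
apply: aeq_Psym.
have : aeq sigma (fcontract sigma f (F n.+1)) (fun=> 0).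
  have [mc _] := L2_fcontract fadm (F2 n.+1).
  apply/(sqnorm_eq0 (@sigman R T sigma n) mc)/eqP.
  rewrite eq_le (@sqnorm_ge0 _ _ _ (@sigman R T sigma n)) andbT.
  apply: le_trans (sqnorm_fcontract fadm (F2 n.+1).1) _.
  by rewrite (sqnorm_eq0 _ (F2 n.+1).1).2 ?mule0//; apply: FN; exact: leqW.
by apply: ae_mono => t ->; rewrite mulr0.
Qed.

Lemma is_fin_annih F : is_fin sigma Q F -> is_fin sigma Q (annih F).
Proof.
move=> fF; have F2 := is_fin_l2 fF; split.
  move=> n; apply: (Qsymmetric_Psym mQ Qnorm).
  by apply: (@cL2Z _ _ _ (@sigman R T sigma n)); exact: L2_fcontract.
by have [N FN] := is_fin_bdd fF; exists N; exact: bdd_annih.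
Qed.

Lemma Qsymmetric_fixed n (g : n.-tuple T -> R[i]) :
  Qsymmetric sigma Q g -> aeq sigma (Psym Q g) g.
Proof.
by move=> /(QsymmetricP sigma Qnorm Qconj)[_ /aeq_sym].
Qed.

(** The projection inside [a_plus] moves to F and the one inside [annih] moves to H; each fixes its
    vector up to a null set. What remains is the adjointness of [tensor] and [fcontract]. *)
Lemma fip_annih F H : is_fin sigma Q F -> is_fin sigma Q H ->
  fip sigma (a_plus Q f H) F = fip sigma H (annih F).
Proof.
move=> fF fH; have [N HN] := is_fin_bdd fH.
have F2 := is_fin_l2 fF; have H2 := is_fin_l2 fH.
have [M aM] := is_fin_bdd (is_fin_a_plus fH).
have aK : bdd sigma (maxn N M).+1 (a_plus Q f H).
  by apply: bdd_le aM; rewrite leqW// leq_maxr.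
rewrite (fipEl (is_fin_l2 (is_fin_a_plus fH)) F2 aK).
rewrite (fipEl H2 (is_fin_l2 (is_fin_annih fF)) (bdd_le (leq_maxl N M) HN)).
rewrite big_ord_recl /= ip20 mulr0 add0r; apply: eq_bigr => n _.
rewrite -[LHS]/(n.+1`!%:R * ip2 sigma (Psym Q (tensor f (H n))) (F n.+1)) factS.
have t2 := L2_tensor fadm (H2 n); have c2 := L2_fcontract fadm (F2 n.+1).
have nc2 : L2 sigma (fun t => n.+1%:R * fcontract sigma f (F n.+1) t).
  exact: (@cL2Z _ _ _ (@sigman R T sigma n) _ _ c2).
rewrite (ip2_Psym mQ Qnorm Qconj t2 (F2 n.+1)).
rewrite (ip2_ae t2 t2 (L2_Psym mQ Qnorm (F2 n.+1)) (F2 n.+1) (aeq_refl _ _)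
  (Qsymmetric_fixed (fF.1 n.+1))).
rewrite (ip2_tensor fadm (H2 n) (F2 n.+1)).
rewrite -(ip2_Psym mQ Qnorm Qconj (H2 n) nc2).
rewrite (ip2_ae (L2_Psym mQ Qnorm (H2 n)) (H2 n) nc2 nc2
  (Qsymmetric_fixed (fH.1 n)) (aeq_refl _ _)).
by rewrite (ip2Zr _ (H2 n) c2) conjC_nat mulrA natrM [_%:R * _%:R]mulrC.
Qed.

(** [a_minus] is a choice among the solutions of the adjoint relation: [annih] shows that there is
    one, [fip_separates] that all agree up to null sets. *)
Lemma a_minus_spec F : is_fin sigma Q F ->
  is_fock sigma Q (a_minus sigma Q f F) /\ feq sigma (a_minus sigma Q f F) (annih F).
Proof.
move=> fF; rewrite /a_minus; set S := [set G | _].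
have SA : S (annih F).
  split; first exact: is_fin_fock (is_fin_annih fF).
  by move=> H fH; exact: fip_annih.
have [] : S (xget 0 S) := xgetI _ SA.
move: (xget 0 S) => G fG GE; split; first exact: fG.
apply: (fip_separates Qnorm Qconj); [exact: fG|by case: SA|].
by move=> H fH; rewrite -(GE _ fH) fip_annih.
Qed.

#[local] Opaque a_minus.

Lemma is_fin_a_minus F : is_fin sigma Q F -> is_fin sigma Q (a_minus sigma Q f F).
Proof.
move=> fF; have [[GQ _] GE] := a_minus_spec fF.
have [N AN] := is_fin_bdd (is_fin_annih fF).
by split=> //; exists N => n nN; apply: aeq_trans (GE n) (AN n nN).
Qed.

Lemma fip_a_minus F H : is_fin sigma Q F -> is_fin sigma Q H ->
  fip sigma (a_plus Q f H) F = fip sigma H (a_minus sigma Q f F).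
Proof.
move=> fF fH; apply: (etrans (fip_annih fF fH)); have [_ GE] := a_minus_spec fF.
have [N AN] := is_fin_bdd (is_fin_annih fF).
exact: (fip_feq (is_fin_l2 fH) (is_fin_l2 fH) (is_fin_l2 (is_fin_annih fF))
  (is_fin_l2 (is_fin_a_minus fF)) AN (feq_refl _ _) (feq_sym GE)).
Qed.

Lemma a_minus_feq F G : is_fin sigma Q F -> is_fin sigma Q G ->
  feq sigma F G -> feq sigma (a_minus sigma Q f F) (a_minus sigma Q f G).
Proof.
move=> fF fG FG; apply: (fip_separates Qnorm Qconj).
- exact/is_fin_fock/is_fin_a_minus.
- exact/is_fin_fock/is_fin_a_minus.
- move=> H fH; apply: (etrans (esym (fip_a_minus fF fH))).
  apply: (etrans _ (fip_a_minus fG fH)); have [N FN] := is_fin_bdd fF.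
  have aH2 := is_fin_l2 (is_fin_a_plus fH).
  exact: (fip_feq aH2 aH2 (is_fin_l2 fF) (is_fin_l2 fG) FN (feq_refl _ _) FG).
Qed.

(** A chosen vector carries no linearity of its own; it is inherited from the pairing with [a_plus],
    which determines the vector. *)
Lemma a_minus_lin (c : R[i]) F G : is_fin sigma Q F -> is_fin sigma Q G ->
  feq sigma (a_minus sigma Q f (c *: F + G))
            (c *: a_minus sigma Q f F + a_minus sigma Q f G).
Proof.
move=> fF fG; have fFG := is_fin_lin Qnorm Qconj c fF fG.
have mF := is_fin_a_minus fF; have mG := is_fin_a_minus fG.
apply: (fip_separates Qnorm Qconj).
- exact: is_fin_fock (is_fin_a_minus fFG).
- exact: is_fin_fock (is_fin_lin Qnorm Qconj c mF mG).
- move=> H fH; apply: (etrans (esym (fip_a_minus fFG fH))).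
  apply: (etrans (fip_fin_linr c (is_fin_l2 fF) (is_fin_l2 fG) (is_fin_a_plus fH))).
  apply: esym; apply: (etrans (fip_fin_linr c (is_fin_l2 mF) (is_fin_l2 mG) fH)).
  apply: (f_equal2 +%R); last exact: esym (fip_a_minus fG fH).
  exact: (congr1 ( *%R c^*) (esym (fip_a_minus fF fH))).
Qed.

Lemma fip_a_plus F H : is_fin sigma Q F -> is_fin sigma Q H ->
  fip sigma (a_minus sigma Q f F) H = fip sigma F (a_plus Q f H).
Proof.
move=> fF fH.
apply: (etrans (fip_finC (is_fin_a_minus fF) (is_fin_l2 fH))).
apply: (etrans (congr1 Num.conj (esym (fip_a_minus fF fH)))).
exact: (esym (fip_finC fF (is_fin_l2 (is_fin_a_plus fH)))).
Qed.

Variable lambda : R.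
Local Notation fieldop := (fieldop sigma Q lambda f).

Lemma is_fin_fieldop F : is_fin sigma Q F -> is_fin sigma Q (fieldop F).
Proof.
move=> fF; apply: (is_finD Qnorm Qconj); last exact: is_fin_a_minus.
apply: (is_finD Qnorm Qconj); first exact: is_fin_a_plus.
by apply: (is_finZ Qnorm Qconj); exact: is_fin_a_zero.
Qed.

Lemma bdd_fieldop N F : is_fin sigma Q F -> bdd sigma N F -> bdd sigma N.+1 (fieldop F).
Proof.
move=> fF FN; have F2 := is_fin_l2 fF.
have pN := bdd_a_plus F2 FN.
have zN : bdd sigma N.+1 (a_zero f F).
  by move=> n Nn; apply: ae_mono (FN n (ltnW Nn)) => t /= Ft; rewrite /a_zero Ft mulr0.
have mN : bdd sigma N.+1 (a_minus sigma Q f F).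
  move=> n Nn; apply: aeq_trans ((a_minus_spec fF).2 n) _.
  exact: (bdd_annih F2 FN (ltnW Nn)).
have pzN := bdd_lin lambda%:C zN pN.
rewrite /Defs.fieldop [a_plus _ _ _ + _]addrC -[_ + a_plus _ _ _]scale1r.
exact: bdd_lin.
Qed.

Lemma feqD F F' G G' : feq sigma F F' -> feq sigma G G' -> feq sigma (F + G) (F' + G').
Proof. by move=> FF GG; have := feq_lin 1 FF GG; rewrite !scale1r. Qed.

Lemma feqZ (c : R[i]) F F' : feq sigma F F' -> feq sigma (c *: F) (c *: F').
Proof. by move=> FF; have := feq_lin c FF (feq_refl sigma 0); rewrite !addr0. Qed.

Lemma fieldop_operator : is_operator sigma Q fieldop.
Proof.
split; first exact: is_fin_fieldop.
- move=> F G fF fG FG; apply: feqD; last exact: a_minus_feq fF fG FG.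
  apply: feqD; first exact: a_plus_feq (is_fin_l2 fF) (is_fin_l2 fG) FG.
  by apply: feqZ; exact: a_zero_feq.
- move=> c F G fF fG.
  apply: (@feq_trans _ _ _ (a_plus Q f (c *: F + G) + lambda%:C *: a_zero f (c *: F + G)
    + (c *: a_minus sigma Q f F + a_minus sigma Q f G))).
    by apply: feqD; [exact: feq_refl|exact: (a_minus_lin c fF fG)].
  rewrite a_plus_lin a_zero_lin /Defs.fieldop.
  rewrite linear_combination3; last exact: mulrC.
  exact: feq_refl.
Qed.

Lemma fip_sum3l A B C G : is_fin sigma Q A -> is_fin sigma Q B -> is_fin sigma Q C ->
  is_fin sigma Q G ->
  fip sigma (A + lambda%:C *: B + C) G =
  fip sigma A G + lambda%:C * fip sigma B G + fip sigma C G.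
Proof.
move=> fA fB fC fG.
have -> : A + lambda%:C *: B + C = lambda%:C *: B + (1 *: A + C).
  by rewrite scale1r addrA [A + _]addrC.
have fAC := is_fin_lin Qnorm Qconj 1 fA fC.
apply: (etrans (fip_fin_linl _ (is_fin_l2 fB) (is_fin_l2 fAC) fG)).
rewrite -addrA addrCA; congr (_ + _).
by apply: (etrans (fip_fin_linl 1 (is_fin_l2 fA) (is_fin_l2 fC) fG)); rewrite mul1r.
Qed.

Lemma fip_sum3r A B C G : is_fin sigma Q A -> is_fin sigma Q B -> is_fin sigma Q C ->
  is_fin sigma Q G ->
  fip sigma G (A + lambda%:C *: B + C) =
  fip sigma G A + lambda%:C * fip sigma G B + fip sigma G C.
Proof.
move=> fA fB fC fG.
have -> : A + lambda%:C *: B + C = lambda%:C *: B + (1 *: A + C).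
  by rewrite scale1r addrA [A + _]addrC.
have fAC := is_fin_lin Qnorm Qconj 1 fA fC.
apply: (etrans (fip_fin_linr _ (is_fin_l2 fB) (is_fin_l2 fAC) fG)).
rewrite conj_realc -addrA addrCA; congr (_ + _).
by apply: (etrans (fip_fin_linr 1 (is_fin_l2 fA) (is_fin_l2 fC) fG)); rewrite rmorph1 mul1r.
Qed.

(** Creation and annihilation are exchanged, hence the reversed order of the three summands; the
    neutral part is symmetric because f and [lambda] are real. *)
Lemma fieldop_selfadjoint : is_adjoint sigma Q fieldop fieldop.
Proof.
split; first exact: fieldop_operator.
move=> F G fF fG; rewrite /Defs.fieldop.
have pF := is_fin_a_plus fF; have pG := is_fin_a_plus fG.
have mF := is_fin_a_minus fF; have mG := is_fin_a_minus fG.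
have zF := is_fin_a_zero fF; have zG := is_fin_a_zero fG.
apply: (etrans (fip_sum3l pF zF mF fG)); apply: (etrans _ (esym (fip_sum3r pG zG mG fF))).
have E : forall x y z : R[i], x + y + z = z + y + x.
  by move=> x y z; rewrite [LHS]addrC [x + y]addrC addrA.
apply: (etrans (E _ _ _)).
apply: (f_equal2 +%R); last exact: fip_a_minus.
apply: (f_equal2 +%R); first exact: fip_a_plus.
exact: (congr1 ( *%R lambda%:C) (fip_a_zero fF fG)).
Qed.

End one_field.

End field_operators.

(** * Inserting a point into a permutation *)

Section insertion.
Context {R : realType} {T : completePseudoMetricType R}.
Local Notation bT := (borel T).

Definition insertT (a : nat) (x : T) (s : seq T) : seq T := take a s ++ x :: drop a s.

Lemma size_insertT a x s : size (insertT a x s) = (size s).+1.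
Proof. by rewrite /insertT size_cat /= addnS -size_cat cat_take_drop. Qed.

Lemma nth_insertT a x (s : seq T) i : (a <= size s)%N ->
  nth point (insertT a x s) i =
  if (i < a)%N then nth point s i else if i == a then x else nth point s i.-1.
Proof.
move=> a_s; rewrite nth_cat size_takel//; case: ltnP => ia; first by rewrite nth_take.
case: eqVneq => [->|ia']; first by rewrite subnn.
have -> : (i - a = (i.-1 - a).+1)%N by lia.
by rewrite /= nth_drop; congr nth; lia.
Qed.

Lemma tconsP m (t : m.+1.-tuple T) : exists x u, t = @tcons _ bT m (x, u).
Proof.
exists (thead t), [tuple of behead t]; exact: (esym (@tunconsK _ bT m t)).
Qed.

(** [lift_perm a ord0 q] reads the front entry at place a and the others according to q, so
    permuting x :: t means inserting x at slot a of the permuted t. *)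
Lemma tuperm_lift_perm k (a : 'I_k.+1) (q : 'S_k) x (t : k.-tuple bT) :
  tuperm (lift_perm a ord0 q) (tcons (x, t)) = insertT a x (tuperm q t) :> seq T.
Proof.
have ak : (a <= size (tuperm q t))%N by rewrite size_tuple -ltnS.
apply: (@eq_from_nth _ point); first by rewrite size_insertT !size_tuple.
move=> i; rewrite size_tuple => ik.
rewrite nth_insertT//.
rewrite -[X in nth _ _ X]/(val (Ordinal ik)) -tnth_nth tnth_mktuple /=.
have [j ij|ia] := unliftP a (Ordinal ik).
  rewrite ij lift_perm_lift tnthS.
  have -> : i = bump a j by exact: (congr1 val ij).
  have E : tnth t (q j) = nth point (tuperm q t) j by rewrite -tnth_nth tnth_mktuple.
  rewrite E /bump; have [aj|ja] := leqP a j; rewrite ?add1n ?add0n ?ja//.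
  by rewrite ltnNge leqW//= gtn_eqF.
have ia' : i = a := congr1 val ia.
by rewrite [in RHS]ia' ltnn eqxx ia lift_perm_id.
Qed.

Variable Q : T -> T -> R[i].

Definition Qleft k (a : nat) x (s : seq T) : R[i] :=
  \prod_(b < k | (b < a)%N) Q x (nth point s b).

(** The inversions are sorted by whether they involve the front point: those that do not are the
    inversions of q, and those that do pair x with the entries that end up before slot a. *)
Lemma cocycle_lift_perm k (a : 'I_k.+1) (q : 'S_k) x (t : k.-tuple bT) :
  cocycle Q (lift_perm a ord0 q) (tcons (x, t)) =
  cocycle Q q t * Qleft k a x (tuperm q t).
Proof.
rewrite /cocycle lift_permV big_ord_recl mulrC; congr (_ * _).
  apply: eq_bigr => b _; rewrite big_mkcond big_ord_recl /= mul1r -big_mkcond /=.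
  apply: eq_big => [c|c _]; last by rewrite !tnthS.
  rewrite !lift_perm_lift /= /bump /= !add1n ltnS; congr (_ && _).
  by lia.
rewrite big_mkcond big_ord_recl /= mul1r -big_mkcond /= /Qleft.
rewrite [RHS](reindex_inj (@perm_inj _ (q^-1)%g)) /=; apply: eq_big => [b|b _].
  by rewrite lift_perm_lift lift_perm_id /= /bump; lia.
have E : nth point (tuperm q t) ((q^-1)%g b) = tnth t b.
  by rewrite -tnth_nth tnth_mktuple permKV.
by rewrite tnthS -E.
Qed.

Lemma Psi_lift_perm k (a : 'I_k.+1) (q : 'S_k) x (t : k.-tuple bT) (g : seq T -> R[i]) :
  Psi Q (lift_perm a ord0 q) (fun u : k.+1.-tuple T => g u) (@tcons _ bT k (x, t)) =
  Psi Q q (fun u : k.-tuple T => Qleft k a x u * g (insertT a x u)) t.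
Proof.
rewrite !PsiE cocycle_lift_perm mulrA; congr (_ * g _).
exact: tuperm_lift_perm.
Qed.

(** A permutation of k+1 points amounts to the place a sent to 0 and a permutation of the rest.
    Injectivity suffices, as both sides have (k+1)! elements. *)
Lemma sum_lift_perm k (G : 'S_k.+1 -> R[i]) :
  \sum_p G p = \sum_(a < k.+1) \sum_(q : 'S_k) G (lift_perm a ord0 q).
Proof.
rewrite pair_big /=.
pose h (z : 'I_k.+1 * 'S_k) : 'S_k.+1 := lift_perm z.1 ord0 z.2.
have hinj : injective h.
  move=> [a q] [b r] /= E.
  have ab : a = b.
    by apply: (@perm_inj _ (h (a, q))); rewrite {2}E /h /= !lift_perm_id.
  subst b; congr pair; apply/permP => i; apply: (@lift_inj _ ord0).
  by rewrite -!(lift_perm_lift a) -[lift_perm a ord0 q]/(h (a, q)) E.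
have hbij : bijective h.
  by apply: inj_card_bij hinj _; rewrite card_prod card_ord !card_Sn factS.
by rewrite (reindex h)//; exact: onW_bij.
Qed.

End insertion.

(** * Field operators on chaos vectors *)
Section chaos_vectors.
Context {R : realType} {T : completePseudoMetricType R}.
Variable sigma : {sigma_finite_measure set (borel T) -> \bar R}.
Local Notation bT := (borel T).
Local Notation fvec := (fvec R T).
Variable Q : T -> T -> R[i].
Hypothesis mQ : cmeasurable setT (fun z : bT * bT => Q z.1 z.2).
Hypothesis Qnorm : forall s t, normsq (Q s t) = 1.
Hypothesis Qconj : forall s t, Q s t = (Q t s)^*.

(* Functions of k variables are given on [seq T], so that the recursions on k
   below need no casts. *)
Definition chaos k (g : seq T -> R[i]) : fvec :=
  fun n t => if n == k then Psym Q (fun u : n.-tuple T => g u) t else 0.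

Lemma eq_chaos k (g h : seq T -> R[i]) :
  (forall s, size s = k -> g s = h s) -> chaos k g = chaos k h.
Proof.
move=> gh; apply: fvec_ext => n t; rewrite /chaos; case: eqP => // nk.
by congr (Psym Q _ t); apply/funext => u; apply: gh; rewrite size_tuple.
Qed.

Lemma chaos_lin k (c : R[i]) (g h : seq T -> R[i]) :
  chaos k (fun s => c * g s + h s) = c *: chaos k g + chaos k h.
Proof.
apply: fvec_ext => n t; rewrite fvec_lin /chaos; case: eqP => _.
  by rewrite -Psym_lin.
by rewrite mulr0 addr0.
Qed.

Lemma chaos0 k : chaos k (fun=> 0) = 0.
Proof.
apply: fvec_ext => n t; rewrite /chaos; case: eqP => // _.
by rewrite /Psym big1 ?mulr0// => p _; rewrite /Psi mulr0.
Qed.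

Lemma chaosD k (g h : seq T -> R[i]) :
  chaos k (fun s => g s + h s) = chaos k g + chaos k h.
Proof.
rewrite -[chaos k g]scale1r -chaos_lin; apply: eq_chaos => s _.
by rewrite mul1r.
Qed.

Lemma chaosZ k (c : R[i]) (g : seq T -> R[i]) :
  chaos k (fun s => c * g s) = c *: chaos k g.
Proof.
rewrite -[RHS]addr0 -(chaos0 k) -chaos_lin; apply: eq_chaos => s _.
by rewrite addr0.
Qed.

Lemma chaos_sum k (I : Type) (r : seq I) (P : pred I) (g : I -> seq T -> R[i]) :
  chaos k (fun s => \sum_(i <- r | P i) g i s) = \sum_(i <- r | P i) chaos k (g i).
Proof.
elim: r => [|i r IH].
  by rewrite big_nil -(chaos0 k); apply: eq_chaos => s _; rewrite big_nil.
rewrite big_cons -IH; case: ifP => Pi.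
  by rewrite -chaosD; apply: eq_chaos => s _; rewrite big_cons Pi.
by apply: eq_chaos => s _; rewrite big_cons Pi.
Qed.

Lemma is_fin_chaos k (g : seq T -> R[i]) :
  L2 sigma (fun t : k.-tuple T => g t) -> is_fin sigma Q (chaos k g).
Proof.
move=> g2; split => [n|].
  rewrite /chaos; case: eqP => [->|_]; first exact: (Qsymmetric_Psym mQ Qnorm).
  exact: (Qsymmetric0 sigma Qnorm Qconj).
by exists k.+1 => n nk; rewrite /chaos gtn_eqF//; exact: aeq_refl.
Qed.

Lemma Psym_Psi n (p : 'S_n) (h : n.-tuple T -> R[i]) :
  Psym Q (Psi Q p h) = Psym Q h.
Proof.
apply/funext => t; rewrite /Psym; congr (_ * _).
rewrite [RHS](reindex_inj (@mulgI _ p)) /=; apply: eq_bigr => q _.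
by rewrite -(Psi_comp _ _ _ (kernel_mulC Qnorm Qconj)).
Qed.

Variable f : T -> R.

Definition create_fun (g : seq T -> R[i]) : seq T -> R[i] :=
  fun s => if s is x :: s' then (f x)%:C * g s' else 0.

Definition number_fun k (g : seq T -> R[i]) : seq T -> R[i] :=
  fun s => (\sum_(i < k) f (nth point s i))%:C * g s.

(* The factor [Qleft] is the cocycle of the cycle that moves x from the front
   to position a. *)
Definition annihilate_fun k (a : nat) (g : seq T -> R[i]) : seq T -> R[i] :=
  fun s => cintegral sigma
    (fun x : bT => (f x)%:C * (Qleft Q k a x s * g (insertT a x s))).

Lemma tensor_Psi m (q : 'S_m) (g : seq T -> R[i]) :
  tensor f (Psi Q q (fun u : m.-tuple T => g u)) =
  Psi Q (lift_perm ord0 ord0 q) (fun u : m.+1.-tuple T => create_fun g u).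
Proof.
apply/funext => t; have [x [u ->]] := tconsP t.
rewrite tensor_tcons Psi_lift_perm !PsiE mulrCA.
by rewrite /Qleft big_pred0// mul1r /insertT take0 drop0.
Qed.

Lemma Psym_sum n (c : R[i]) (I : Type) (r : seq I) (F : I -> n.-tuple T -> R[i]) t :
  Psym Q (fun t => c * \sum_(i <- r) F i t) t = c * \sum_(i <- r) Psym Q (F i) t.
Proof.
rewrite /Psym -mulr_sumr mulrCA; congr (_ * _).
rewrite exchange_big mulr_sumr; apply: eq_bigr => p _ /=.
by rewrite PsiE mulrCA mulr_sumr; congr (_ * _).
Qed.

Lemma Psym0 n : Psym Q (fun _ : n.-tuple T => 0) = fun=> 0.
Proof.
by apply/funext => t; rewrite /Psym big1 ?mulr0// => p _; rewrite /Psi mulr0.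
Qed.

Lemma chaos_at k (g : seq T -> R[i]) :
  @chaos k g k = Psym Q (fun u : k.-tuple T => g u).
Proof. by apply/funext => t; rewrite /chaos eqxx. Qed.

Lemma chaos_neq k n (g : seq T -> R[i]) : n != k -> @chaos k g n = fun=> 0.
Proof. by move=> /negbTE nk; apply/funext => t; rewrite /chaos nk. Qed.

(** The inner average runs over the subgroup fixing the front point, and the outer projection
    absorbs each of its terms, so the tensor product with P_k g and the one with g have the same
    projection. *)
Lemma a_plus_chaos k (g : seq T -> R[i]) :
  a_plus Q f (chaos k g) = chaos k.+1 (create_fun g).
Proof.
apply: fvec_ext => -[|n] t; first by rewrite /chaos.
rewrite a_plusS; case: (eqVneq n k) t => [->|nk] t; last first.
  rewrite !chaos_neq// (_ : tensor _ _ = fun=> 0) ?Psym0//.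
  by apply/funext => u; rewrite /tensor mulr0.
rewrite !chaos_at.
have -> : tensor f (Psym Q (fun u : k.-tuple T => g u)) =
    (fun t => (k`!%:R)^-1 * \sum_(q : 'S_k) Psi Q (lift_perm ord0 ord0 q)
      (fun u : k.+1.-tuple T => create_fun g u) t).
  apply/funext => u; rewrite /tensor /Psym mulrCA; congr (_ * _).
  rewrite mulr_sumr; apply: eq_bigr => q _.
  by rewrite -tensor_Psi.
rewrite Psym_sum (eq_bigr (fun=> Psym Q (fun u : k.+1.-tuple T => create_fun g u) t)).
  rewrite sumr_const card_Sn -[X in _ * X]mulr_natl mulrA mulVf ?mul1r//.
by move=> q _; rewrite Psym_Psi.
Qed.

Lemma a_zero_chaos k (g : seq T -> R[i]) :
  a_zero f (chaos k g) = chaos k (number_fun k g).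
Proof.
apply: fvec_ext => n t; rewrite /a_zero.
case: (eqVneq n k) t => [->|nk] t; last by rewrite !chaos_neq// mulr0.
rewrite !chaos_at.
rewrite -(@Psym_mul_symmetric _ _ Q k (fun u => (\sum_(i < k) f (tnth u i))%:C)); last first.
  by move=> p u; rewrite tuperm_sum.
congr (Psym Q _ t); apply/funext => u; rewrite /number_fun; congr (_%:C * _).
by apply: eq_bigr => b _; rewrite (tnth_nth point).
Qed.

Definition ann_integrable k (g : seq T -> R[i]) : Prop :=
  forall (a : 'I_k.+1) (u : k.-tuple T),
    cintegrable sigma (fun x : bT => (f x)%:C * (Qleft Q k a x u * g (insertT a x u))).

(** The sum over all permutations of k+1 points is sorted by the slot a of the integrated variable
    and the order q of the others. Since (k+1)/(k+1)! = 1/k!, the sum over q is again a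
    symmetrization. *)
Lemma fcontract_Psym k (g : seq T -> R[i]) t : ann_integrable k g ->
  k.+1%:R * fcontract sigma f (Psym Q (fun u : k.+1.-tuple T => g u)) t =
  Psym Q (fun u : k.-tuple T => \sum_(a < k.+1) annihilate_fun k a g u) t.
Proof.
move=> ig; rewrite /fcontract.
pose E x := \sum_(a < k.+1) \sum_(q : 'S_k) cocycle Q q t *
  ((f x)%:C * (Qleft Q k a x (@tuperm _ bT k q t) * g (insertT a x (@tuperm _ bT k q t)))).
rewrite (@eq_cintegral _ _ _ sigma _ (fun x => (k.+1`!%:R)^-1 * E x)); last first.
  move=> x; rewrite /Psym mulrCA; congr (_ * _); rewrite sum_lift_perm mulr_sumr.
  apply: eq_bigr => a _; rewrite mulr_sumr; apply: eq_bigr => q _.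
  by rewrite Psi_lift_perm PsiE mulrCA.
have iE a : cintegrable sigma (fun x => \sum_(q : 'S_k) cocycle Q q t *
  ((f x)%:C * (Qleft Q k (a : 'I_k.+1) x (@tuperm _ bT k q t) *
   g (insertT a x (@tuperm _ bT k q t))))).
  by apply: cintegrable_sum => q _; apply: cintegrableZ; exact: ig.
rewrite cintegralZ; last by apply: cintegrable_sum => a _; exact: iE.
rewrite mulrA factS natrM invfM mulrA mulfV ?pnatr_eq0// mul1r /Psym; congr (_ * _).
rewrite /E cintegral_sum; last by move=> a _; exact: iE.
rewrite [LHS](eq_bigr (fun a : 'I_k.+1 =>
  \sum_(q : 'S_k) cocycle Q q t * annihilate_fun k a g (@tuperm _ bT k q t))).
  by rewrite exchange_big; apply: eq_bigr => q _; rewrite PsiE mulr_sumr.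
move=> a _; rewrite cintegral_sum; last by move=> q _; apply: cintegrableZ; exact: ig.
by apply: eq_bigr => q _; rewrite cintegralZ//; exact: ig.
Qed.

Lemma annih_chaosS k (g : seq T -> R[i]) : ann_integrable k g ->
  annih sigma Q f (chaos k.+1 g) = chaos k (fun s => \sum_(a < k.+1) annihilate_fun k a g s).
Proof.
move=> ig; apply: fvec_ext => n t; rewrite /annih.
case: (eqVneq n k) t => [->|nk] t; last first.
  rewrite !chaos_neq// (_ : (fun u => _) = fun=> 0) ?Psym0//.
  apply/funext => u; rewrite /fcontract -[RHS](mulr0 n.+1%:R); congr (_ * _).
  rewrite -[RHS](@cintegral0 _ _ _ sigma); apply: eq_cintegral => x.
  by rewrite mulr0.
rewrite !chaos_at.
have -> : (fun u => k.+1%:R * fcontract sigma f (Psym Q (fun v : k.+1.-tuple T => g v)) u) =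
    Psym Q (fun u : k.-tuple T => \sum_(a < k.+1) annihilate_fun k a g u).
  by apply/funext => u; exact: fcontract_Psym.
by rewrite (Psym_idem Qnorm Qconj).
Qed.

Lemma annih_chaos0 (g : seq T -> R[i]) : annih sigma Q f (chaos 0 g) = 0.
Proof.
apply: fvec_ext => n t; rewrite /annih chaos_neq//.
rewrite (_ : (fun u => _) = fun=> 0) ?Psym0//.
apply/funext => u; rewrite /fcontract -[RHS](mulr0 n.+1%:R); congr (_ * _).
rewrite -[RHS](@cintegral0 _ _ _ sigma); apply: eq_cintegral => x.
by rewrite mulr0.
Qed.

End chaos_vectors.

(** * Marked partitions of one more point *)
Section extension.
Import mathcomp.boot.finset.
Local Open Scope nat_scope.
Local Open Scope set_scope.

Lemma partition_setTP (X : finType) (P : {set {set X}}) :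
  reflect [/\ set0 \notin P, forall x, exists2 B, B \in P & x \in B
            & forall B C x, B \in P -> C \in P -> x \in B -> x \in C -> B = C]
          (finset.partition P [set: X]).
Proof.
apply: (iffP and3P) => [[/eqP cP /trivIsetP tP P0]|[P0 cP tP]].
  split=> // [x|B C x BP CP xB xC].
    have : x \in cover P by rewrite cP inE.
    by case/bigcupP => B; exists B.
  apply/eqP; apply: contraT => /(tP _ _ BP CP) /disjoint_setI0 /setP/(_ x).
  by rewrite !inE xB xC.
split=> //.
  apply/eqP/setP => x; rewrite inE; apply/bigcupP.
  by have [B] := cP x; exists B.
apply/trivIsetP => B C BP CP; apply: contraR => /pred0Pn[x /= /andP[xB xC]].
by apply/eqP; exact: tP xB xC.
Qed.

Lemma marked_partitionP m (V : {set {set 'I_m}} * {set {set 'I_m}}) :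
  reflect [/\ set0 \notin V.1 :|: V.2,
     forall x, exists2 B, B \in V.1 :|: V.2 & x \in B,
     forall B C x, B \in V.1 :|: V.2 -> C \in V.1 :|: V.2 ->
       x \in B -> x \in C -> B = C,
     forall B, B \in V.1 -> B \in V.2 -> False
   & forall B, B \in V.2 -> 1 < #|B|] (marked_partition V).
Proof.
apply: (iffP and3P) => [[/partition_setTP[V0 cV tV] /pred0P dV /forall_inP mV]|].
  by split=> // B B1 B2; have := dV B; rewrite /= B1 B2.
case=> V0 cV tV dV mV; split; first exact/partition_setTP.
  apply/pred0P => B /=; apply/negbTE/negP => /andP[]; exact: dV.
exact/forall_inP.
Qed.

Variable n : nat.
Implicit Types (A B C : {set 'I_n}) (V : {set {set 'I_n}} * {set {set 'I_n}}).

(** Every block of the larger set is the shift of a smaller set, with the point 0 ([up0]) or without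
    it ([up]); [down] undoes both. *)
Definition up B : {set 'I_n.+1} := lift ord0 @: B.
Definition up0 B : {set 'I_n.+1} := ord0 |: up B.
Definition down (B : {set 'I_n.+1}) : {set 'I_n} := lift ord0 @^-1: B.

Lemma mem_up B i : (lift ord0 i \in up B) = (i \in B).
Proof. by rewrite mem_imset//; exact: lift_inj. Qed.

Lemma ord0_up B : (ord0 \in up B) = false.
Proof. by apply/negbTE/imsetP => -[j _ /eqP]; rewrite (negbTE (neq_lift _ _)). Qed.

Lemma mem_up0 B i : (lift ord0 i \in up0 B) = (i \in B).
Proof. by rewrite !inE mem_up eq_sym (negbTE (neq_lift _ _)). Qed.

Lemma ord0_up0 B : ord0 \in up0 B.
Proof. by rewrite !inE eqxx. Qed.

Lemma upK : cancel up down.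
Proof. by move=> B; apply/setP => i; rewrite inE mem_up. Qed.

Lemma up0K : cancel up0 down.
Proof. by move=> B; apply/setP => i; rewrite inE mem_up0. Qed.

Lemma up_inj : injective up. Proof. exact: can_inj upK. Qed.
Lemma up0_inj : injective up0. Proof. exact: can_inj up0K. Qed.

Lemma downK (B : {set 'I_n.+1}) : ord0 \notin B -> up (down B) = B.
Proof.
move=> B0; apply/setP => i; have [j ->|->] := unliftP ord0 i.
  by rewrite mem_up inE.
by rewrite ord0_up (negbTE B0).
Qed.

Lemma down0K (B : {set 'I_n.+1}) : ord0 \in B -> up0 (down B) = B.
Proof.
move=> B0; apply/setP => i; have [j ->|->] := unliftP ord0 i.
  by rewrite mem_up0 inE.
by rewrite ord0_up0 B0.
Qed.

Lemma up0_neq_up A B : up0 A <> up B.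
Proof. by move=> /setP/(_ ord0); rewrite ord0_up0 ord0_up. Qed.

Lemma card_up B : #|up B| = #|B|.
Proof. by rewrite card_imset//; exact: lift_inj. Qed.

Lemma card_up0 B : #|up0 B| = #|B|.+1.
Proof. by rewrite cardsU1 ord0_up card_up. Qed.

Lemma up_eq0 B : (up B == set0) = (B == set0).
Proof. by rewrite -!cards_eq0 card_up. Qed.

Lemma up0_neq0 B : up0 B != set0.
Proof. by rewrite -cards_eq0 card_up0. Qed.

Lemma mem_ups (P : {set {set 'I_n}}) B : (up B \in up @: P) = (B \in P).
Proof. by rewrite mem_imset//; exact: up_inj. Qed.

Lemma up0_ups (P : {set {set 'I_n}}) B : (up0 B \in up @: P) = false.
Proof. by apply/negbTE/imsetP => -[C _ /up0_neq_up]. Qed.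

(* The three ways of adding the point 0 in front of a marked partition: as a
   singleton, inside a block A marked +1, or inside such a block A whose mark
   is changed to -1. *)
Definition extend (z : ({set {set 'I_n}} * {set {set 'I_n}}) * option ({set 'I_n} * bool)) :
    {set {set 'I_n.+1}} * {set {set 'I_n.+1}} :=
  let V := z.1 in
  match z.2 with
  | None => (up0 set0 |: (up @: V.1), up @: V.2)
  | Some (A, false) => (up0 A |: (up @: (V.1 :\ A)), up @: V.2)
  | Some (A, true) => (up @: (V.1 :\ A), up0 A |: (up @: V.2))
  end.

Definition extension
    (z : ({set {set 'I_n}} * {set {set 'I_n}}) * option ({set 'I_n} * bool)) : bool :=
  marked_partition z.1 && (if z.2 is Some (A, _) then A \in z.1.1 else true).

Lemma mem_extend1_up z B :
  (up B \in (extend z).1) =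
  (B \in z.1.1) && (if z.2 is Some (A, _) then B != A else true).
Proof.
case: z => V [[A [|]]|] /=.
- by rewrite mem_ups in_setD1 andbC.
- rewrite in_setU1 mem_ups in_setD1 andbC.
  by case: eqP => // /esym/up0_neq_up.
- rewrite in_setU1 mem_ups andbT.
  by case: eqP => // /esym/up0_neq_up.
Qed.

Lemma mem_extend2_up z B : (up B \in (extend z).2) = (B \in z.1.2).
Proof.
case: z => V [[A [|]]|] /=; rewrite ?in_setU1 ?mem_ups//.
by case: eqP => // /esym/up0_neq_up.
Qed.

Lemma mem_extend1_up0 z B :
  (up0 B \in (extend z).1) =
  match z.2 with
  | None => B == set0
  | Some (A, b) => ~~ b && (B == A)
  end.
Proof.
by case: z => V [[A [|]]|] /=; rewrite ?in_setU1 up0_ups ?orbF ?(inj_eq up0_inj).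
Qed.

Lemma mem_extend2_up0 z B : (up0 B \in (extend z).2) = (z.2 == Some (B, true)).
Proof.
case: z => V [[A [|]]|] /=; rewrite ?in_setU1 up0_ups ?orbF ?(inj_eq up0_inj)//.
- by apply/eqP/eqP => [->|[->]].
- by apply/esym/negbTE/eqP => -[].
Qed.

Lemma up_or_up0 (B : {set 'I_n.+1}) : (exists C, B = up C) \/ (exists C, B = up0 C).
Proof.
have [B0|B0] := boolP (ord0 \in B).
  by right; exists (down B); rewrite down0K.
by left; exists (down B); rewrite downK.
Qed.

Lemma mem_extend_up z B :
  (up B \in (extend z).1 :|: (extend z).2) -> B \in z.1.1 :|: z.1.2.
Proof.
by rewrite !in_setU mem_extend1_up mem_extend2_up => /orP[/andP[->]|->]; rewrite ?orbT.
Qed.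

Lemma mem_extend_up0 z B :
  (up0 B \in (extend z).1 :|: (extend z).2) ->
  B = if z.2 is Some (A, _) then A else set0.
Proof.
rewrite in_setU mem_extend1_up0 mem_extend2_up0; case: z.2 => [[A b]|].
  by case/orP=> [/andP[_ /eqP]|/eqP[->]].
by rewrite orbF => /eqP.
Qed.

Lemma extend_marked z : extension z -> marked_partition (extend z).
Proof.
move=> /andP[/marked_partitionP[V0 cV tV dV mV] zA].
(* A is the block that 0 joins; the empty set stands for the new singleton {0}. *)
pose A := if z.2 is Some (A, _) then A else set0.
have up0A : up0 A \in (extend z).1 :|: (extend z).2.
  rewrite in_setU mem_extend1_up0 mem_extend2_up0 /A.
  by case: z.2 => [[C [|]]|]; rewrite /= eqxx ?orbT.
have cA i : i \in A -> A \in z.1.1 :|: z.1.2.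
  by rewrite /A; case: (z.2) zA => [[C b] CV _|_]; rewrite ?inE ?CV.
apply/marked_partitionP; split.
- apply/negP; have [[B BE]|[B BE]] := up_or_up0 set0.
    rewrite BE => /mem_extend_up BV.
    by move: BE V0 => /esym/eqP; rewrite up_eq0 => /eqP <-; rewrite BV.
  by have := up0_neq0 B; rewrite -BE eqxx.
- move=> i; have [j ->|->] := unliftP ord0 i; last first.
    by exists (up0 A) => //; exact: ord0_up0.
  have [B BV jB] := cV j; have [BA|BA] := eqVneq B A.
    by exists (up0 A) => //; rewrite mem_up0 -BA.
  exists (up B); last by rewrite mem_up.
  rewrite in_setU mem_extend1_up mem_extend2_up; move: BV BA; rewrite in_setU /A.
  by case: z.2 => [[C b]|] /orP[->|->]; rewrite ?orbT// => ->.
- move=> B C i; have [[B' ->]|[B' ->]] := up_or_up0 B;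
    have [[C' ->]|[C' ->]] := up_or_up0 C.
  + move=> /mem_extend_up BV /mem_extend_up CV.
    have [j ->|->] := unliftP ord0 i; last by rewrite ord0_up.
    by rewrite !mem_up => jB jC; rewrite (tV _ _ _ BV CV jB jC).
  + move=> BV' /mem_extend_up0 CA; have BV := mem_extend_up BV'.
    have [j ->|->] := unliftP ord0 i; last by rewrite ord0_up.
    rewrite mem_up mem_up0 CA => jB jA; exfalso.
    have BA := tV _ _ _ BV (cA _ jA) jB jA.
    move: BV'; rewrite in_setU mem_extend1_up mem_extend2_up BA /A.
    move: zA jA; rewrite /A; case: z.2 => [[D b]|]; last by rewrite inE.
    by move=> DV _; rewrite eqxx andbF /=; exact: dV DV.
  + move=> /mem_extend_up0 CA BV'; have BV := mem_extend_up BV'.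
    have [j ->|->] := unliftP ord0 i; last by rewrite ord0_up.
    rewrite mem_up mem_up0 CA => jA jB; exfalso.
    have BA := tV _ _ _ BV (cA _ jA) jB jA.
    move: BV'; rewrite in_setU mem_extend1_up mem_extend2_up BA /A.
    move: zA jA; rewrite /A; case: z.2 => [[D b]|]; last by rewrite inE.
    by move=> DV _; rewrite eqxx andbF /=; exact: dV DV.
  + by move=> /mem_extend_up0 -> /mem_extend_up0 ->.
- move=> B; have [[B' ->]|[B' ->]] := up_or_up0 B.
    by rewrite mem_extend1_up mem_extend2_up => /andP[B1 _]; exact: dV.
  by rewrite mem_extend1_up0 mem_extend2_up0; case: z.2 => [[D [|]]|] //= _ /eqP[].
- move=> B; have [[B' ->]|[B' ->]] := up_or_up0 B.
    by rewrite mem_extend2_up card_up; exact: mV.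
  rewrite mem_extend2_up0 card_up0 ltnS card_gt0 => /eqP zE.
  move: zA; rewrite zE => BV; apply/eqP => B0.
  by move: V0; rewrite -B0 in_setU BV.
Qed.

(** The block that contains 0, with its mark, reveals the option; the blocks without 0 reveal the
    rest. Since blocks are nonempty, {0} cannot be mistaken for 0 joined to an old block. *)
Lemma extend_inj : {in extension &, injective extend}.
Proof.
move=> z w /andP[/marked_partitionP[V0 cV tV dV mV] zA].
move=> /andP[/marked_partitionP[W0 cW tW dW mW] wA] E.
have V2 : z.1.2 = w.1.2.
  by apply/setP => B; rewrite -!mem_extend2_up E.
have n0 (X Y : {set {set 'I_n}}) : set0 \notin X :|: Y -> (set0 \in X) = false.
  by rewrite in_setU negb_or => /andP[/negbTE].
have zw : z.2 = w.2.
  case zE : z.2 zA => [[A [|]]|] zA.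
  - by have := mem_extend2_up0 z A; rewrite E mem_extend2_up0 zE eqxx => /eqP.
  - have := mem_extend1_up0 z A; rewrite E mem_extend1_up0 zE eqxx /=.
    case: w.2 => [[B [|]]|] //=; first by move=> /eqP ->.
    by move=> /eqP A0; rewrite A0 (n0 _ _ V0) in zA.
  - have := mem_extend1_up0 z set0; rewrite E mem_extend1_up0 zE eqxx /=.
    case: (w.2) wA => [[B [|]]|] //= wA /eqP B0.
    by rewrite -B0 (n0 _ _ W0) in wA.
have V1 : z.1.1 = w.1.1.
  apply/setP => B; have := mem_extend1_up z B; rewrite E mem_extend1_up.
  move: zA wA; rewrite zw; case: w.2 => [[A b] AV AW|_ _]; last by rewrite !andbT.
  by have [->|_] := eqVneq B A; rewrite ?AV ?AW// !andbT.
by move: zw V1 V2; case: z w {zA wA E V0 cV tV dV mV W0 cW tW dW mW} =>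
  [[? ?] ?] [[? ?] ?] /= -> -> ->.
Qed.

Lemma extend_surj (V' : {set {set 'I_n.+1}} * {set {set 'I_n.+1}}) :
  marked_partition V' -> exists2 z, extension z & V' = extend z.
Proof.
move=> /marked_partitionP[V0 cV tV dV mV].
have [B0 B0V' B00] := cV ord0; pose A := down B0.
have B0E : B0 = up0 A by rewrite down0K.
(* The point 0 is deleted from its block. If something remains, it returns to the blocks marked +1
   whatever mark it had; if nothing remains, 0 was a singleton and the option is [None]. *)
pose V1 := [set B | (up B \in V'.1) || ((B == A) && (A != set0))].
pose V2 := [set B | up B \in V'.2].
pose z := ((V1, V2), if A == set0 then None else Some (A, B0 \in V'.2)).
have uA B : B != set0 -> B = A -> up B \notin V'.1 :|: V'.2.
  move=> Bn0 BA; apply/negP => uV; have /set0Pn[i iB] := Bn0.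
  have := tV _ _ (lift ord0 i) uV B0V'; rewrite mem_up iB B0E mem_up0 -BA iB.
  by move=> /(_ isT isT)/esym/up0_neq_up.
have up0V B : up0 B \in V'.1 :|: V'.2 -> B = A.
  move=> BV; apply: up0_inj; rewrite -B0E; apply: tV BV B0V' _ _; last exact: B00.
  exact: ord0_up0.
have VB B i : B \in V1 :|: V2 -> i \in B ->
    exists C : {set 'I_n.+1},
      [/\ C \in V'.1 :|: V'.2, lift ord0 i \in C & C = up B \/ (C = B0 /\ B = A)].
  rewrite !inE => /orP[/orP[BV|/andP[/eqP BA A0]]|BV] iB.
  - by exists (up B); rewrite inE BV mem_up; split => //; left.
  - by exists B0; split => //; [rewrite B0E mem_up0 -BA|right].
  - by exists (up B); rewrite inE BV orbT mem_up; split => //; left.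
exists z.
  apply/andP; split; last first.
    by rewrite /z /=; case: ifPn => // A0; rewrite inE eqxx A0 orbT.
  apply/marked_partitionP; split.
  - have u0 : up set0 = set0 by apply/eqP; rewrite up_eq0.
    move: V0; rewrite !inE u0 !negb_or => /andP[-> ->].
    by rewrite negb_and negbK andbT eq_sym; case: eqP.
  - move=> i; have [B BV iB] := cV (lift ord0 i).
    have [[C CE]|[C CE]] := up_or_up0 B; subst B.
      exists C; last by rewrite -mem_up.
      by move: BV; rewrite !inE => /orP[->|->]; rewrite ?orbT.
    have CA := up0V _ BV; exists C; last by rewrite -mem_up0.
    rewrite !inE CA eqxx; suff -> : A != set0 by rewrite orbT.
    by apply/set0Pn; exists i; rewrite -CA -mem_up0.
  - move=> B C i BV CV iB iC.
    have [B' [B'V iB' BE]] := VB _ _ BV iB; have [C' [C'V iC' CE]] := VB _ _ CV iC.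
    have BC := tV _ _ _ B'V C'V iB' iC'.
    case: BE CE => [BE|[BE BA]] [CE|[CE CA]].
    + by apply: up_inj; rewrite -BE -CE.
    + by have := @up0_neq_up A B; rewrite -B0E -BE -CE BC.
    + by have := @up0_neq_up A C; rewrite -B0E -BE -CE BC.
    + by rewrite BA CA.
  - move=> B; rewrite !inE => /orP[|/andP[/eqP BA A0]] B2; first exact: dV.
    have Bn0 : B != set0 by rewrite BA.
    by have := uA _ Bn0 BA; rewrite inE B2 orbT.
  - by move=> B; rewrite inE => /mV; rewrite card_up.
have B0n2 : A = set0 -> B0 \in V'.2 = false.
  move=> A0; apply/negP => /mV; rewrite B0E card_up0 A0 cards0.
  by [].
have B01 : B0 \in V'.1 = ~~ (B0 \in V'.2).
  move: B0V'; rewrite inE; have := dV B0; case: (B0 \in V'.1); case: (B0 \in V'.2) => //.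
  by move=> /(_ isT isT).
have up0E B (P : {set {set 'I_n.+1}}) : P \subset V'.1 :|: V'.2 ->
    (up0 B \in P) = (B0 \in P) && (B == A).
  move=> /fintype.subsetP PV; have [->|BA] := eqVneq B A; first by rewrite -B0E andbT.
  by rewrite andbF; apply/negP => /PV /up0V; exact/eqP.
have E1 : V'.1 = (extend z).1.
  apply/setP => B; have [[C ->]|[C ->]] := up_or_up0 B.
    rewrite mem_extend1_up /= inE; have [A0|A0] := eqVneq A set0.
      by rewrite andbF orbF andbT.
    rewrite andbT; have [CA|CA] := eqVneq C A; last by rewrite orbF andbT.
    rewrite andbF; have Cn0 : C != set0 by rewrite CA.
    by have := uA _ Cn0 CA; rewrite inE negb_or => /andP[/negbTE].
  rewrite mem_extend1_up0 up0E ?subsetUl//= B01.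
  by have [A0|A0] := eqVneq A set0; rewrite // B0n2//= A0.
have E2 : V'.2 = (extend z).2.
  apply/setP => B; have [[C ->]|[C ->]] := up_or_up0 B.
    by rewrite mem_extend2_up /= inE.
  rewrite mem_extend2_up0 up0E ?subsetUr//=.
  have [A0|A0] := eqVneq A set0; first by rewrite B0n2.
  apply/andP/eqP => [[-> /eqP ->]//|[-> ->]]; by rewrite eqxx.
by case: (V') (extend z) E1 E2 => [? ?] [? ?] /= -> ->.
Qed.

Lemma sum_extend (W : nmodType)
    (F : {set {set 'I_n.+1}} * {set {set 'I_n.+1}} -> W) :
  (\sum_(V | marked_partition V) F V = \sum_(V | marked_partition V)
     (F (extend (V, None)) + \sum_(A in V.1)
       (F (extend (V, Some (A, false))) + F (extend (V, Some (A, true))))))%R.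
Proof.
transitivity (\sum_(z | extension z) F (extend z))%R.
  rewrite -(big_imset _ extend_inj); apply: eq_bigl => V.
  apply/idP/imsetP => [/extend_surj[z zA ->]|[z zA ->]]; first by exists z.
  exact: extend_marked.
rewrite /extension -(pair_big_dep _ (fun V (o : option ({set 'I_n} * bool)) =>
   if o is Some (A, _) then A \in V.1 else true) (fun V o => F (extend (V, o)))) /=.
apply: eq_bigr => V _; rewrite (bigD1 None)//=; congr (_ + _)%R.
rewrite (reindex_omap Some id) /=; last by case=> [[A b]|].
transitivity (\sum_(p | (p.1 \in V.1) && true) F (extend (V, Some (p.1, p.2))))%R.
  by apply: eq_big => [[A b]|[A b] _] //=; rewrite !andbT eqxx andbT.
rewrite -(pair_big_dep (fun A => A \in V.1) (fun _ _ => true)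
  (fun A b => F (extend (V, Some (A, b))))) /=.
by apply: eq_bigr => A _; rewrite big_bool /= addrC.
Qed.

End extension.
Arguments up {n} B.
Arguments up0 {n} B.
Arguments down {n} B.
Arguments extend {n} z.
Arguments extension {n} z.

(** * Extrema and ranks of blocks *)

Section block_extrema.
Import mathcomp.boot.finset.
Local Open Scope nat_scope.
Local Open Scope set_scope.

Lemma bmaxP m (B : {set 'I_m}) : B != set0 ->
  exists2 i : 'I_m, i \in B & bmax B = i /\ forall j : 'I_m, j \in B -> j <= i.
Proof.
move=> /set0Pn[i0 i0B].
have B0 : 0 < #|B| by apply/card_gt0P; exists i0.
have [i iB iE] := eq_bigmax_cond (fun i : 'I_m => i : nat) B0.
by exists i => //; split => // j jB; rewrite -iE; exact: leq_bigmax_cond.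
Qed.

Lemma bmax_eq m (B : {set 'I_m}) (i : 'I_m) : i \in B ->
  (forall j : 'I_m, j \in B -> j <= i) -> bmax B = i.
Proof.
move=> iB iM; apply/eqP; rewrite eqn_leq leq_bigmax_cond// andbT.
exact/bigmax_leqP.
Qed.

Lemma bmin_le m (B : {set 'I_m}) (i : 'I_m) : i \in B -> bmin B <= i.
Proof.
rewrite /bmin -[index_enum _]filter_predT => iB.
have : i \in [seq j <- index_enum 'I_m | predT j] by rewrite filter_predT mem_index_enum.
elim: [seq j <- _ | _] => // j r IH; rewrite inE big_cons => /predU1P[<-|/IH ri].
  by rewrite iB geq_minl.
by case: ifP => // _; rewrite geq_min ri orbT.
Qed.

Lemma bminP m (B : {set 'I_m}) : B != set0 ->
  exists2 i : 'I_m, i \in B & bmin B = i /\ forall j : 'I_m, j \in B -> i <= j.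
Proof.
move=> /set0Pn[i0 i0B].
pose k := [arg min_(j < i0 in B) (j : nat)].
have [kB kM] : k \in B /\ forall j, j \in B -> (k <= j).
  by rewrite /k; case: arg_minnP => // i iB iM; split.
exists k => //; split => //; apply/eqP; rewrite eqn_leq bmin_le//= /bmin.
elim/big_ind : _ => [|x y kx ky|j jB]; [exact: ltnW|by rewrite leq_min kx|exact: kM].
Qed.

Lemma bmin_eq m (B : {set 'I_m}) (i : 'I_m) : i \in B ->
  (forall j : 'I_m, j \in B -> i <= j) -> bmin B = i.
Proof.
move=> iB iM; have B0 : B != set0 by apply/set0Pn; exists i.
have [j jB [-> jM]] := bminP B0.
by apply/eqP; rewrite eqn_leq jM// iM.
Qed.

Variable n : nat.
Implicit Types (A B C : {set 'I_n}) (P : {set {set 'I_n}}).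

Lemma bmax_up B : B != set0 -> bmax (up B) = (bmax B).+1.
Proof.
move=> /bmaxP[i iB [-> iM]]; rewrite (@bmax_eq _ _ (lift ord0 i)) ?mem_up//.
move=> j; have [k ->|->] := unliftP ord0 j; last by rewrite ord0_up.
by rewrite mem_up => /iM.
Qed.

Lemma bmin_up B : B != set0 -> bmin (up B) = (bmin B).+1.
Proof.
move=> /bminP[i iB [-> iM]]; rewrite (@bmin_eq _ _ (lift ord0 i)) ?mem_up//.
move=> j; have [k ->|->] := unliftP ord0 j; last by rewrite ord0_up.
by rewrite mem_up => /iM.
Qed.

(** Joining 0 to a nonempty block leaves its maximum where [up] would put it, so the order of the
    blocks by maxima is unchanged. *)
Lemma bmax_up0 B : B != set0 -> bmax (up0 B) = (bmax B).+1.
Proof.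
move=> /bmaxP[i iB [-> iM]]; rewrite (@bmax_eq _ _ (lift ord0 i)) ?mem_up0//.
move=> j; have [k ->|-> //] := unliftP ord0 j.
by rewrite mem_up0 => /iM.
Qed.

Lemma bmax_up00 : bmax (up0 (set0 : {set 'I_n})) = 0.
Proof.
rewrite (@bmax_eq _ _ ord0) ?ord0_up0// => j; have [k ->|-> //] := unliftP ord0 j.
by rewrite mem_up0 inE.
Qed.

Lemma bmin_up0 B : bmin (up0 B) = 0.
Proof. by rewrite (@bmin_eq _ _ ord0) ?ord0_up0. Qed.

(** [block_rank P B] is [brank P (bmax B)]. With a number in place of the block, a block outside P
    can be ranked too, as when A is about to enter the blocks marked -1. *)
Definition brank m (P : {set {set 'I_m}}) (k : nat) := #|[set B in P | bmax B < k]|.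

Lemma brank_ups P k : set0 \notin P -> brank (up @: P) k.+1 = brank P k.
Proof.
move=> P0; rewrite /brank -[RHS](card_imset _ (@up_inj n)); congr #|pred_of_set _|.
apply/setP => B; rewrite inE; apply/andP/imsetP => [[/imsetP[C CP ->]]|[C]].
  rewrite bmax_up; last by apply: contraNneq P0 => <-.
  by rewrite ltnS => Ck; exists C; rewrite // inE CP.
rewrite inE => /andP[CP Ck] ->; rewrite mem_ups bmax_up ?ltnS//.
by apply: contraNneq P0 => <-.
Qed.

Lemma brankU1 m (P : {set {set 'I_m}}) X k : X \notin P ->
  brank (X |: P) k = (bmax X < k) + brank P k.
Proof.
move=> XP; rewrite /brank; have [Xk|Xk] := boolP (bmax X < k).
  have -> : [set B in X |: P | bmax B < k] = X |: [set B in P | bmax B < k].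
    by apply/setP => B; rewrite !inE; case: eqP => // ->; rewrite Xk.
  by rewrite cardsU1 inE (negbTE XP).
congr #|pred_of_set _|; apply/setP => B; rewrite !inE; case: eqP => // ->.
by rewrite (negbTE Xk) !andbF.
Qed.

Lemma brankD1 m (P : {set {set 'I_m}}) X k : X \in P ->
  brank P k = (bmax X < k) + brank (P :\ X) k.
Proof. by move=> XP; rewrite -brankU1 ?setD11// setD1K. Qed.

Lemma brank_ltn m (P : {set {set 'I_m}}) (B : {set 'I_m}) k : B \in P -> bmax B < k ->
  brank P (bmax B) < brank P k.
Proof.
move=> BP Bk; apply: proper_card; apply/properP; split.
  by apply/fintype.subsetP => C; rewrite !inE => /andP[-> /ltn_trans]; exact.
by exists B; rewrite !inE ?BP// ltnn andbF.
Qed.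

Lemma brank_leq m (P : {set {set 'I_m}}) k l : k <= l -> brank P k <= brank P l.
Proof.
move=> kl; apply: subset_leq_card; apply/fintype.subsetP => C.
by rewrite !inE => /andP[-> /leq_trans]; exact.
Qed.

Lemma brank_card m (P : {set {set 'I_m}}) (B : {set 'I_m}) : B \in P -> brank P (bmax B) < #|P|.
Proof.
move=> BP; apply: proper_card; apply/properP; split.
  by apply/fintype.subsetP => C; rewrite !inE => /andP[].
by exists B; rewrite // inE ltnn andbF.
Qed.

(** The rank is strictly increasing in the maximum, and the maxima are distinct; so it injects P
    into the ordinals below its size, hence is a bijection. *)
Lemma big_block_rank (W : Type) (idx : W) (op : Monoid.com_law idx) m
    (P : {set {set 'I_m}}) (h : nat -> W) : {in P &, injective (@bmax m)} ->
  \big[op/idx]_(B in P) h (block_rank P B) = \big[op/idx]_(b < #|P|) h b.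
Proof.
move=> Pinj; rewrite big_enum_val /=.
pose r (j : 'I_#|P|) := Ordinal (brank_card (enum_valP j)).
have rinj : injective r.
  move=> j k /(congr1 val) /= E; apply/enum_val_inj.
  apply: Pinj; rewrite ?enum_valP//.
  have [h1|h1|//] := ltngtP (bmax (enum_val j)) (bmax (enum_val k)).
  - by have := brank_ltn (enum_valP j) h1; rewrite E ltnn.
  - by have := brank_ltn (enum_valP k) h1; rewrite E ltnn.
by rewrite [RHS](reindex_inj rinj).
Qed.

End block_extrema.

Section marked_partition_blocks.
Import mathcomp.boot.finset.
Local Open Scope nat_scope.
Local Open Scope set_scope.
Variable n : nat.
Variable V : {set {set 'I_n}} * {set {set 'I_n}}.
Hypothesis mV : marked_partition V.

Lemma marked_set0 : (set0 \notin V.1) /\ (set0 \notin V.2).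
Proof.
have [V0 _ _ _ _] := marked_partitionP _ mV.
by move: V0; rewrite in_setU negb_or => /andP[].
Qed.

Lemma marked1_neq0 B : B \in V.1 -> B != set0.
Proof. by move=> BV; apply: contraNneq marked_set0.1 => <-. Qed.

Lemma marked2_neq0 B : B \in V.2 -> B != set0.
Proof. by move=> BV; apply: contraNneq marked_set0.2 => <-. Qed.

Lemma marked_notin2 B : B \in V.1 -> B \notin V.2.
Proof.
have [_ _ _ dV _] := marked_partitionP _ mV.
by move=> BV; apply/negP; exact: dV BV.
Qed.

Lemma marked_pblock B i : B \in V.1 :|: V.2 -> i \in B -> pblock (V.1 :|: V.2) i = B.
Proof.
move=> BV iB; apply: def_pblock => //.
by case/and3P : mV => /and3P[].
Qed.

(** The maximum of a block is one of its elements, and blocks with a common element coincide. *)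
Lemma marked_bmax_inj : {in V.1 :|: V.2 &, injective (@bmax n)}.
Proof.
have [V0 cV tV _ _] := marked_partitionP _ mV.
move=> B C BV CV E.
have Bn0 : B != set0 by apply: contraNneq V0 => <-.
have Cn0 : C != set0 by apply: contraNneq V0 => <-.
have [i iB [Bi _]] := bmaxP Bn0; have [j jC [Cj _]] := bmaxP Cn0.
have ij : i = j by apply: val_inj; rewrite /= -Bi -Cj.
by apply: (tV _ _ i BV CV iB); rewrite ij.
Qed.

Lemma marked_bmax_inj1 : {in V.1 &, injective (@bmax n)}.
Proof. by move=> B C BV CV; apply: marked_bmax_inj; rewrite inE ?BV ?CV. Qed.

Lemma marked_cover i : exists2 B, B \in V.1 :|: V.2 & i \in B.
Proof. by have [_ cV _ _ _] := marked_partitionP _ mV; exact: cV. Qed.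

End marked_partition_blocks.

(** * Points assembled from the variables of the blocks *)

Section assembling.
Import mathcomp.boot.finset.
Local Open Scope nat_scope.
Local Open Scope set_scope.
Context {R : realType} {T : completePseudoMetricType R}.
Local Notation bT := (borel T).

(** [assemble] with sequences in place of tuples, so that the numbers of blocks do not appear in the
    types. *)
Definition assembleS n (V : {set {set 'I_n}} * {set {set 'I_n}}) (s u : seq T) : n.-tuple T :=
  [tuple let B := finset.pblock (V.1 :|: V.2) i in
         if B \in V.1 then nth point s (block_rank V.1 B)
         else nth point u (block_rank V.2 B) | i < n].

Section entries.
Variables (n : nat) (V : {set {set 'I_n}} * {set {set 'I_n}}).
Hypothesis mV : marked_partition V.

Lemma tnth_assemble1 s u B i : B \in V.1 -> i \in B ->
  tnth (assembleS V s u) i = nth point s (block_rank V.1 B).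
Proof.
move=> BV iB; have BU : B \in V.1 :|: V.2 by rewrite inE BV.
by rewrite tnth_mktuple /= (marked_pblock mV BU iB) BV.
Qed.

Lemma tnth_assemble2 s u B i : B \in V.2 -> i \in B ->
  tnth (assembleS V s u) i = nth point u (block_rank V.2 B).
Proof.
move=> BV iB; have BU : B \in V.1 :|: V.2 by rewrite inE BV orbT.
rewrite tnth_mktuple /= (marked_pblock mV BU iB).
by case: ifP => // B1; have := marked_notin2 mV B1; rewrite BV.
Qed.

Lemma nth_assemble1 s u B : B \in V.1 ->
  nth point (assembleS V s u) (bmax B) = nth point s (block_rank V.1 B).
Proof.
move=> BV; have [i iB [-> _]] := bmaxP (marked1_neq0 mV BV).
by rewrite -tnth_nth (tnth_assemble1 _ _ BV iB).
Qed.

End entries.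

Section extend_assemble.
Variables (n : nat) (V : {set {set 'I_n}} * {set {set 'I_n}}).
Hypothesis mV : marked_partition V.

Let ext o := extension (V, o).

(** The block {0} has the smallest of all maxima, so it takes rank 0 and moves every other block
    marked +1 up by one rank. *)
Lemma assemble_new s u :
  assembleS (extend (V, None)) s u =
  @tcons _ bT n (nth point s 0, assembleS V (behead s) u).
Proof.
have e : ext None by rewrite /ext /extension mV.
have mE := extend_marked e; apply: eq_from_tnth => i.
have [V10 V20] := marked_set0 mV.
have [j ->|->] := unliftP ord0 i; last first.
  rewrite (tnth_assemble1 mE _ _ (B := up0 set0)) ?ord0_up0//; last by rewrite mem_extend1_up0 /=.
  rewrite /block_rank -/(brank _ _) bmax_up00 /tcons /=.
  by rewrite (_ : brank _ 0 = 0)//; apply: eq_card0 => C; rewrite inE andbF.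
rewrite tnthS; have [B] := marked_cover mV j; rewrite inE => /orP[BV|BV] jB.
  rewrite (tnth_assemble1 mE _ _ (B := up B)) ?mem_up//; last by rewrite mem_extend1_up BV.
  rewrite (tnth_assemble1 mV _ _ BV jB) nth_behead; congr nth.
  rewrite /block_rank -!/(brank _ _) /= brankU1 ?up0_ups// bmax_up ?(marked1_neq0 mV)//.
  by rewrite bmax_up00 brank_ups.
rewrite (tnth_assemble2 mE _ _ (B := up B)) ?mem_up//; last by rewrite mem_extend2_up.
rewrite (tnth_assemble2 mV _ _ BV jB); congr nth.
by rewrite /block_rank -!/(brank _ _) /= bmax_up ?(marked2_neq0 mV)// brank_ups.
Qed.

Variable A : {set 'I_n}.
Hypothesis AV : A \in V.1.

Let V1A0 : set0 \notin V.1 :\ A.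
Proof. by rewrite in_setD1 negb_and (marked_set0 mV).1 orbT. Qed.

(** No rank changes, and the point 0 repeats the variable of A. *)
Lemma assemble_join s u :
  assembleS (extend (V, Some (A, false))) s u =
  @tcons _ bT n (nth point s (block_rank V.1 A), assembleS V s u).
Proof.
have e : ext (Some (A, false)) by rewrite /ext /extension mV.
have mE := extend_marked e; apply: eq_from_tnth => i.
have [V10 V20] := marked_set0 mV.
have rk B : B \in V.1 -> brank (up0 A |: (up @: (V.1 :\ A))) (bmax B).+1 = brank V.1 (bmax B).
  move=> BV; rewrite brankU1 ?up0_ups// brank_ups// bmax_up0 ?(marked1_neq0 mV)//.
  by rewrite ltnS -brankD1.
have up0A : up0 A \in (extend (V, Some (A, false))).1 by rewrite mem_extend1_up0 /=.
have [j ->|->] := unliftP ord0 i; last first.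
  rewrite (tnth_assemble1 mE _ _ up0A) ?ord0_up0//.
  by rewrite /block_rank -!/(brank _ _) bmax_up0 ?(marked1_neq0 mV)//= rk.
rewrite tnthS; have [B] := marked_cover mV j; rewrite inE => /orP[BV|BV] jB.
  rewrite (tnth_assemble1 mV _ _ BV jB); have [BA|BA] := eqVneq B A.
    rewrite (tnth_assemble1 mE _ _ up0A) ?mem_up0 -?BA//.
    by rewrite /block_rank -!/(brank _ _) BA bmax_up0 ?(marked1_neq0 mV)//= rk.
  rewrite (tnth_assemble1 mE _ _ (B := up B)) ?mem_up//; last first.
    by rewrite mem_extend1_up BV.
  by rewrite /block_rank -!/(brank _ _) bmax_up ?(marked1_neq0 mV)//= rk.
rewrite (tnth_assemble2 mE _ _ (B := up B)) ?mem_up//; last by rewrite mem_extend2_up.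
rewrite (tnth_assemble2 mV _ _ BV jB); congr nth.
by rewrite /block_rank -!/(brank _ _) /= bmax_up ?(marked2_neq0 mV)// brank_ups.
Qed.

(** When A changes its mark, its variable leaves the list s at the rank of A and enters the list u
    at the rank that the maximum of A has among the blocks marked -1. *)
Lemma assemble_contract s u x :
  (block_rank V.1 A <= size s) -> (brank V.2 (bmax A) <= size u) ->
  assembleS (extend (V, Some (A, true))) s (insertT (brank V.2 (bmax A)) x u) =
  @tcons _ bT n (x, assembleS V (insertT (block_rank V.1 A) x s) u).
Proof.
move=> As Au.
have e : ext (Some (A, true)) by rewrite /ext /extension mV.
have mE := extend_marked e; apply: eq_from_tnth => i.
have [V10 V20] := marked_set0 mV.
have An0 := marked1_neq0 mV AV.
have rk1 B : B \in V.1 -> brank (up @: (V.1 :\ A)) (bmax B).+1 = brank (V.1 :\ A) (bmax B).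
  by move=> BV; rewrite brank_ups.
have rk2 k : brank (up0 A |: (up @: V.2)) k.+1 = (bmax A < k) + brank V.2 k.
  by rewrite brankU1 ?up0_ups// brank_ups// bmax_up0// ltnS.
have up0A : up0 A \in (extend (V, Some (A, true))).2 by rewrite mem_extend2_up0 /=.
have xA j : j \in up0 A -> tnth (assembleS (extend (V, Some (A, true))) s
    (insertT (brank V.2 (bmax A)) x u)) j = x.
  move=> jA; rewrite (tnth_assemble2 mE _ _ up0A jA) /block_rank -!/(brank _ _) /=.
  by rewrite bmax_up0// rk2 ltnn add0n nth_insertT// ltnn eqxx.
have [j ->|->] := unliftP ord0 i; last by rewrite xA ?ord0_up0.
rewrite tnthS; have [B] := marked_cover mV j; rewrite inE => /orP[BV|BV] jB.
  rewrite (tnth_assemble1 mV _ _ BV jB) nth_insertT//; have [BA|BA] := eqVneq B A.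
    by rewrite xA ?mem_up0 -?BA// ltnn eqxx.
  rewrite (tnth_assemble1 mE _ _ (B := up B)) ?mem_up//; last first.
    by rewrite mem_extend1_up BV.
  rewrite /block_rank -!/(brank _ _) /= bmax_up ?(marked1_neq0 mV)// rk1//.
  have AB : bmax A != bmax B.
    by apply: contraNneq BA => /(marked_bmax_inj1 mV AV BV) ->.
  rewrite (brankD1 (bmax B) AV); have [h|h|h] := ltngtP (bmax A) (bmax B).
  - have := brank_ltn AV h; rewrite (brankD1 (bmax B) AV) h add1n => h'.
    by rewrite ltnNge ltnW//= gtn_eqF//.
  - have hF : (bmax A < bmax B) = false by rewrite ltnNge (ltnW h).
    by have := brank_ltn BV h; rewrite (brankD1 (bmax B) AV) hF add0n => ->.
  - by rewrite h eqxx in AB.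
rewrite (tnth_assemble2 mE _ _ (B := up B)) ?mem_up//; last by rewrite mem_extend2_up.
rewrite (tnth_assemble2 mV _ _ BV jB) /block_rank -!/(brank _ _) /=.
rewrite bmax_up ?(marked2_neq0 mV)// rk2 nth_insertT//.
have AB : bmax A != bmax B.
  apply/eqP => E; have AU : A \in V.1 :|: V.2 by rewrite inE AV.
  have BU : B \in V.1 :|: V.2 by rewrite inE BV orbT.
  by have := marked_notin2 mV AV; rewrite (marked_bmax_inj mV AU BU E) BV.
have [h|h|h] := ltngtP (bmax A) (bmax B).
- have := brank_leq V.2 (ltnW h) => h'.
  by rewrite add1n ltnNge leqW//= gtn_eqF.
- by rewrite add0n (brank_ltn BV h).
- by rewrite h eqxx in AB.
Qed.

End extend_assemble.

End assembling.

(** * Bounded functions supported in a set of finite measure *)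

Section bounded_support.
Context {R : realType} {d : measure_display} {X : measurableType d}.
Variables (mu : {measure set X -> \bar R}) (D : set X).
Hypotheses (mD : measurable D) (Dfin : (mu D < +oo)%E).

Lemma integrable_indic_fin : mu.-integrable setT (fun x => (\1_D x)%:E : \bar R).
Proof.
apply/integrableP; split; first exact/measurable_EFinP/measurable_indic.
under eq_integral do rewrite gee0_abs ?lee_fin//.
by rewrite integral_indic// setIT.
Qed.

Lemma bounded_cintegrable (h : X -> R[i]) (C : R) : cmeasurable setT h ->
  (forall x, normsq (h x) <= C) -> (forall x, ~ D x -> h x = 0) -> cintegrable mu h.
Proof.
move=> mh hC hD.
(* A point is needed to know that the bound C is nonnegative; over an empty space there is nothing
   to prove. *)
have [x0|noX] := pselect (exists x : X, True); last first.
  by apply: eq_cintegrable (cintegrable0 mu) => x; case: noX; exists x.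
have C0 : 0 <= C by case: x0 => x _; exact: le_trans (normsq_ge0 _) (hC x).
apply: (@le_cintegrable _ _ _ mu _ (fun x => Num.sqrt C * \1_D x)) => //.
- move=> x; have [Dx|Dx] := pselect (D x).
    by rewrite indicE mem_set// mulr1 sqr_sqrtr.
  by rewrite hD// normsq0 sqr_ge0.
- exact: (integrableZl measurableT (Num.sqrt C) integrable_indic_fin).
Qed.

Lemma bounded_sqnorm (h : X -> R[i]) (C : R) : cmeasurable setT h ->
  (forall x, normsq (h x) <= C) -> (forall x, ~ D x -> h x = 0) ->
  (sqnorm mu h <= C%:E * mu D)%E.
Proof.
move=> mh hC hD.
have [[x0 _]|noX] := pselect (exists x : X, True); last first.
  have -> : D = set0 by apply/seteqP; split => // x; case: noX; exists x.
  rewrite measure0 mule0 /sqnorm (_ : (fun x => _) = cst 0%E) ?integral0//.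
  by apply/funext => x; case: noX; exists x.
have C0 : 0 <= C := le_trans (normsq_ge0 _) (hC x0).
apply: (@le_trans _ _ (\int[mu]_x (C%:E * (\1_D x)%:E))%E).
  apply: ge0_le_integral => //.
  - by move=> x _; rewrite lee_fin normsq_ge0.
  - exact/measurable_EFinP/measurable_normsq.
  - by apply: measurable_funeM; exact/measurable_EFinP/measurable_indic.
  - move=> x _; rewrite -EFinM lee_fin; have [Dx|Dx] := pselect (D x).
      by rewrite indicE mem_set// mulr1.
    by rewrite hD// normsq0 mulr_ge0.
rewrite ge0_integralZl_EFin//; last exact/measurable_EFinP/measurable_indic.
by rewrite integral_indic// setIT.
Qed.

Lemma bounded_cL2 (h : X -> R[i]) (C : R) : cmeasurable setT h ->
  (forall x, normsq (h x) <= C) -> (forall x, ~ D x -> h x = 0) -> cL2 mu h.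
Proof.
move=> mh hC hD; split => //; apply: le_lt_trans (bounded_sqnorm mh hC hD) _.
have [[x0 _]|noX] := pselect (exists x : X, True); last first.
  have -> : D = set0 by apply/seteqP; split => // x; case: noX; exists x.
  by rewrite measure0 mule0 ltry.
by rewrite lte_mul_pinfty// lee_fin (le_trans (normsq_ge0 _) (hC x0)).
Qed.

(** Cauchy-Schwarz against the indicator of D, which acts as the identity on h. *)
Lemma normsq_cintegral_le_sqnorm (h : X -> R[i]) : cmeasurable setT h ->
  (forall x, ~ D x -> h x = 0) ->
  ((normsq (cintegral mu h))%:E <= (2 * (fine (mu D) + 1))%:E * sqnorm mu h)%E.
Proof.
move=> mh hD.
have i2 : mu.-integrable setT (fun x => (\1_D x ^+ 2 : R)%:E).
  apply: eq_integrable integrable_indic_fin => //= x _.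
  by rewrite indicE; case: (x \in D); rewrite ?expr1n ?expr0n.
have mi : measurable_fun setT (\1_D : X -> R) by exact: measurable_indic.
have := normsq_cintegral_le mi i2 mh.
have -> : cintegral mu (fun x => (\1_D x)%:C * h x) = cintegral mu h.
  apply: eq_cintegral => x; have [Dx|Dx] := pselect (D x).
    by rewrite indicE mem_set// mul1r.
  by rewrite hD// mulr0.
have -> // : \int[mu]_x (\1_D x ^+ 2) = fine (mu D).
have <- : (\int[mu]_x (\1_D x)%:E)%E = mu D by rewrite integral_indic// setIT.
congr fine; apply: eq_integral => x _.
by rewrite indicE; case: (x \in D); rewrite ?expr1n ?expr0n.
Qed.

Lemma bounded_normsq_cintegral (h : X -> R[i]) (C : R) : cmeasurable setT h ->
  (forall x, normsq (h x) <= C) -> (forall x, ~ D x -> h x = 0) ->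
  normsq (cintegral mu h) <= 2 * (fine (mu D) + 1) * (C * fine (mu D)).
Proof.
move=> mh hC hD; rewrite -lee_fin; apply: le_trans (normsq_cintegral_le_sqnorm mh hD) _.
rewrite [leRHS]EFinM; apply: lee_wpmul2l.
  by rewrite lee_fin mulr_ge0// addr_ge0 ?fine_ge0.
have Dnum : mu D \is a fin_num by rewrite ge0_fin_numE.
by rewrite EFinM fineK//; exact: bounded_sqnorm.
Qed.

Lemma bounded_cvg_sqnorm (h : nat -> X -> R[i]) (C : R) :
  (forall j, cmeasurable setT (h j)) ->
  (forall j x, normsq (h j x) <= C) -> (forall j x, ~ D x -> h j x = 0) ->
  (forall x, normsq (h j x) @[j --> \oo] --> (0 : R)) ->
  sqnorm mu (h j) @[j --> \oo] --> 0%E.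
Proof.
move=> mh hC hD h0.
have gint : mu.-integrable setT (fun x => (C * \1_D x)%:E).
  exact: (integrableZl measurableT C integrable_indic_fin).
have [] // := @dominated_convergence _ _ _ mu setT measurableT
  (fun j x => (normsq (h j x))%:E) (cst 0%E) (fun x => (C * \1_D x)%:E).
- by move=> j; exact/measurable_EFinP/measurable_normsq.
- by apply: aeW => x _; apply: cvg_EFin; [exact: nearW|exact: h0].
- apply: aeW => x j _ /=; rewrite lee_fin ger0_norm ?normsq_ge0//.
  have [Dx|Dx] := pselect (D x); first by rewrite indicE mem_set// mulr1.
  by rewrite hD// normsq0 indicE memNset// mulr0.
- by rewrite integral0.
Qed.

End bounded_support.

Section K_class.
Context {R : realType} {T : completePseudoMetricType R}.
Variable sigma : {sigma_finite_measure set (borel T) -> \bar R}.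
Local Notation bT := (borel T).
Variable K : set bT.
Hypotheses (mK : measurable K) (Kfin : (sigma K < +oo)%E).

(** One K for all coordinates and all degrees: tensoring with a field and smearing over a partition
    stay within the class. The bound is put on [normsq], which is real-valued and multiplicative. *)
Definition Kclass m (f : m.-tuple T -> R[i]) : Prop :=
  [/\ @cmeasurable R _ (m.-tuple bT) setT f, exists C : R, forall t, normsq (f t) <= C
    & forall t i, ~ K (tnth t i) -> f t = 0].

Lemma sigman_rectK m : (@sigman R T sigma m (rect (fun _ : 'I_m => K)) < +oo)%E.
Proof.
rewrite -ge0_fin_numE; last exact: measure_ge0.
rewrite (_ : sigman _ _ = \prod_(i < m) sigma K)%E; last exact: sigman_rect.
by apply: prode_fin_num => i _; rewrite ge0_fin_numE.
Qed.

Lemma measurable_rectK m : measurable (rect (fun _ : 'I_m => K)).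
Proof. exact: measurable_rect. Qed.

Lemma notin_rectK m (f : m.-tuple T -> R[i]) : Kclass f ->
  forall t : m.-tuple bT, ~ rect (fun _ : 'I_m => K) t -> f t = 0.
Proof.
by move=> [_ _ fK] t /existsNP[i ti]; exact: fK ti.
Qed.

Lemma Kclass_cintegrable m (f : m.-tuple T -> R[i]) : Kclass f ->
  cintegrable (@sigman R T sigma m) f.
Proof.
move=> fK; have [mf [C fC] _] := fK.
exact: (@bounded_cintegrable _ _ _ (@sigman R T sigma m) _ (@measurable_rectK m)
  (sigman_rectK m) f C mf fC (notin_rectK fK)).
Qed.

Lemma Kclass_L2 m (f : m.-tuple T -> R[i]) : Kclass f -> L2 sigma f.
Proof.
move=> fK; have [mf [C fC] _] := fK.
exact: (@bounded_cL2 _ _ _ (@sigman R T sigma m) _ (@measurable_rectK m)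
  (sigman_rectK m) f C mf fC (notin_rectK fK)).
Qed.

Lemma Kclass_lin m (c : R[i]) (f g : m.-tuple T -> R[i]) :
  Kclass f -> Kclass g -> Kclass (fun t => c * f t + g t).
Proof.
move=> [mf [C fC] fK] [mg [D gD] gK]; split.
- by apply: cmeasurableD => //; apply: cmeasurableM => //; exact: cmeasurable_cst.
- exists (2 * (normsq c * C + D)) => t; apply: le_trans (normsqD_le _ _) _.
  by rewrite ler_pM2l// lerD// normsqM ler_wpM2l ?normsq_ge0.
- by move=> t i ti; rewrite (fK t i)// (gK t i)// mulr0 addr0.
Qed.

Definition Kfield (f : T -> R) : Prop :=
  [/\ measurable_fun (setT : set bT) f, exists C : R, forall x, `|f x| <= C
    & forall x, ~ K x -> f x = 0].

Lemma Kfield_admissible f : Kfield f -> admissible sigma f.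
Proof.
move=> [mf [C fC] fK]; split => //; first by exists C.
have mfc : cmeasurable setT (fun x : bT => (f x)%:C) by exact: cmeasurable_real.
have fC2 x : normsq (f x)%:C <= C ^+ 2.
  rewrite normsq_real -[leLHS]real_normK ?num_real// ler_pXn2r// nnegrE//.
  exact: le_trans (fC x).
have f2 : cL2 sigma (fun x : bT => (f x)%:C).
  by apply: (bounded_cL2 mK Kfin mfc fC2) => x /fK ->.
by have := cL2_sqr_integrable f2; under eq_fun do rewrite normsq_real.
Qed.

Lemma Kclass_tensor m f0 (f : m.-tuple T -> R[i]) :
  Kfield f0 -> Kclass f -> Kclass (tensor f0 f).
Proof.
move=> f0K [mf [C fC] fK]; have [mf0 [C0 f0C] f00] := f0K; split.
- exact: (cmeasurable_tensor (Kfield_admissible f0K) mf).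
- exists (C0 ^+ 2 * C) => t; rewrite normsqM ler_pM ?normsq_ge0//.
  rewrite normsq_real -[leLHS]real_normK ?num_real// ler_pXn2r// nnegrE//.
  exact: le_trans (f0C point).
- move=> t i; have [x [u ->]] := tconsP t; rewrite tensor_tcons.
  have [j ->|->] := unliftP ord0 i; first by rewrite tnthS => /fK->; rewrite mulr0.
  by move=> /f00 ->; rewrite mul0r.
Qed.

Lemma measurable_nth m j :
  measurable_fun (setT : set (m.-tuple bT)) (fun t => nth point (t : seq T) j : bT).
Proof.
have [jm|jm] := ltnP j m; last first.
  rewrite (_ : (fun t => _) = cst (point : bT)); first exact: measurable_cst.
  by apply/funext => t; rewrite nth_default// size_tuple.
rewrite (_ : (fun t => _) = @tnth _ bT ^~ (Ordinal jm)); first exact: measurable_tnth.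
by apply/funext => t; rewrite (tnth_nth point).
Qed.

End K_class.

(** * The recursion of the smeared functions *)
Section partition_kernel.
Import mathcomp.boot.finset.
Local Open Scope set_scope.
Context {R : realType} {T : completePseudoMetricType R}.
Local Notation bT := (borel T).
Variable Q : T -> T -> R[i].

(** The inner products of [Qpartition]: here for a block marked +1 with maximum m, in [crossD] for a
    block marked -1 with extremes k and m. Only the extremes enter, so a change of mark can be
    followed on them. *)
Definition crossA n (P : {set {set 'I_n}}) (m : nat) (t : seq T) : R[i] :=
  \prod_(B in P | (bmin B < m)%N && (m < bmax B)%N)
    Q (nth point t (bmin B)) (nth point t m).

Definition crossD n (P : {set {set 'I_n}}) (k m : nat) (t : seq T) : R[i] :=
  \prod_(B in P | [&& (k < bmin B)%N, (bmin B < m)%N & (m < bmax B)%N])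
    Q (nth point t (bmin B)) (nth point t m).

Lemma QpartitionE n (V : {set {set 'I_n}} * {set {set 'I_n}}) (t : n.-tuple T) :
  Qpartition Q V t =
  (\prod_(B in V.2) crossD V.2 (bmin B) (bmax B) t) *
  \prod_(B in V.1) crossA V.2 (bmax B) t.
Proof. by []. Qed.

Variable n : nat.
Implicit Types (P : {set {set 'I_n}}) (t : seq T).

Lemma crossA_ups P m x t : set0 \notin P ->
  crossA (up @: P) m.+1 (x :: t) = crossA P m t.
Proof.
move=> P0; rewrite /crossA !big_mkcondr /= big_imset /=; last first.
  by move=> B C _ _; exact: up_inj.
apply: eq_bigr => B BP; have Bn0 : B != set0 by apply: contraNneq P0 => <-.
by rewrite bmin_up// bmax_up// !ltnS.
Qed.

Lemma crossD_ups P k m x t : set0 \notin P ->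
  crossD (up @: P) k.+1 m.+1 (x :: t) = crossD P k m t.
Proof.
move=> P0; rewrite /crossD !big_mkcondr /= big_imset /=; last first.
  by move=> B C _ _; exact: up_inj.
apply: eq_bigr => B BP; have Bn0 : B != set0 by apply: contraNneq P0 => <-.
by rewrite bmin_up// bmax_up// !ltnS.
Qed.

(** With minimum 0 the condition on the minima always holds, so the crossings of a contracted block
    are the factors that it had before, as a block marked +1. *)
Lemma crossD_ups0 P m x t : set0 \notin P ->
  crossD (up @: P) 0 m.+1 (x :: t) = crossA P m t.
Proof.
move=> P0; rewrite /crossD /crossA !big_mkcondr /= big_imset /=; last first.
  by move=> B C _ _; exact: up_inj.
apply: eq_bigr => B BP; have Bn0 : B != set0 by apply: contraNneq P0 => <-.
by rewrite bmin_up// bmax_up// !ltnS.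
Qed.

Lemma crossA_0 m (P : {set {set 'I_m}}) t : crossA P 0 t = 1.
Proof. by rewrite /crossA big1// => B /and3P[]. Qed.

Lemma crossA_up0 P A m x t : set0 \notin P -> A != set0 ->
  crossA (up0 A |: (up @: P)) m.+1 (x :: t) =
  (if (m < bmax A)%N then Q x (nth point t m) else 1) * crossA P m t.
Proof.
move=> P0 A0; rewrite -(crossA_ups _ x _ P0) /crossA !big_mkcondr /=.
rewrite big_setU1 ?up0_ups//=; congr (_ * _).
by rewrite bmin_up0 bmax_up0// ltnS.
Qed.

(** The new block has minimum 0, so it never has the larger minimum in a crossing and adds no factor
    to the other blocks. *)
Lemma crossD_up0 P A k m t :
  crossD (up0 A |: (up @: P)) k m t = crossD (up @: P) k m t.
Proof.
rewrite /crossD !big_mkcondr /= big_setU1 ?up0_ups//=.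
by rewrite bmin_up0 ltn0 mul1r.
Qed.

Variable V : {set {set 'I_n}} * {set {set 'I_n}}.
Hypothesis mV : marked_partition V.

Let V10 : set0 \notin V.1 := (marked_set0 mV).1.
Let V20 : set0 \notin V.2 := (marked_set0 mV).2.

Lemma Qpartition_new x (t : n.-tuple T) :
  Qpartition Q (extend (V, None)) (@tcons _ bT n (x, t)) = Qpartition Q V t.
Proof.
rewrite !QpartitionE /=; congr (_ * _).
  rewrite big_imset /=; last by move=> B C _ _; exact: up_inj.
  apply: eq_bigr => B BV; have Bn0 := marked2_neq0 mV BV.
  by rewrite bmin_up// bmax_up// crossD_ups.
rewrite big_setU1 ?up0_ups//= bmax_up00 crossA_0 mul1r.
rewrite big_imset /=; last by move=> B C _ _; exact: up_inj.
apply: eq_bigr => B BV; have Bn0 := marked1_neq0 mV BV.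
by rewrite bmax_up// crossA_ups.
Qed.

Variable A : {set 'I_n}.
Hypothesis AV : A \in V.1.

Let A0 : A != set0. Proof. exact: (marked1_neq0 mV AV). Qed.

Lemma Qpartition_join x (t : n.-tuple T) :
  Qpartition Q (extend (V, Some (A, false))) (@tcons _ bT n (x, t)) = Qpartition Q V t.
Proof.
rewrite !QpartitionE /=; congr (_ * _).
  rewrite big_imset /=; last by move=> B C _ _; exact: up_inj.
  apply: eq_bigr => B BV; have Bn0 := marked2_neq0 mV BV.
  by rewrite bmin_up// bmax_up// crossD_ups.
rewrite big_setU1 ?up0_ups//= bmax_up0// crossA_ups// [RHS](big_setD1 A)//=.
congr (_ * _); rewrite big_imset /=; last by move=> B C _ _; exact: up_inj.
apply: eq_bigr => B; rewrite in_setD1 => /andP[_ BV].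
by rewrite bmax_up ?(marked1_neq0 mV)// crossA_ups.
Qed.

(** The factors of A pass from the second product to the first, those between the other old blocks
    are unchanged, and the new block meets the blocks marked +1 whose maximum is smaller than that
    of A. *)
Lemma Qpartition_contract x (t : n.-tuple T) :
  Qpartition Q (extend (V, Some (A, true))) (@tcons _ bT n (x, t)) =
  Qpartition Q V t *
  \prod_(B in V.1) (if (bmax B < bmax A)%N then Q x (nth point t (bmax B)) else 1).
Proof.
rewrite !QpartitionE /= big_setU1 ?up0_ups//= bmax_up0// bmin_up0.
rewrite crossD_up0 crossD_ups0// big_imset /=; last by move=> B C _ _; exact: up_inj.
rewrite [\prod_(B in V.1) crossA _ _ _](big_setD1 A)//=.
rewrite [\prod_(B in V.1) (if _ then _ else _)](big_setD1 A)//= ltnn mul1r.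
rewrite (eq_bigr (fun B => crossD V.2 (bmin B) (bmax B) t)); last first.
  move=> B BV; have Bn0 := marked2_neq0 mV BV.
  by rewrite crossD_up0 bmin_up// bmax_up// crossD_ups.
rewrite big_imset /=; last by move=> B C _ _; exact: up_inj.
rewrite [X in _ * _ * X = _](eq_bigr (fun B =>
    (if (bmax B < bmax A)%N then Q x (nth point t (bmax B)) else 1)
    * crossA V.2 (bmax B) t)); last first.
  move=> B; rewrite in_setD1 => /andP[_ BV].
  by rewrite bmax_up ?(marked1_neq0 mV)// crossA_up0.
rewrite big_split /=. ring.
Qed.

End partition_kernel.

Section block_rank_surjectivity.
Import mathcomp.boot.finset.
Local Open Scope nat_scope.
Local Open Scope set_scope.
Variables (m : nat) (P : {set {set 'I_m}}).
Hypothesis Pinj : {in P &, injective (@bmax m)}.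

(** For the boolean law [orb], the reindexing [big_block_rank] becomes a statement of existence. *)
Lemma block_rank_surj a : a < #|P| -> exists2 B, B \in P & block_rank P B = a.
Proof.
move=> aP; have := big_block_rank orb (fun b => b == a) Pinj.
rewrite [RHS](_ : _ = true) ?big_orE; last first.
  by apply/existsP; exists (Ordinal aP) => /=.
by move=> /existsP[B /andP[BP /eqP Ba]]; exists B.
Qed.

Lemma block_rank_ltn A B : A \in P -> B \in P ->
  (block_rank P B < block_rank P A) = (bmax B < bmax A).
Proof.
move=> AP BP; apply/idP/idP => [|BA]; last exact: brank_ltn BP BA.
by rewrite !ltnNge; apply: contraNN; exact: brank_leq.
Qed.

End block_rank_surjectivity.

Section smearing.
Context {R : realType} {T : completePseudoMetricType R}.
Variable sigma : {sigma_finite_measure set (borel T) -> \bar R}.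
Local Notation bT := (borel T).
Variable K : set bT.
Hypotheses (mK : measurable K) (Kfin : (sigma K < +oo)%E).
Variable Q : T -> T -> R[i].
Hypothesis mQ : cmeasurable setT (fun z : bT * bT => Q z.1 z.2).
Hypothesis Qnorm : forall s t, normsq (Q s t) = 1.
Variable lambda : R.

(* [smear] as a function on sequences: for the partitions built by [extend] the
   number of variables #|V.1| is known only up to a propositional equality. *)
Definition smearS n (f : n.-tuple T -> R[i]) V (s : seq T) : R[i] :=
  lambda%:C ^+ lambda_exponent V *
  cintegral (@sigman R T sigma #|V.2|) (fun u : #|V.2|.-tuple bT =>
    f (assembleS V s u) * Qpartition Q V (assembleS V s u)).

Lemma smearSE n (f : n.-tuple T -> R[i]) (V : {set {set 'I_n}} * {set {set 'I_n}}) s l :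
  #|V.2| = l ->
  smearS f V s = lambda%:C ^+ lambda_exponent V *
  cintegral (@sigman R T sigma l) (fun u : l.-tuple bT =>
    f (assembleS V s u) * Qpartition Q V (assembleS V s u)).
Proof. by move=> <-. Qed.

Lemma measurable_assemble n (V : {set {set 'I_n}} * {set {set 'I_n}}) k l :
  measurable_fun setT
    (fun z : k.-tuple bT * l.-tuple bT => assembleS V z.1 z.2 : n.-tuple bT).
Proof.
apply/measurable_fun_tnthP => i.
rewrite (_ : _ \o _ = (fun z : k.-tuple bT * l.-tuple bT =>
   let B := finset.pblock (V.1 :|: V.2)%SET i in
   if B \in V.1 then nth point z.1 (block_rank V.1 B) : bT
   else nth point z.2 (block_rank V.2 B))); last first.
  by apply/funext => z; rewrite /= tnth_mktuple.
cbv zeta; case: (_ \in V.1).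
  exact: (measurableT_comp (measurable_nth _) measurable_fst).
exact: (measurableT_comp (measurable_nth _) measurable_snd).
Qed.

Lemma cmeasurable_Qpartition n (V : {set {set 'I_n}} * {set {set 'I_n}}) :
  @cmeasurable R _ (n.-tuple bT) setT (Qpartition Q V).
Proof.
by apply: cmeasurableM; apply: cmeasurable_prod => B _; apply: cmeasurable_prod => C _;
  apply: (cmeasurable_kernel mQ); exact: measurable_nth.
Qed.

Lemma normsq_Qpartition n (V : {set {set 'I_n}} * {set {set 'I_n}}) (t : n.-tuple T) :
  normsq (Qpartition Q V t) = 1.
Proof.
by rewrite /Qpartition normsqM !normsq_prod ?mulr1// => B _; apply: normsq_prod.
Qed.

Section one_partition.
Variables (n : nat) (V : {set {set 'I_n}} * {set {set 'I_n}}).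
Hypothesis mV : marked_partition V.
Variable f : n.-tuple T -> R[i].
Hypothesis fK : Kclass K f.

Let marked_bmax_inj2 : {in V.2 &, injective (@bmax n)}.
Proof.
by move=> B C BV CV; apply: (marked_bmax_inj mV); rewrite finset.inE ?BV ?CV orbT.
Qed.

Let g (s u : seq T) : R[i] := f (assembleS V s u) * Qpartition Q V (assembleS V s u).

Lemma cmeasurable_integrand k l :
  cmeasurable setT (fun z : k.-tuple bT * l.-tuple bT => g z.1 z.2).
Proof.
have [mf _ _] := fK.
apply: cmeasurableM; first exact: (cmeasurable_comp mf (measurable_assemble V (k := k) (l := l))).
exact: (cmeasurable_comp (cmeasurable_Qpartition V) (measurable_assemble V (k := k) (l := l))).
Qed.

Lemma normsq_integrand_le C : (forall t, normsq (f t) <= C) ->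
  forall s u, normsq (g s u) <= C.
Proof. by move=> fC s u; rewrite normsqM normsq_Qpartition mulr1. Qed.

(** Each variable of s is the value t_i for all i in some nonempty block, so a variable outside K
    takes some t_i outside K. *)
Lemma integrand_supp1 s u a : (a < #|V.1|)%N -> ~ K (nth point s a) -> g s u = 0.
Proof.
move=> /(block_rank_surj (marked_bmax_inj1 mV))[B BV <-] sa.
have /finset.set0Pn[i iB] := marked1_neq0 mV BV.
have [_ _ f0] := fK.
rewrite /g (f0 _ i) ?mul0r//.
by rewrite (tnth_assemble1 mV _ _ BV iB).
Qed.

Lemma integrand_supp2 s u a : (a < #|V.2|)%N -> ~ K (nth point u a) -> g s u = 0.
Proof.
move=> /(block_rank_surj marked_bmax_inj2)[B BV <-] sa.
have /finset.set0Pn[i iB] := marked2_neq0 mV BV.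
have [_ _ f0] := fK.
rewrite /g (f0 _ i) ?mul0r//.
by rewrite (tnth_assemble2 mV _ _ BV iB).
Qed.

Lemma Kclass_integrand s l : #|V.2| = l -> Kclass K (fun u : l.-tuple T => g s u).
Proof.
move=> Vl; have [mf [C fC] f0] := fK; split.
(* The sequence s, of arbitrary length, is read as a fixed tuple, so that joint measurability yields
   measurability in u. *)
- apply: (cmeasurable_comp (h := fun u : l.-tuple bT => (in_tuple s : _.-tuple bT, u))
    (@cmeasurable_integrand (size s) l)).
  exact: measurable_fun_pair.
- by exists C => u; exact: normsq_integrand_le.
- move=> u i ui; apply: (@integrand_supp2 _ _ i); first by rewrite Vl.
  by rewrite -tnth_nth.
Qed.

(** It depends on f only through C, so it serves a whole sequence of uniformly bounded functions. *)
Definition smear_bound (C : R) : R :=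
  let D := fine (@sigman R T sigma #|V.2| (rect (fun _ : 'I_#|V.2| => K))) in
  normsq (lambda%:C ^+ lambda_exponent V) * (2 * (D + 1) * (C * D)).

Lemma normsq_smearS_le C : (forall t, normsq (f t) <= C) ->
  forall s, normsq (smearS f V s) <= smear_bound C.
Proof.
move=> fC s; rewrite normsqM; apply: ler_wpM2l; first exact: normsq_ge0.
have gK := Kclass_integrand s (erefl #|V.2|); have [mg _ _] := gK.
have gC u : normsq (g s u) <= C by exact: normsq_integrand_le.
exact: (@bounded_normsq_cintegral _ _ _ (@sigman R T sigma #|V.2|) _
  (@measurable_rectK _ _ _ mK _) (sigman_rectK mK Kfin #|V.2|) _ C mg gC (notin_rectK gK)).
Qed.

Lemma Kclass_smearS k : #|V.1| = k -> Kclass K (fun s : k.-tuple T => smearS f V s).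
Proof.
move=> Vk; have [mf [C fC] f0] := fK; split.
- apply: cmeasurableM; first exact: cmeasurable_cst.
  exact: (cmeasurable_cintegral (@sigman R T sigma #|V.2|) (@cmeasurable_integrand k #|V.2|)).
- by exists (smear_bound C) => s; exact: normsq_smearS_le.
- move=> s i si; rewrite /smearS (@eq_cintegral _ _ _ (@sigman R T sigma _) _ (fun=> 0)).
    by rewrite cintegral0 mulr0.
  by move=> u; apply: (@integrand_supp1 _ _ i); rewrite ?Vk// -tnth_nth.
Qed.

End one_partition.

Lemma Kclass_ann_integrable f0 k (g : seq T -> R[i]) : Kfield K f0 ->
  Kclass K (fun s : k.+1.-tuple T => g s) -> ann_integrable sigma Q f0 k g.
Proof.
move=> [mf0 [C0 f0C] f0K] [mg [C gC] gK] a u.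
apply: (@bounded_cintegrable _ _ _ sigma _ mK Kfin _ (C0 ^+ 2 * C)).
- apply: cmeasurableM; first exact: cmeasurable_real.
  apply: cmeasurableM.
    by apply: cmeasurable_prod => b _; apply: (cmeasurable_kernel mQ) => //; exact: measurable_cst.
  (* Insertion at slot a is a permutation of x :: u, which gives the measurability in x. *)
  apply: (@eq_cmeasurable _ _ _ (fun x : bT => g (tuperm (lift_perm a ord0 1) (tcons (x, u))))).
    by move=> x; rewrite tuperm_lift_perm tuperm1.
  apply: (cmeasurable_comp mg); apply: (measurableT_comp (@measurable_tuperm _ bT _ _)).
  apply: (measurableT_comp (@measurable_tcons _ bT _)).
  exact: measurable_fun_pair.
- move=> x; rewrite normsqM ler_pM ?normsq_ge0//.
    rewrite normsq_real -[leLHS]real_normK ?num_real// ler_pXn2r// nnegrE//.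
    exact: le_trans (f0C point).
  rewrite normsqM (normsq_prod (I := 'I_k))// mul1r.
  have sz : size (insertT a x u) == k.+1 by rewrite size_insertT size_tuple.
  exact: (gC (Tuple sz)).
- by move=> x /f0K ->; rewrite mul0r.
Qed.

End smearing.

(** * Exponents of lambda and the recursion for the smeared kernels *)

Section lambda_exponents.
Import mathcomp.boot.finset.
Local Open Scope nat_scope.
Local Open Scope set_scope.
Variables (n : nat) (V : {set {set 'I_n}} * {set {set 'I_n}}).

Lemma sum_ups (P : {set {set 'I_n}}) (h : nat -> nat) :
  \sum_(B in up @: P) h #|B| = \sum_(B in P) h #|B|.
Proof.
rewrite big_imset /=; last by move=> B C _ _; exact: up_inj.
by apply: eq_bigr => B _; rewrite card_up.
Qed.

Lemma sum_up0_ups (P : {set {set 'I_n}}) A (h : nat -> nat) :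
  \sum_(B in up0 A |: (up @: P)) h #|B| = h #|A|.+1 + \sum_(B in P) h #|B|.
Proof. by rewrite big_setU1 ?up0_ups//= card_up0 sum_ups. Qed.

Lemma card_ups (P : {set {set 'I_n}}) : #|up @: P| = #|P|.
Proof. exact/card_imset/up_inj. Qed.

Lemma card_up0_ups (P : {set {set 'I_n}}) A : #|up0 A |: (up @: P)| = #|P|.+1.
Proof. by rewrite cardsU1 up0_ups card_ups. Qed.

Lemma lambda_exponent_new : lambda_exponent (extend (V, None)) = lambda_exponent V.
Proof.
rewrite /lambda_exponent /= (sum_up0_ups V.1 set0 (subn^~ 1)).
by rewrite (sum_ups V.2 (subn^~ 2)) cards0.
Qed.

Hypothesis mV : marked_partition V.
Variable A : {set 'I_n}.
Hypothesis AV : A \in V.1.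

Let A0 : 0 < #|A|. Proof. by rewrite card_gt0 (marked1_neq0 mV AV). Qed.

Lemma lambda_exponent_join :
  lambda_exponent (extend (V, Some (A, false))) = (lambda_exponent V).+1.
Proof.
rewrite /lambda_exponent /= (sum_up0_ups (V.1 :\ A) A (subn^~ 1)).
rewrite (sum_ups V.2 (subn^~ 2)) [in RHS](big_setD1 A AV) /= -!addSn.
by rewrite -subSn// subSS subn0.
Qed.

(** A block of size |A|+1 marked -1 counts |A|+1-2, which is the |A|-1 that A counted as a block
    marked +1. *)
Lemma lambda_exponent_contract :
  lambda_exponent (extend (V, Some (A, true))) = lambda_exponent V.
Proof.
rewrite /lambda_exponent /= (sum_up0_ups V.2 A (subn^~ 2)).
rewrite (sum_ups (V.1 :\ A) (subn^~ 1)) [in RHS](big_setD1 A AV) /=.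
by rewrite addnCA addnA subSS.
Qed.

Lemma card_join1 : #|(up0 A |: (up @: (V.1 :\ A)))| = #|V.1|.
Proof. by rewrite card_up0_ups [RHS](cardsD1 A) AV. Qed.

Lemma card_contract1 : #|(up @: (V.1 :\ A))|.+1 = #|V.1|.
Proof. by rewrite card_ups [RHS](cardsD1 A) AV. Qed.

End lambda_exponents.

Section smear_recursion.
Context {R : realType} {T : completePseudoMetricType R}.
Variable sigma : {sigma_finite_measure set (borel T) -> \bar R}.
Local Notation bT := (borel T).
Variable K : set bT.
Hypotheses (mK : measurable K) (Kfin : (sigma K < +oo)%E).
Variable Q : T -> T -> R[i].
Hypothesis mQ : cmeasurable setT (fun z : bT * bT => Q z.1 z.2).
Hypothesis Qnorm : forall s t, normsq (Q s t) = 1.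
Variable lambda : R.
Variables (n : nat) (V : {set {set 'I_n}} * {set {set 'I_n}}).
Hypothesis mV : marked_partition V.
Variables (f0 : T -> R) (f : n.-tuple T -> R[i]).
Hypotheses (f0K : Kfield K f0) (fK : Kclass K f).
Local Notation smearS := (smearS sigma Q lambda).

Lemma smearS_new s : size s = #|V.1|.+1 ->
  smearS (tensor f0 f) (extend (V, None)) s = create_fun f0 (smearS f V) s.
Proof.
case: s => // x s _; rewrite (@smearSE _ _ _ _ _ _ _ _ _ #|V.2|) ?card_ups//.
rewrite lambda_exponent_new /= mulrCA; congr (_ * _).
rewrite -(@cintegralZ _ _ _ (@sigman R T sigma _)); last first.
  exact: (Kclass_cintegrable mK Kfin (Kclass_integrand mQ Qnorm mV fK s erefl)).
apply: eq_cintegral => u.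
by rewrite assemble_new// Qpartition_new// tensor_tcons /= mulrA.
Qed.

Variable A : {set 'I_n}.
Hypothesis AV : A \in V.1.

Lemma smearS_join s :
  smearS (tensor f0 f) (extend (V, Some (A, false))) s =
  lambda%:C * ((f0 (nth point s (block_rank V.1 A)))%:C * smearS f V s).
Proof.
rewrite (@smearSE _ _ _ _ _ _ _ _ _ #|V.2|) ?card_ups//.
rewrite (lambda_exponent_join mV AV) exprS -mulrA; congr (_ * _).
rewrite [RHS]mulrCA; congr (_ * _).
rewrite -(@cintegralZ _ _ _ (@sigman R T sigma _)); last first.
  exact: (Kclass_cintegrable mK Kfin (Kclass_integrand mQ Qnorm mV fK s erefl)).
apply: eq_cintegral => u.
by rewrite assemble_join// Qpartition_join// tensor_tcons /= mulrA.
Qed.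

Variable k : nat.
Hypothesis Vk : #|V.1| = k.+1.
Let a := block_rank V.1 A.

Let ak : (a < k.+1)%N. Proof. by rewrite -Vk; exact: brank_card. Qed.

Lemma Qleft_blocks x s u : size s = k ->
  \prod_(B in V.1) (if (bmax B < bmax A)%N then
     Q x (nth point (assembleS V (insertT a x s) u) (bmax B)) else 1) =
  Qleft Q k a x s.
Proof.
move=> sk; have inj1 := marked_bmax_inj1 mV.
pose h b := if (b < a)%N then Q x (nth point (insertT a x s) b) else 1.
rewrite (eq_bigr (fun B => h (block_rank V.1 B))); last first.
  by move=> B BV; rewrite /h nth_assemble1//= -(block_rank_ltn AV BV).
rewrite (big_block_rank _ h inj1) /Qleft Vk big_ord_recr /=.
rewrite {2}/h ltnNge -ltnS ak mulr1 -big_mkcond /=; apply: eq_bigr => b ba.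
by rewrite nth_insertT ?ba// sk -ltnS.
Qed.

Lemma smearS_contract s : size s = k ->
  smearS (tensor f0 f) (extend (V, Some (A, true))) s =
  annihilate_fun sigma Q f0 k a (smearS f V) s.
Proof.
move=> sk; set E := extend _; pose l := #|V.2|.
have mE : marked_partition E.
  by apply: extend_marked; rewrite /extension /= mV AV.
have E2 : #|E.2| = l.+1 by exact: card_up0_ups.
rewrite (smearSE _ _ _ _ _ E2) (lambda_exponent_contract AV).
have TK := Kclass_tensor mK Kfin f0K fK.
have iG := Kclass_cintegrable mK Kfin (Kclass_integrand mQ Qnorm mE TK s E2).
pose r : nat := brank V.2 (bmax A).
have rl : (r < l.+1)%N.
  rewrite ltnS; apply: subset_leq_card; apply/fintype.subsetP => C.
  by rewrite finset.inE => /andP[].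
(* The variable of the contracted block stands at slot r of u. Permutation invariance of the measure
   brings it to the front, where Fubini isolates it as the variable x of [annihilate_fun]. *)
pose p : 'S_l.+1 := lift_perm (Ordinal rl) ord0 1.
rewrite -(@cintegralZ _ _ _ (@sigman R T sigma _))//.
have iZ := cintegrableZ (lambda%:C ^+ lambda_exponent V) iG.
rewrite -(cintegral_tuperm p iZ) (cintegral_sigmanS (cintegrable_tuperm p iZ)).
apply: eq_cintegral => x; rewrite mulrA mulrCA.
have iV := Kclass_cintegrable mK Kfin
  (Kclass_integrand mQ Qnorm mV fK (insertT a x s) (erefl l)).
rewrite -(@cintegralZ _ _ _ (@sigman R T sigma _))//.
rewrite -(@cintegralZ _ _ _ (@sigman R T sigma _)); last exact: cintegrableZ.
apply: eq_cintegral => u.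
rewrite tuperm_lift_perm tuperm1 assemble_contract//; last 2 first.
- by rewrite sk -ltnS.
- by rewrite size_tuple.
rewrite Qpartition_contract// Qleft_blocks// tensor_tcons.
by rewrite -/a [Qpartition _ _ _ * Qleft _ _ _ _ _]mulrC mulrACA.
Qed.

End smear_recursion.

(** * The expansion for product kernels *)

Section operator_sums.
Context {R : realType} {T : completePseudoMetricType R}.
Variable sigma : {sigma_finite_measure set (borel T) -> \bar R}.
Local Notation bT := (borel T).
Local Notation fvec := (fvec R T).
Variable Q : T -> T -> R[i].
Hypothesis Qnorm : forall s t, normsq (Q s t) = 1.
Hypothesis Qconj : forall s t, Q s t = (Q t s)^*.

Lemma is_fin_sum (I : Type) (r : seq I) (P : pred I) (F : I -> fvec) :
  (forall i, P i -> is_fin sigma Q (F i)) -> is_fin sigma Q (\sum_(i <- r | P i) F i).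
Proof.
move=> fF; elim/big_ind : _ => //; first exact: is_fin0.
by move=> F1 F2; exact: is_finD.
Qed.

Lemma feq_sum (I : Type) (r : seq I) (P : pred I) (F G : I -> fvec) :
  (forall i, P i -> feq sigma (F i) (G i)) ->
  feq sigma (\sum_(i <- r | P i) F i) (\sum_(i <- r | P i) G i).
Proof.
move=> FG; elim/big_ind2 : _ => //; first exact: feq_refl.
by move=> F1 F2 G1 G2; exact: feqD.
Qed.

Variable p : fvec -> fvec.
Hypothesis op : is_operator sigma Q p.

Lemma operator0 : feq sigma (p 0) 0.
Proof.
have [_ _ lin] := op; have f0 := is_fin0 sigma Qnorm Qconj.
move=> n; have := lin 1 _ _ f0 f0 n; rewrite scaler0 addr0 => /=.
rewrite scale1r; apply: ae_mono => t H.
have : p 0 t + p 0 t = p 0 t + 0 by rewrite addr0 [RHS]H.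
exact: addrI.
Qed.

Lemma operator_sum (I : Type) (r : seq I) (P : pred I) (F : I -> fvec) :
  (forall i, P i -> is_fin sigma Q (F i)) ->
  feq sigma (p (\sum_(i <- r | P i) F i)) (\sum_(i <- r | P i) p (F i)).
Proof.
have [_ _ lin] := op => fF; elim: r => [|i r IH].
  by rewrite !big_nil; exact: operator0.
rewrite !big_cons; case: ifP => // Pi; set S := \big[+%R/0]_(i <- r | _) F i.
have E : F i + S = 1 *: F i + S by rewrite scale1r.
rewrite E.
have L := lin 1 _ _ (fF i Pi) (is_fin_sum r fF).
apply: feq_trans L _.
by rewrite scale1r; apply: feqD IH; exact: feq_refl.
Qed.

End operator_sums.

Section product_formula.
Context {R : realType} {T : completePseudoMetricType R}.
Variable sigma : {sigma_finite_measure set (borel T) -> \bar R}.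
Local Notation bT := (borel T).
Local Notation fvec := (fvec R T).
Variable K : set bT.
Hypotheses (mK : measurable K) (Kfin : (sigma K < +oo)%E).
Variable Q : T -> T -> R[i].
Hypothesis mQ : cmeasurable setT (fun z : bT * bT => Q z.1 z.2).
Hypothesis Qnorm : forall s t, normsq (Q s t) = 1.
Hypothesis Qconj : forall s t, Q s t = (Q t s)^*.
Variable lambda : R.
Local Notation smearS := (smearS sigma Q lambda).
Local Notation chaos := (chaos Q).

Lemma Kclass_is_fin_chaos k (g : seq T -> R[i]) :
  Kclass K (fun s : k.-tuple T => g s) -> is_fin sigma Q (chaos k g).
Proof.
by move=> gK; apply: (is_fin_chaos mQ Qnorm Qconj); exact: (Kclass_L2 mK Kfin gK).
Qed.

Lemma fieldop_chaos f0 k (g : seq T -> R[i]) : Kfield K f0 ->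
  Kclass K (fun s : k.-tuple T => g s) ->
  feq sigma (fieldop sigma Q lambda f0 (chaos k g))
    (chaos k.+1 (create_fun f0 g) + lambda%:C *: chaos k (number_fun f0 k g) +
     if k is k'.+1 then chaos k' (fun s => \sum_(a < k) annihilate_fun sigma Q f0 k' a g s) else 0).
Proof.
move=> f0K gK; have fadm := Kfield_admissible mK Kfin f0K.
have fg := Kclass_is_fin_chaos gK.
rewrite /fieldop (a_plus_chaos Qnorm Qconj) a_zero_chaos.
apply: feqD; first exact: feq_refl.
apply: feq_trans (a_minus_spec mQ Qnorm Qconj fadm fg).2 _.
case: k gK {fg} => [|k] gK; first by rewrite annih_chaos0; exact: feq_refl.
rewrite (annih_chaosS Qnorm Qconj); first exact: feq_refl.
exact: Kclass_ann_integrable gK.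
Qed.

(** The vector to which the right-hand side of the theorem will correspond under I. *)
Definition wick_sum n (f : n.-tuple T -> R[i]) : fvec :=
  \sum_(V : {set {set 'I_n}} * {set {set 'I_n}} | marked_partition V)
    chaos #|V.1| (smearS f V).

Lemma is_fin_wick_sum n (f : n.-tuple T -> R[i]) : Kclass K f ->
  is_fin sigma Q (wick_sum f).
Proof.
move=> fK; apply: (is_fin_sum Qnorm Qconj) => V mV; apply: Kclass_is_fin_chaos.
exact: (Kclass_smearS mK Kfin mQ Qnorm lambda mV fK).
Qed.

Lemma sum_num n (V : {set {set 'I_n}} * {set {set 'I_n}}) f0 g :
  marked_partition V ->
  lambda%:C *: chaos #|V.1| (number_fun f0 #|V.1| g) =
  \sum_(A in V.1) chaos #|V.1| (fun s =>
    lambda%:C * ((f0 (nth point s (block_rank V.1 A)))%:C * g s)).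
Proof.
move=> mV; rewrite -chaos_sum -chaosZ; apply: eq_chaos => s _.
rewrite /number_fun -mulr_sumr; congr (_ * _); rewrite -mulr_suml; congr (_ * _).
rewrite -rmorph_sum /=; congr _%:C; apply/esym.
exact: (big_block_rank _ (fun b => f0 (nth point s b)) (marked_bmax_inj1 mV)).
Qed.

Lemma wick_sum_tensor n f0 (f : n.-tuple T -> R[i]) : Kfield K f0 -> Kclass K f ->
  feq sigma (fieldop sigma Q lambda f0 (wick_sum f)) (wick_sum (tensor f0 f)).
Proof.
move=> f0K fK; have fadm := Kfield_admissible mK Kfin f0K.
have SK V : marked_partition V -> Kclass K (fun s : #|V.1|.-tuple T => smearS f V s).
  by move=> mV; exact: (Kclass_smearS mK Kfin mQ Qnorm lambda mV fK).
apply: feq_trans (operator_sum Qnorm Qconj (fieldop_operator mQ Qnorm Qconj fadm lambda) _ _) _.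
  by move=> V mV; apply: Kclass_is_fin_chaos; exact: SK.
rewrite [X in feq _ _ X]sum_extend; apply: feq_sum => V mV.
apply: feq_trans (fieldop_chaos f0K (SK V mV)) _.
suff -> : chaos #|V.1|.+1 (create_fun f0 (smearS f V)) +
    lambda%:C *: chaos #|V.1| (number_fun f0 #|V.1| (smearS f V)) +
    (if #|V.1| is k'.+1 then
       chaos k' (fun s => \sum_(a < #|V.1|) annihilate_fun sigma Q f0 k' a (smearS f V) s) else 0) =
  chaos #|(extend (V, None)).1| (smearS (tensor f0 f) (extend (V, None))) +
  \sum_(A in V.1)
    (chaos #|(extend (V, Some (A, false))).1|
       (smearS (tensor f0 f) (extend (V, Some (A, false)))) +
     chaos #|(extend (V, Some (A, true))).1|
       (smearS (tensor f0 f) (extend (V, Some (A, true))))) by exact: feq_refl.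
rewrite big_split /= addrA; congr (_ + _ + _).
- rewrite card_up0_ups; apply: eq_chaos => s sV.
  by rewrite (smearS_new mK Kfin mQ Qnorm lambda mV f0 fK).
- rewrite (sum_num f0 _ mV); apply: eq_bigr => A AV; rewrite card_join1//.
  by apply: eq_chaos => s _; rewrite (smearS_join mK Kfin mQ Qnorm lambda mV f0 fK AV).
(* With no block marked +1 there is nothing to annihilate and no block to contract. *)
- case Vk : #|V.1| => [|k].
    rewrite big_pred0// => A; apply/negP => AV.
    by move: Vk => /eqP; rewrite finset.cards_eq0 => /eqP V0; rewrite V0 finset.inE in AV.
  rewrite [RHS](eq_bigr (fun A => chaos k (fun s =>
      annihilate_fun sigma Q f0 k (block_rank V.1 A) (smearS f V) s))); last first.
    move=> A AV; have := card_contract1 AV; rewrite Vk => -[->].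
    apply: eq_chaos => s sk.
    exact: (smearS_contract mK Kfin mQ Qnorm lambda mV f0K fK AV Vk).
  rewrite -chaos_sum; apply: eq_chaos => s _; apply/esym.
  rewrite -Vk.
  exact: (big_block_rank _ (fun a => annihilate_fun sigma Q f0 k a (smearS f V) s)
    (marked_bmax_inj1 mV)).
Qed.

Lemma vacuum_chaos : vacuum = chaos 0 (fun=> 1).
Proof.
apply: fvec_ext => n t; rewrite /vacuum /chaos; case: eqP t => [->|//] t /=.
rewrite /Psym (eq_bigr (fun=> 1)); last first.
  by move=> p _; rewrite /Psi big_ord0 mul1r.
by rewrite sumr_const card_Sn fact0 invr1 mul1r.
Qed.

Lemma marked_partition0 (V : {set {set 'I_0}} * {set {set 'I_0}}) :
  marked_partition V = (V == (finset.set0, finset.set0)).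
Proof.
have no (B : {set 'I_0}) : B = finset.set0 by apply/finset.setP => -[].
apply/idP/eqP => [mV|->].
  have [V10 V20] := marked_set0 mV.
  rewrite [V]surjective_pairing; congr (_, _); apply/finset.setP => B;
    by rewrite (no B) finset.inE; apply/negbTE.
apply/marked_partitionP; split => [|[]//|B C []//|B|B]; rewrite ?finset.inE//.
Qed.

Lemma wick_sum0 : wick_sum (fun _ : 0.-tuple T => 1) = vacuum.
Proof.
rewrite /wick_sum (eq_bigl _ _ marked_partition0) big_pred1_eq vacuum_chaos /=.
rewrite finset.cards0; apply: eq_chaos => s _.
rewrite (@smearSE _ _ _ _ _ _ _ _ _ 0) /= ?finset.cards0//.
rewrite /lambda_exponent !big1 ?expr0 ?mul1r; last 2 first.
- by move=> B; rewrite finset.inE.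
- by move=> B; rewrite finset.inE.
rewrite (@eq_cintegral _ _ _ (@sigman R T sigma 0) _ (fun=> 1)); last first.
  by move=> u; rewrite /Qpartition !big1 ?mulr1// => B; rewrite finset.inE.
(* The power 0 of the measure is a unit mass at the empty tuple, so an integral over no variable is
   an evaluation. *)
have d1 : @sigman R T sigma 0 setT = 1%E by exact: diracT.
rewrite /cintegral (@integral_cst _ _ _ (@sigman R T sigma 0))//.
by rewrite [X in (_ * X)%E]d1 mule1 integral0.
Qed.

Lemma Kclass_prod n (f : 'I_n -> T -> R) : (forall i, Kfield K (f i)) ->
  Kclass K (fun t : n.-tuple T => \prod_(i < n) (f i (tnth t i))%:C).
Proof.
elim: n f => [|n IH] f fK.
  split.
  - apply: (@eq_cmeasurable _ _ _ (fun=> 1)); last exact: cmeasurable_cst.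
    by move=> t; rewrite big_ord0.
  - by exists 1 => t; rewrite big_ord0 normsq1.
  - by move=> t [].
rewrite (_ : (fun _ => _) = tensor (f ord0)
    (fun t : n.-tuple T => \prod_(i < n) (f (lift ord0 i) (tnth t i))%:C)).
  exact: (Kclass_tensor mK Kfin (fK ord0) (IH (fun i => f (lift ord0 i)) (fun i => fK _))).
apply/funext => t; have [x [u ->]] := tconsP t.
rewrite tensor_tcons big_ord_recl; congr (_ * _).
by apply: eq_bigr => i _; rewrite tnthS.
Qed.

Lemma product_formula n (f : 'I_n -> T -> R) : (forall i, Kfield K (f i)) ->
  feq sigma (field_monomial sigma Q lambda [seq f i | i <- enum 'I_n] vacuum)
    (wick_sum (fun t => \prod_(i < n) (f i (tnth t i))%:C)).
Proof.
elim: n f => [|n IH] f fK.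
  have -> : (fun t : 0.-tuple T => \prod_(i < 0) (f i (tnth t i))%:C) = fun=> 1.
    by apply/funext => t; rewrite big_ord0.
  rewrite wick_sum0 (_ : enum 'I_0 = [::]); first exact: feq_refl.
  by apply: size0nil; rewrite size_enum_ord.
rewrite enum_ordSl /= -map_comp.
have -> : (fun t : n.+1.-tuple T => \prod_(i < n.+1) (f i (tnth t i))%:C) =
  tensor (f ord0) (fun t : n.-tuple T => \prod_(i < n) (f (lift ord0 i) (tnth t i))%:C).
  apply/funext => t; have [x [u ->]] := tconsP t.
  rewrite tensor_tcons big_ord_recl; congr (_ * _).
  by apply: eq_bigr => i _; rewrite tnthS.
have fK' i : Kfield K (f (lift ord0 i)) by [].
apply: feq_trans (wick_sum_tensor (fK ord0) (Kclass_prod fK')).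
have [_ ext _] := fieldop_operator mQ Qnorm Qconj (Kfield_admissible mK Kfin (fK ord0)) lambda.
have fadm s : (forall g, List.In g s -> Kfield K g) ->
    is_fin sigma Q (field_monomial sigma Q lambda s vacuum).
  elim: s => [_|g s IHs sK] /=.
    rewrite vacuum_chaos; apply: Kclass_is_fin_chaos; split.
    - exact: cmeasurable_cst.
    - by exists 1 => t; rewrite normsq1.
    - by move=> t [].
  apply: (is_fin_fieldop mQ Qnorm Qconj (Kfield_admissible mK Kfin (sK g _))); first by left.
  by apply: IHs => h hs; apply: sK; right.
apply: ext.
- apply: fadm; elim: (enum _) => //= i s IHs g [<-//|]; exact: IHs.
- exact: is_fin_wick_sum (Kclass_prod fK').
- exact: IH.
Qed.

End product_formula.

(** * From products to bounded functions *)
Section monotone_class.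
Import HBNNSimple.
Context {R : realType} {T : completePseudoMetricType R}.
Local Notation bT := (borel T).
Variable K : set bT.
Hypothesis mK : measurable K.
Variable n : nat.
Implicit Types (f g : n.-tuple T -> R[i]) (A : set (n.-tuple bT)).
Variable P : (n.-tuple T -> R[i]) -> Prop.
Hypothesis Pprod : forall f : 'I_n -> T -> R, (forall i, Kfield K (f i)) ->
  P (fun t => \prod_(i < n) (f i (tnth t i))%:C).
Hypothesis Plin : forall (c : R[i]) f g, Kclass K f -> Kclass K g -> P f -> P g ->
  P (fun t => c * f t + g t).
Hypothesis Plim : forall (fj : nat -> n.-tuple T -> R[i]) f (C : R),
  (forall j, Kclass K (fj j)) -> Kclass K f ->
  (forall j t, normsq (fj j t) <= C) -> (forall t, ccvg (fj ^~ t) (f t)) ->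
  (forall j, P (fj j)) -> P f.

(** Cut down to the cube over K, an indicator is in the class for every measurable A, which the
    Dynkin argument needs for complements. *)
Let ind A : n.-tuple T -> R[i] := fun t => (\1_(A `&` rect (fun=> K)) (t : n.-tuple bT))%:C.

Let ind_in A t : A t -> rect (fun=> K) t -> ind A t = 1.
Proof. by move=> At Kt; rewrite /ind indicE mem_set. Qed.

Let ind_out A t : ~ A t -> ind A t = 0.
Proof. by move=> At; rewrite /ind indicE memNset// => -[]. Qed.

Let ind_outK A t : ~ rect (fun=> K) t -> ind A t = 0.
Proof. by move=> At; rewrite /ind indicE memNset// => -[]. Qed.

Let normsq_ind A t : normsq (ind A t) <= 1.
Proof.
by rewrite normsq_real indicE; case: (_ \in _); rewrite ?expr1n ?expr0n.
Qed.

Let Kind A : measurable A -> Kclass K (ind A).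
Proof.
move=> mA; split.
- apply: cmeasurable_real; apply: measurable_indic; apply: measurableI => //.
  exact: measurable_rectK.
- by exists 1 => t.
- by move=> t i ti; apply: ind_outK => /(_ i).
Qed.

Let P0 : P (fun=> 0).
Proof.
have K0 : Kclass K (ind setT) by exact: Kind.
have P1 : P (ind setT).
  have -> : ind setT = fun t => \prod_(i < n) (\1_K (tnth t i : bT))%:C.
    apply/funext => t; have [Kt|Kt] := pselect (rect (fun=> K) t).
      rewrite ind_in// big1// => i _; rewrite indicE mem_set//; exact: Kt.
    rewrite ind_outK//; have /existsNP[i ti] := Kt.
    by rewrite (bigD1 i)//= indicE memNset// mul0r.
  apply: (@Pprod (fun _ => \1_K)) => i; split.
  - exact: measurable_indic.
  - exists 1 => x; rewrite indicE; case: (_ \in _); rewrite ?normr1 ?normr0//.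
  - by move=> x Kx; rewrite indicE memNset.
(* For n = 0 the only product is 1, so zero is obtained as a difference. *)
rewrite (_ : (fun _ => _) = fun t => -1 * ind setT t + ind setT t); first exact: Plin.
by apply/funext => t; rewrite mulN1r addNr.
Qed.

Let Pind_rect (B : 'I_n -> set bT) : (forall i, measurable (B i)) -> P (ind (rect B)).
Proof.
move=> mB.
have -> : ind (rect B) = fun t => \prod_(i < n) (\1_(B i `&` K) (tnth t i : bT))%:C.
  apply/funext => t; have [BKt|BKt] := pselect ((rect B `&` rect (fun=> K)) t).
    case: BKt => Bt Kt; rewrite ind_in// big1// => i _.
    have /mem_set : (B i `&` K) (tnth t i) by split; [exact: Bt|exact: Kt].
    by rewrite indicE => ->.
  have [i it] : exists i, ~ (B i `&` K) (tnth t i).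
    apply/existsNP => H; by apply: BKt; split => i; have [] := H i.
  rewrite (bigD1 i)//= indicE memNset// mul0r /ind indicE memNset//.
apply: (@Pprod (fun i => \1_(B i `&` K))) => i; split.
- by apply: measurable_indic; exact: measurableI.
- exists 1 => x; rewrite indicE; case: (_ \in _); rewrite ?normr1 ?normr0//.
- by move=> x Kx; rewrite indicE memNset// => -[].
Qed.

Lemma indicator_class A : measurable A -> P (ind A).
Proof.
rewrite measurable_rectangle_gen; move: A.
apply: (@dynkin_induction _ (n.-tuple bT) (@rectangle _ bT n) (fun A => P (ind A))).
- exact: measurable_rectangle_gen.
- exact: rectangle_setI_closed.
- have -> : [set: n.-tuple bT] = rect (fun _ : 'I_n => setT :> set bT).
    by apply/seteqP; split.
  exact: Pind_rect.
- by move=> _ [B mB ->]; exact: Pind_rect.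
- move=> A mA PA.
  have -> : ind (~` A) = fun t => -1 * ind A t + ind (rect (fun _ : 'I_n => setT :> set bT)) t.
    apply/funext => t; have [Kt|Kt] := pselect (rect (fun=> K) t); last first.
      by rewrite !ind_outK// mulr0 addr0.
    rewrite (@ind_in (rect _))//; have [At|At] := pselect (A t).
      by rewrite ind_out ?ind_in// mulr1 addNr.
    by rewrite (ind_out At) ind_in// mulr0 add0r.
  apply: Plin => //; [exact: Kind| |exact: Pind_rect].
  by apply: Kind; exact: measurable_rect.
(* The indicator of a finite disjoint union is a sum; the partial unions then converge pointwise and
   boundedly to the countable one. *)
- move=> F mF tF PF; pose G j := \big[setU/set0]_(i < j) F i.
  have mG j : measurable (G j) by exact: bigsetU_measurable.
  have PG j : P (ind (G j)).
    elim: j => [|j IH].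
      rewrite /G big_ord0 (_ : ind set0 = fun=> 0) //.
      by apply/funext => t; rewrite ind_out.
    have -> : ind (G j.+1) = fun t => 1 * ind (F j) t + ind (G j) t.
      apply/funext => t; have [Kt|Kt] := pselect (rect (fun=> K) t); last first.
        by rewrite !ind_outK// mulr0 addr0.
      have GE : G j.+1 t <-> G j t \/ F j t by rewrite /G big_ord_recr.
      have [Ft|Ft] := pselect (F j t).
        rewrite (ind_in _ Kt); last by apply/GE; right.
        rewrite (ind_in Ft Kt) ind_out ?mulr1 ?addr0//.
        rewrite /G -bigcup_mkord => -[k /= kj Fkt].
        have := tF k j I I; rewrite /= => /(_ (ex_intro _ t (conj Fkt Ft))) kE.
        by rewrite kE ltnn in kj.
      rewrite (ind_out Ft) mulr0 add0r; have [Gt|Gt] := pselect (G j t).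
        by rewrite !ind_in//; apply/GE; left.
      by rewrite !ind_out// => /GE[].
    by apply: Plin => //; exact: Kind.
  apply: (@Plim (fun j => ind (G j)) _ 1) => //.
  + by move=> j; exact: Kind.
  + by apply: Kind; exact: bigcupT_measurable.
  + move=> t; rewrite /ccvg.
    have near_eq : \forall j \near \oo, ind (G j) t = ind (\bigcup_k F k) t.
      have [[k _ Fkt]|nF] := pselect ((\bigcup_k F k) t).
        exists k.+1 => // j /= kj.
        have [Kt|Kt] := pselect (rect (fun=> K) t); last by rewrite !ind_outK.
        rewrite !ind_in//; first by exists k.
        by rewrite /G -bigcup_mkord; exists k.
      apply: nearW => j; rewrite !ind_out//.
      by rewrite /G -bigcup_mkord => -[k /= _ Fkt]; apply: nF; exists k.
    by split; apply: cvg_near_cst; apply: filterS near_eq => j ->.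
Qed.

Let Psum (I : eqType) (r : seq I) (c : I -> R) (A : I -> set (n.-tuple bT)) :
  (forall i, measurable (A i)) ->
  P (fun t => \sum_(i <- r) (c i)%:C * ind (A i) t) /\
  Kclass K (fun t => \sum_(i <- r) (c i)%:C * ind (A i) t).
Proof.
move=> mA; elim: r => [|i r [IH1 IH2]].
  rewrite (_ : (fun _ => _) = fun=> 0); last by apply/funext => t; rewrite big_nil.
  split => //; split; [exact: cmeasurable_cst| |by []].
  by exists 0 => t; rewrite normsq0.
rewrite (_ : (fun _ => _) = fun t => (c i)%:C * ind (A i) t + \sum_(i <- r) (c i)%:C * ind (A i) t).
  split; last by apply: Kclass_lin => //; exact: Kind.
  by apply: Plin => //; [exact: Kind|exact: indicator_class].
by apply/funext => t; rewrite big_cons.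
Qed.

(** The simple approximations of g lie between 0 and g, so they share its bound and vanish where it
    does, and bounded limits apply. *)
Lemma nonneg_class (g : n.-tuple T -> R) (C : R) :
  measurable_fun (setT : set (n.-tuple bT)) g -> (forall t, 0 <= g t <= C) ->
  (forall t i, ~ K (tnth t i) -> g t = 0) ->
  P (fun t => (g t)%:C).
Proof.
move=> mg gC g0.
have Kreal (h : n.-tuple T -> R) : measurable_fun (setT : set (n.-tuple bT)) h ->
    (forall t, 0 <= h t <= g t) -> Kclass K (fun t => (h t)%:C).
  move=> mh hg; split.
  - exact: cmeasurable_real.
  - exists (C ^+ 2) => t; rewrite normsq_real; have /andP[h0 hgt] := hg t.
    have /andP[gt0 gtC] := gC t.
    rewrite ler_pXn2r ?nnegrE ?(le_trans gt0 gtC)//; exact: le_trans gtC.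
  - move=> t i ti; have := hg t; rewrite (g0 t i ti) => ht.
    by congr (_%:C); apply/eqP; rewrite eq_le andbC.
have mgE : measurable_fun (setT : set (n.-tuple bT)) (EFin \o g) by exact/measurable_EFinP.
have g0E (t : n.-tuple bT) : setT t -> (0 <= (EFin \o g) t)%E.
  by move=> _; rewrite lee_fin; have /andP[] := gC t.
pose h j := nnsfun_approx measurableT mgE j.
have hg j t : 0 <= h j t <= g t.
  apply/andP; split; first exact: fun_ge0.
  rewrite /h nnsfun_approxE -lee_fin.
  exact: (le_approx j g0E).
apply: (@Plim (fun j t => (h j t)%:C) _ (C ^+ 2)).
- by move=> j; apply: Kreal; [exact: measurable_funPT|exact: hg].
- by apply: Kreal => // t; have /andP[-> _] := gC t; rewrite lexx.
- move=> j t; rewrite normsq_real; have /andP[h0 hgt] := hg j t.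
  have /andP[gt0 gtC] := gC t.
  rewrite ler_pXn2r ?nnegrE ?(le_trans gt0 gtC)//; exact: le_trans gtC.
- move=> t; split => /=; last exact: cvg_cst.
  exact: (fine_cvg (cvg_nnsfun_approx measurableT mgE g0E (x := t) I)).
- move=> j.
  rewrite (_ : (fun _ => _) = fun t => \sum_(y <- finmap.enum_fset (fset_set (range (h j))))
      y%:C * ind (h j @^-1` [set y]) t).
    by apply: (Psum _ (fun y => y) _).1 => y; exact: measurable_funPTI.
  apply/funext => t; have [Kt|Kt] := pselect (rect (fun=> K) t); last first.
    have /existsNP[i ti] := Kt.
    rewrite big1; last by move=> y _; rewrite ind_outK// mulr0.
    have := hg j t; rewrite (g0 t i ti) => ht.
    by congr (_%:C); apply/eqP; rewrite eq_le andbC.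
  rewrite (fimfunE (h j)) fsbig_finite//= rmorph_sum /=; apply: eq_bigr => y _.
  rewrite rmorphM /=; congr (_ * _); have [hy|hy] := pselect ((h j @^-1` [set y]) t).
    by rewrite ind_in// indicE mem_set.
  by rewrite ind_out// indicE memNset.
Qed.

(** P is left abstract because the argument serves twice: for approximability by polynomials, and
    for the agreement of [W] on the vacuum with the expansion. *)
Lemma Kclass_monotone_class f : Kclass K f -> P f.
Proof.
move=> [[mRe mIm] [C fC] fK].
have part (g : n.-tuple T -> R) : measurable_fun (setT : set (n.-tuple bT)) g ->
    (forall t, g t ^+ 2 <= C) -> (forall t i, ~ K (tnth t i) -> g t = 0) ->
    P (fun t => (g t)%:C) /\ Kclass K (fun t => (g t)%:C).
  move=> mg gC gK.
  (* C bounds the square of g, and 2 |g| <= g^2 + 1 <= C + 1. *)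
  have C1 t : 0 <= Num.max (g t) 0 <= C + 1 /\ 0 <= Num.max (- g t) 0 <= C + 1.
    have := gC t; have := sqr_ge0 (g t - 1); have := sqr_ge0 (g t + 1) => h1 h2 h3.
    rewrite !le_max lexx !orbT /= !ge_max; split; nra.
  have Kg (h : n.-tuple T -> R) : measurable_fun (setT : set (n.-tuple bT)) h ->
      (forall t, 0 <= h t <= C + 1) -> (forall t i, ~ K (tnth t i) -> h t = 0) ->
      Kclass K (fun t => (h t)%:C).
    move=> mh hC h0; split.
    - exact: cmeasurable_real.
    - exists ((C + 1) ^+ 2) => t; rewrite normsq_real; have /andP[ht0 htC] := hC t.
      by rewrite ler_pXn2r// nnegrE (le_trans ht0).
    - by move=> t i ti; rewrite (h0 t i ti).
  have mp : measurable_fun (setT : set (n.-tuple bT)) (fun t => Num.max (g t) 0).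
    by apply: measurable_maxr => //; exact: measurable_cst.
  have mm : measurable_fun (setT : set (n.-tuple bT)) (fun t => Num.max (- g t) 0).
    by apply: measurable_maxr; [exact: measurableT_comp|exact: measurable_cst].
  have p0 t i : ~ K (tnth t i) -> Num.max (g t) 0 = 0.
    by move=> ti; rewrite (gK t i ti) maxxx.
  have m0 t i : ~ K (tnth t i) -> Num.max (- g t) 0 = 0.
    by move=> ti; rewrite (gK t i ti) oppr0 maxxx.
  have Kp := Kg _ mp (fun t => (C1 t).1) p0; have Km := Kg _ mm (fun t => (C1 t).2) m0.
  have Pp := nonneg_class mp (fun t => (C1 t).1) p0.
  have Pm := nonneg_class mm (fun t => (C1 t).2) m0.
  rewrite (_ : (fun t => _) = fun t => -1 * (Num.max (- g t) 0)%:C + (Num.max (g t) 0)%:C).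
    by split; [exact: Plin|exact: Kclass_lin].
  apply/funext => t; rewrite mulN1r -rmorphN -rmorphD /=; congr (_%:C).
  have [h|h] := leP 0 (g t).
    by rewrite max_r ?oppr_le0// oppr0 add0r.
  by rewrite max_l ?oppr_ge0 1?ltW// opprK addr0.
have RK t i : ~ K (tnth t i) -> complex.Re (f t) = 0 by move=> ti; rewrite (fK t i ti).
have IK t i : ~ K (tnth t i) -> complex.Im (f t) = 0 by move=> ti; rewrite (fK t i ti).
have [P1 K1] := part _ mRe (fun t => le_trans (Re2_le_normsq _) (fC t)) RK.
have [P2 K2] := part _ mIm (fun t => le_trans (Im2_le_normsq _) (fC t)) IK.
rewrite (_ : f = fun t => 'i%C * (complex.Im (f t))%:C + (complex.Re (f t))%:C).
  exact: Plin.
by apply/funext => t; rewrite [LHS]complexE addrC.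
Qed.

End monotone_class.

(** * Continuity of the expansion in the kernel *)

Section wick_sum_continuity.
Context {R : realType} {T : completePseudoMetricType R}.
Variable sigma : {sigma_finite_measure set (borel T) -> \bar R}.
Local Notation bT := (borel T).
Local Notation fvec := (fvec R T).
Variable K : set bT.
Hypotheses (mK : measurable K) (Kfin : (sigma K < +oo)%E).
Variable Q : T -> T -> R[i].
Hypothesis mQ : cmeasurable setT (fun z : bT * bT => Q z.1 z.2).
Hypothesis Qnorm : forall s t, normsq (Q s t) = 1.
Hypothesis Qconj : forall s t, Q s t = (Q t s)^*.
Variable lambda : R.
Local Notation smearS := (smearS sigma Q lambda).
Local Notation chaos := (chaos Q).
Local Notation wick_sum := (wick_sum sigma Q lambda).

Lemma smearS_lin n (c : R[i]) (f g : n.-tuple T -> R[i])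
    (V : {set {set 'I_n}} * {set {set 'I_n}}) s : marked_partition V ->
  Kclass K f -> Kclass K g ->
  smearS (fun t => c * f t + g t) V s = c * smearS f V s + smearS g V s.
Proof.
move=> mV fK gK; rewrite /smearS mulrCA -mulrDr; congr (_ * _).
have if_ := Kclass_cintegrable mK Kfin (Kclass_integrand mQ Qnorm mV fK s (erefl #|V.2|)).
have ig := Kclass_cintegrable mK Kfin (Kclass_integrand mQ Qnorm mV gK s (erefl #|V.2|)).
rewrite -(cintegralZ _ if_) -(cintegralD (cintegrableZ _ if_) ig).
by apply: eq_cintegral => u; rewrite mulrDl mulrA.
Qed.

Lemma wick_sum_lin n (c : R[i]) (f g : n.-tuple T -> R[i]) :
  Kclass K f -> Kclass K g ->
  wick_sum (fun t => c * f t + g t) = c *: wick_sum f + wick_sum g.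
Proof.
move=> fK gK; rewrite /wick_sum scaler_sumr -big_split; apply: eq_bigr => V mV /=.
rewrite -chaos_lin; apply: eq_chaos => s _; exact: smearS_lin.
Qed.

(** Measurability is part of the notion because the norm estimates for sums and multiples require
    it. *)
Definition vanish m (F : nat -> m.-tuple T -> R[i]) : Prop :=
  (forall j, @cmeasurable R _ (m.-tuple bT) setT (F j)) /\
  sqnorm (@sigman R T sigma m) (F j : m.-tuple bT -> R[i]) @[j --> \oo] --> 0%E.

Lemma eq_vanish m (F G : nat -> m.-tuple T -> R[i]) :
  (forall j t, F j t = G j t) -> vanish F -> vanish G.
Proof. by move=> FG; suff -> : F = G by []; apply/funext => j; apply/funext. Qed.

Lemma vanish_lin m (c : R[i]) (F G : nat -> m.-tuple T -> R[i]) :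
  vanish F -> vanish G -> vanish (fun j t => c * F j t + G j t).
Proof.
move=> [mF F0] [mG G0].
have mcF j : @cmeasurable R _ (m.-tuple bT) setT (fun t => c * F j t).
  by apply: cmeasurableM => //; exact: cmeasurable_cst.
split; first by move=> j; exact: cmeasurableD.
apply: (@squeeze_cvge _ _ _ _ (cst 0%E) _ (fun j => 2%:E *
  ((normsq c)%:E * sqnorm (@sigman R T sigma m) (F j : m.-tuple bT -> R[i]) +
   sqnorm (@sigman R T sigma m) (G j : m.-tuple bT -> R[i])))%E).
- apply: nearW => j; rewrite sqnorm_ge0 /=.
  by rewrite -(sqnormZ _ c (mF j)); exact: sqnormD_le.
- exact: cvg_cst.
- rewrite -[X in _ --> X](mule0 2%:E); apply: cvgeZl => //.
  rewrite -[X in _ --> X]adde0; apply: cvgeD => //.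
  by rewrite -[X in _ --> X](mule0 (normsq c)%:E); apply: cvgeZl.
Qed.

Lemma vanish0 m : vanish (fun (_ : nat) (_ : m.-tuple T) => 0).
Proof.
split; first by move=> _; exact: cmeasurable_cst.
rewrite (_ : (fun j : nat => _) = cst 0%E); first exact: cvg_cst.
apply/funext => j; apply/(sqnorm_eq0 (@sigman R T sigma m)); first exact: cmeasurable_cst.
exact: aeW.
Qed.

Lemma vanish_sum m (I : Type) (r : seq I) (P : pred I) (F : I -> nat -> m.-tuple T -> R[i]) :
  (forall i, P i -> vanish (F i)) -> vanish (fun j t => \sum_(i <- r | P i) F i j t).
Proof.
move=> F0; elim: r => [|i r IH].
  by apply: eq_vanish (vanish0 m) => j t; rewrite big_nil.
have [Pi|/negbTE Pi] := boolP (P i).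
  by apply: eq_vanish (vanish_lin 1 (F0 i Pi) IH) => j t; rewrite big_cons Pi mul1r.
by apply: eq_vanish IH => j t; rewrite big_cons Pi.
Qed.

Lemma vanish_Psym m (F : nat -> m.-tuple T -> R[i]) :
  vanish F -> vanish (fun j => Psym Q (F j)).
Proof.
move=> [mF F0].
have S0 : vanish (fun j t => \sum_(p : 'S_m) Psi Q p (F j) t).
  apply: vanish_sum => p _; split; first by move=> j; exact: cmeasurable_Psi.
  rewrite (_ : (fun j : nat => _) = fun j =>
    sqnorm (@sigman R T sigma m) (F j : m.-tuple bT -> R[i]))//.
  by apply/funext => j; rewrite (sqnorm_Psi sigma Qnorm p (mF _)).
apply: eq_vanish (vanish_lin (m`!%:R)^-1 S0 (vanish0 m)) => j t.
by rewrite addr0.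
Qed.

Lemma bounded_vanish m (F : nat -> m.-tuple T -> R[i]) (C : R) :
  (forall j, Kclass K (F j)) -> (forall j t, normsq (F j t) <= C) ->
  (forall t, normsq (F j t) @[j --> \oo] --> (0 : R)) -> vanish F.
Proof.
move=> FK FC F0; split; first by move=> j; have [] := FK j.
apply: (@bounded_cvg_sqnorm _ _ _ (@sigman R T sigma m) _ (@measurable_rectK _ _ _ mK m)
  (sigman_rectK mK Kfin m) _ C _ FC _ F0) => j; first by have [] := FK j.
exact: notin_rectK (FK j).
Qed.

(** For fixed s, dominated convergence in u gives convergence in L^2, and on a cube of finite
    measure the integral is controlled by the L^2 norm. *)
Lemma smearS_cvg0 n (f : nat -> n.-tuple T -> R[i]) (C : R)
    (V : {set {set 'I_n}} * {set {set 'I_n}}) s : marked_partition V ->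
  (forall j, Kclass K (f j)) -> (forall j t, normsq (f j t) <= C) ->
  (forall t, normsq (f j t) @[j --> \oo] --> (0 : R)) ->
  normsq (smearS (f j) V s) @[j --> \oo] --> (0 : R).
Proof.
move=> mV fK fC f0; set D := rect (fun _ : 'I_#|V.2| => K).
pose g j (u : #|V.2|.-tuple T) := f j (assembleS V s u) * Qpartition Q V (assembleS V s u).
pose c := normsq (lambda%:C ^+ lambda_exponent V).
pose I j := normsq (cintegral (@sigman R T sigma #|V.2|) (g j : #|V.2|.-tuple bT -> R[i])).
suff I0 : I j @[j --> \oo] --> (0 : R).
  have -> : (fun j => normsq (smearS (f j) V s)) = fun j => c * I j.
    by apply/funext => j; rewrite normsqM.
  by rewrite -[X in _ --> X](mulr0 c); apply: cvgM => //; exact: cvg_cst.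
have gK j : Kclass K (g j) by exact: (Kclass_integrand mQ Qnorm mV (fK j) s erefl).
have [mg g0] : vanish g.
  apply: bounded_vanish gK _ _ => [j u|u].
    by rewrite normsqM (normsq_Qpartition Qnorm) mulr1.
  by under eq_fun do rewrite normsqM (normsq_Qpartition Qnorm) mulr1; exact: f0.
suff I0 : (I j)%:E @[j --> \oo] --> 0%:E by exact: (fine_cvg I0).
apply: (@squeeze_cvge _ _ _ _ (cst 0%E) _ (fun j =>
  (2 * (fine (@sigman R T sigma #|V.2| D) + 1))%:E *
  sqnorm (@sigman R T sigma #|V.2|) (g j : #|V.2|.-tuple bT -> R[i]))%E).
- apply: nearW => j; rewrite lee_fin normsq_ge0 /=.
  apply: (@normsq_cintegral_le_sqnorm _ _ _ (@sigman R T sigma #|V.2|) _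
    (@measurable_rectK _ _ _ mK _) (sigman_rectK mK Kfin _) (g j) (mg j)).
  exact: notin_rectK (gK j).
- exact: cvg_cst.
- by rewrite -[X in _ --> X](mule0 (2 * (fine (@sigman R T sigma #|V.2| D) + 1))%:E); apply: cvgeZl.
Qed.

Lemma wick_sum_cvg0 n (f : nat -> n.-tuple T -> R[i]) (C : R) :
  (forall j, Kclass K (f j)) -> (forall j t, normsq (f j t) <= C) ->
  (forall t, normsq (f j t) @[j --> \oo] --> (0 : R)) ->
  forall m, vanish (fun j (t : m.-tuple T) => wick_sum (f j) t).
Proof.
move=> fK fC f0 m.
have S0 : vanish (fun j t => \sum_(V : {set {set 'I_n}} * {set {set 'I_n}} | marked_partition V)
    chaos #|V.1| (smearS (f j) V) (t : m.-tuple T)).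
  apply: vanish_sum => V mV; have [mk|mk] := eqVneq m #|V.1|; last first.
    by apply: eq_vanish (vanish0 m) => j t; rewrite chaos_neq.
  have SK j : Kclass K (fun s : m.-tuple T => smearS (f j) V s).
    exact: (Kclass_smearS mK Kfin mQ Qnorm lambda mV (fK j) (esym mk)).
  have S0 : vanish (fun j (s : m.-tuple T) => smearS (f j) V s).
    apply: (bounded_vanish SK) => [j s|s].
      exact: (normsq_smearS_le mK Kfin mQ Qnorm lambda mV (fK j) (fC j)).
    exact: smearS_cvg0 mV fK fC f0.
  by apply: eq_vanish (vanish_Psym S0) => j t; rewrite -mk chaos_at.
apply: eq_vanish S0 => j t; rewrite /wick_sum.
by elim/big_ind2 : _ => // F x G y -> ->.
Qed.

End wick_sum_continuity.

(** * The algebra generated by the fields *)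

Section algebra.
Context {R : realType} {T : completePseudoMetricType R}.
Variable sigma : {sigma_finite_measure set (borel T) -> \bar R}.
Local Notation bT := (borel T).
Local Notation fvec := (fvec R T).
Hypothesis compact_fin : forall K : set T, compact K ->
  measurable (K : set bT) /\ (sigma K < +oo)%E.
Variable Q : T -> T -> R[i].
Hypothesis mQ : cmeasurable setT (fun z : bT * bT => Q z.1 z.2).
Hypothesis Qnorm : forall s t, normsq (Q s t) = 1.
Hypothesis Qconj : forall s t, Q s t = (Q t s)^*.
Variable lambda : R.
Local Notation is_fin := (is_fin sigma Q).
Local Notation is_operator := (is_operator sigma Q).
Local Notation is_adjoint := (is_adjoint sigma Q).
Local Notation field_algebra := (field_algebra sigma Q lambda).
Local Notation field_monomial := (field_monomial sigma Q lambda).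
Local Notation algebra_upto := (algebra_upto sigma Q lambda).

Lemma B0_Kfield (f : T -> R) : B0 f -> exists2 K : set T, compact K & Kfield K f.
Proof. by move=> [mf fC [K cK fK]]; exists K. Qed.

Lemma B0_admissible (f : T -> R) : B0 f -> admissible sigma f.
Proof.
by move=> /B0_Kfield[K /compact_fin[mK Kfin] fK]; exact: (Kfield_admissible mK Kfin fK).
Qed.

Lemma is_operator_id : is_operator idfun.
Proof. by split => // c F G _ _; exact: feq_refl. Qed.

Lemma is_operator_comp p q : is_operator p -> is_operator q -> is_operator (p \o q).
Proof.
move=> [pf pe pl] [qf qe ql]; split => /=.
- by move=> F fF; exact/pf/qf.
- by move=> F G fF fG FG; apply: pe; [exact: qf|exact: qf|exact: qe].
- move=> c F G fF fG; have fFG := is_fin_lin Qnorm Qconj c fF fG.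
  have qFG := is_fin_lin Qnorm Qconj c (qf _ fF) (qf _ fG).
  exact: feq_trans (pe _ _ (qf _ fFG) qFG (ql c F G fF fG)) (pl c _ _ (qf _ fF) (qf _ fG)).
Qed.

Lemma is_operator_lin (a : R[i]) p q : is_operator p -> is_operator q ->
  is_operator (fun F => a *: p F + q F).
Proof.
move=> [pf pe pl] [qf qe ql]; split => /=.
- by move=> F fF; apply: (is_fin_lin Qnorm Qconj); [exact: pf|exact: qf].
- by move=> F G fF fG FG; apply: feq_lin; [exact: pe|exact: qe].
- move=> c F G fF fG; apply: feq_trans (feq_lin a (pl c F G fF fG) (ql c F G fF fG)) _.
  have -> : a *: (c *: p F + p G) + (c *: q F + q G) =
      c *: (a *: p F + q F) + (a *: p G + q G).
    by rewrite !scalerDr !scalerA [a * c]mulrC addrACA.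
  exact: feq_refl.
Qed.

Lemma is_adjoint_lin (a : R[i]) p p' q q' : is_operator p -> is_operator q ->
  is_adjoint p p' -> is_adjoint q q' ->
  is_adjoint (fun F => a *: p F + q F) (fun F => a^* *: p' F + q' F).
Proof.
move=> [pf _ _] [qf _ _] [op' pE] [oq' qE]; split; first exact: is_operator_lin.
have [p'f _ _] := op'; have [q'f _ _] := oq'.
move=> F G fF fG.
apply: (etrans (fip_fin_linl a (is_fin_l2 (pf _ fF)) (is_fin_l2 (qf _ fF)) fG)).
rewrite (pE F G fF fG) (qE F G fF fG).
apply: esym; apply: (etrans (fip_fin_linr a^* (is_fin_l2 (p'f _ fG)) (is_fin_l2 (q'f _ fG)) fF)).
by rewrite conjCK.
Qed.

Lemma is_adjoint_comp p p' q q' : is_operator p -> is_operator q ->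
  is_adjoint p p' -> is_adjoint q q' -> is_adjoint (p \o q) (q' \o p').
Proof.
move=> [pf _ _] [qf _ _] [op' pE] [oq' qE]; split; first exact: is_operator_comp.
have [p'f _ _] := op'.
move=> F G fF fG /=; apply: (etrans (pE _ _ (qf _ fF) fG)).
exact: (qE _ _ fF (p'f _ fG)).
Qed.

Lemma is_adjointC p q : is_operator p -> is_adjoint p q -> is_adjoint q p.
Proof.
move=> op [[qf _ _] pE]; split; first exact: op.
move=> F G fF fG; have [pf _ _] := op.
apply: (etrans (fip_finC (qf _ fF) (is_fin_l2 fG))).
apply: (etrans (congr1 Num.conj (esym (pE _ _ fG fF)))).
exact: (esym (fip_finC fF (is_fin_l2 (pf _ fG)))).
Qed.

Lemma is_adjoint_id : is_adjoint idfun idfun.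
Proof. by split => //; exact: is_operator_id. Qed.

Lemma fadd_lin (p q : fvec -> fvec) : (fun F => p F + q F) = (fun F => 1 *: p F + q F).
Proof. by apply/funext => F; rewrite scale1r. Qed.

(** Writing c p as (c - 1) p + p brings a multiple into the form a p + q, for which operators and
    adjoints are treated at once. *)
Lemma fscale_lin (c : R[i]) (p : fvec -> fvec) :
  (fun F => c *: p F) = (fun F => (c - 1) *: p F + p F).
Proof. by apply/funext => F; rewrite scalerBl scale1r subrK. Qed.

(** The adjoint is carried along with the operator property because the inner product of L^2(tau) is
    evaluated through an adjoint of the second polynomial. In the case of [field_algebra_star] the
    adjoint of q is p itself. *)
Lemma field_algebra_operator_adjoint p : field_algebra p ->
  is_operator p /\ exists2 q, field_algebra q & is_adjoint p q.
Proof.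
elim => {p}.
- move=> f B0f; have fadm := B0_admissible B0f.
  split; first exact: (fieldop_operator mQ Qnorm Qconj fadm).
  by exists (fieldop sigma Q lambda f); [exact: field_algebra_field|exact: fieldop_selfadjoint].
- split; first exact: is_operator_id.
  by exists idfun; [exact: field_algebra_one|exact: is_adjoint_id].
- move=> p q _ [op [p' ap' pp']] _ [oq [q' aq' qq']].
  rewrite fadd_lin; split; first exact: is_operator_lin.
  exists (fun F => p' F + q' F); first exact: field_algebra_add.
  by rewrite fadd_lin; have := is_adjoint_lin 1 op oq pp' qq'; rewrite conjC1.
- move=> c p _ [op [p' ap' pp']].
  rewrite fscale_lin; split; first exact: is_operator_lin.
  exists (fun F => c^* *: p' F); first exact: field_algebra_scale.
  by rewrite fscale_lin; have := is_adjoint_lin (c - 1) op op pp' pp'; rewrite rmorphB /= conjC1.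
- move=> p q _ [op [p' ap' pp']] _ [oq [q' aq' qq']].
  split; first exact: is_operator_comp.
  by exists (q' \o p'); [exact: field_algebra_mul|exact: is_adjoint_comp].
- move=> p q ap [op _] pq; split; first by have [] := pq.
  by exists p; [exact: ap|exact: is_adjointC op pq].
Qed.

Lemma field_algebra_operator p : field_algebra p -> is_operator p.
Proof. by move=> /field_algebra_operator_adjoint[]. Qed.

Lemma field_monomial_algebra s : (forall f, f \in s -> B0 f) ->
  field_algebra (field_monomial s).
Proof.
elim: s => [_|f s IH sB] /=; first exact: field_algebra_one.
apply: field_algebra_mul.
  by apply: field_algebra_field; apply: sB; rewrite inE eqxx.
by apply: IH => g gs; apply: sB; rewrite inE gs orbT.
Qed.

Lemma algebra_upto_algebra n p : algebra_upto n p -> field_algebra p.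
Proof.
move=> [m [c [s [sB ->]]]]; elim: m c s sB => [|m IH] c s sB.
  rewrite (_ : (fun _ => _) = fun F => (0 : R[i]) *: F).
    exact: (field_algebra_scale 0 (field_algebra_one _ _ _)).
  by apply/funext => F; rewrite big_ord0 scale0r.
rewrite (_ : (fun _ => _) = fun F => c ord0 *: field_monomial (s ord0) F +
  \sum_(i < m) c (lift ord0 i) *: field_monomial (s (lift ord0 i)) F); last first.
  by apply/funext => F; rewrite big_ord_recl.
apply: field_algebra_add.
  by apply: field_algebra_scale; apply: field_monomial_algebra; have [] := sB ord0.
by apply: (IH (fun i => c (lift ord0 i)) (fun i => s (lift ord0 i))) => i; exact: sB.
Qed.

Lemma algebra_upto_lin n (a : R[i]) p q : algebra_upto n p -> algebra_upto n q ->
  algebra_upto n (fun F => a *: p F + q F).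
Proof.
move=> [m [c [s [sB ->]]]] [k [d [r [rB ->]]]].
exists (m + k)%N,
  (fun i => match fintype.split i with inl i => a * c i | inr i => d i end),
  (fun i => match fintype.split i with inl i => s i | inr i => r i end); split.
  by move=> i; case: (fintype.split i).
apply/funext => F; rewrite big_split_ord /= scaler_sumr; congr (_ + _).
  apply: eq_bigr => i _; rewrite scalerA.
  by rewrite -[lshift _ _]/(unsplit (inl _)) unsplitK.
by apply: eq_bigr => i _; rewrite -[rshift _ _]/(unsplit (inr _)) unsplitK.
Qed.

Lemma algebra_upto_mono n n' p : (n <= n')%N -> algebra_upto n p -> algebra_upto n' p.
Proof.
move=> nn' [m [c [s [sB ->]]]]; exists m, c, s; split => // i.
by have [si sBi] := sB i; split => //; exact: leq_trans si nn'.
Qed.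

Lemma algebra_upto_monomial s : (forall f, f \in s -> B0 f) ->
  algebra_upto (size s) (field_monomial s).
Proof.
move=> sB; exists 1, (fun=> 1), (fun=> s); split => //.
by apply/funext => F; rewrite big_ord1 scale1r.
Qed.

Lemma vacuum_is_fin : is_fin (vacuum : fvec).
Proof.
have K0 : compact (set0 : set T) by exact: compact0.
have [mK Kfin] := compact_fin K0.
rewrite (vacuum_chaos Q); apply: (Kclass_is_fin_chaos mK Kfin mQ Qnorm Qconj); split.
- exact: cmeasurable_cst.
- by exists 1 => t; rewrite normsq1.
- by move=> t [].
Qed.

Lemma is_fin_algebra p : field_algebra p -> is_fin (p vacuum).
Proof. by move=> /field_algebra_operator[pf _ _]; exact/pf/vacuum_is_fin. Qed.

Lemma fnorm2_is_finD F G : is_fin F -> is_fin G ->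
  (fnorm2 sigma (F + G)%R <= 2%:E * (fnorm2 sigma F + fnorm2 sigma G))%E.
Proof.
move=> fF fG; have [N FN] := is_fin_bdd fF; have [M GM] := is_fin_bdd fG.
exact: (fnorm2D_le (is_fin_l2 fF) (is_fin_l2 fG)
  (bdd_le (leq_maxl N M) FN) (bdd_le (leq_maxr N M) GM)).
Qed.

Lemma fnorm2_is_finZ (c : R[i]) F : is_fin F ->
  fnorm2 sigma (c *: F) = ((normsq c)%:E * fnorm2 sigma F)%E.
Proof.
by move=> fF; have [N FN] := is_fin_bdd fF; exact: (fnorm2Z c (is_fin_l2 fF) FN).
Qed.

Lemma fnorm2_is_fin F : is_fin F -> fnorm2 sigma F \is a fin_num.
Proof.
by move=> fF; have [N FN] := is_fin_bdd fF; exact: (fnorm2_fin (is_fin_l2 fF) FN).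
Qed.

(** Membership of F in the closure of the vacuum vectors of polynomials of degree at most n, the
    Fock space picture of [MP n]. *)
Definition approximable n F : Prop := forall e : R, 0 < e ->
  exists2 p, algebra_upto n p & (fnorm2 sigma (p vacuum - F)%R < e%:E)%E.

Lemma approximable_mono n n' F : (n <= n')%N -> approximable n F -> approximable n' F.
Proof.
by move=> nn' aF e /aF[p pn pF]; exists p => //; exact: algebra_upto_mono pn.
Qed.

Lemma approximable_lin n (c : R[i]) F G : is_fin F -> is_fin G ->
  approximable n F -> approximable n G -> approximable n (c *: F + G).
Proof.
move=> fF fG aF aG e e0.
(* Chosen so that 2 (|c|^2 d + d) = e / 2, the factor 2 being that of the quasi-triangle
   inequality. *)
pose d := e / (4 * (normsq c + 1)).
have c1 : 0 < 4 * (normsq c + 1) by rewrite mulr_gt0// ltr_wpDl// normsq_ge0.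
have d0 : 0 < d by rewrite divr_gt0.
have [p pn pF] := aF d d0; have [q qn qG] := aG d d0.
exists (fun H => c *: p H + q H); first exact: algebra_upto_lin.
have fp := is_fin_algebra (algebra_upto_algebra pn).
have fq := is_fin_algebra (algebra_upto_algebra qn).
have fpF := is_finB Qnorm Qconj fp fF; have fqG := is_finB Qnorm Qconj fq fG.
have -> : c *: p vacuum + q vacuum - (c *: F + G) =
    c *: (p vacuum - F) + (q vacuum - G) by rewrite scalerBr opprD addrACA.
apply: le_lt_trans (fnorm2_is_finD (is_finZ Qnorm Qconj c fpF) fqG) _.
rewrite (fnorm2_is_finZ c fpF).
have := fnorm2_is_fin fpF; have := fnorm2_is_fin fqG.
have := fnorm2_ge0 sigma (p vacuum - F); have := fnorm2_ge0 sigma (q vacuum - G).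
move: pF qG; case: (fnorm2 sigma (p vacuum - F)) => // x.
case: (fnorm2 sigma (q vacuum - G)) => // y; rewrite !lte_fin !lee_fin => xd yd y0 x0 _ _.
have c0 := normsq_ge0 c.
apply: (@le_lt_trans _ _ (2 * (normsq c * d + y))).
  by rewrite ler_pM2l// lerD2r ler_wpM2l// ltW.
apply: (@lt_le_trans _ _ (2 * (normsq c * d + d))); first by rewrite ltr_pM2l// ltrD2l.
have -> : 2 * (normsq c * d + d) = e / 2.
  by rewrite /d; field; rewrite gt_eqF// ltr_wpDl.
by lra.
Qed.

Lemma feq_approximable n F G : is_fin F -> is_fin G -> feq sigma F G ->
  approximable n F -> approximable n G.
Proof.
move=> fF fG FG aF e /aF[p pn pF]; exists p; first exact: pn.
have fp := is_fin_algebra (algebra_upto_algebra pn).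
have [M HM] := is_fin_bdd (is_finB Qnorm Qconj fp fF).
rewrite -(feq_fnorm2 (F := p vacuum - F))//.
- exact: is_fin_l2 (is_finB Qnorm Qconj fp fF).
- exact: is_fin_l2 (is_finB Qnorm Qconj fp fG).
by move=> m; apply: ae_mono (FG m) => t /= FGt; congr (_ - _).
Qed.

Lemma approximable_lim n F : is_fin F ->
  (forall e : R, 0 < e -> exists G, [/\ is_fin G, approximable n G
     & (fnorm2 sigma (G - F)%R < e%:E)%E]) -> approximable n F.
Proof.
move=> fF lF e e0; have e4 : 0 < e / 4 by rewrite divr_gt0.
have [G [fG aG GF]] := lF _ e4; have [p pn pG] := aG _ e4; exists p; first exact: pn.
have fp := is_fin_algebra (algebra_upto_algebra pn).
have fpG := is_finB Qnorm Qconj fp fG; have fGF := is_finB Qnorm Qconj fG fF.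
have -> : p vacuum - F = (p vacuum - G) + (G - F) by rewrite addrA subrK.
apply: le_lt_trans (fnorm2_is_finD fpG fGF) _.
apply: (@lt_le_trans _ _ (2%:E * ((e / 4)%:E + (e / 4)%:E)))%E.
  by rewrite lte_pmul2l; [exact: (lteD pG GF)| |].
by rewrite -EFinD -EFinM lee_fin; lra.
Qed.

End algebra.

(** * Numbers of blocks and the partition into singletons *)

Section marked_cards.
Import mathcomp.boot.finset.
Local Open Scope nat_scope.
Local Open Scope set_scope.
Variables (n : nat) (V : {set {set 'I_n}} * {set {set 'I_n}}).
Hypothesis mV : marked_partition V.

Lemma card_marked : \sum_(B in V.1) #|B| + \sum_(B in V.2) #|B| = n.
Proof.
have /and3P[pV dV _] := mV.
have nE := card_partition pV; rewrite cardsT card_ord in nE.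
rewrite -bigU//=; apply: (etrans _ (esym nE)).
by apply: eq_bigl => B; rewrite in_setU.
Qed.

Lemma card_marked1_le : #|V.1| <= n.
Proof.
rewrite -sum1_card -[leqRHS]card_marked; apply: leq_trans (leq_addr _ _).
by apply: leq_sum => B BV; rewrite card_gt0 (marked1_neq0 mV BV).
Qed.

Definition singleton_blocks : {set {set 'I_n}} * {set {set 'I_n}} :=
  ([set [set i] | i : 'I_n], set0).

(** Nonempty blocks marked +1 of total size at most n can number n only if each is a singleton and
    nothing is left for blocks marked -1. *)
Lemma card_marked1_lt : V != singleton_blocks -> #|V.1| < n.
Proof.
apply: contraR; rewrite -leqNgt => nV.
have V1 B : B \in V.1 -> 0 < #|B| by move=> BV; rewrite card_gt0 (marked1_neq0 mV BV).
have s1 : #|V.1| <= \sum_(B in V.1) #|B|.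
  by rewrite -sum1_card; apply: leq_sum => B /V1.
have V20 : V.2 = set0.
  apply/setP => B; rewrite inE; apply/negbTE/negP => BV.
  have /and3P[_ _ /forall_inP/(_ _ BV) B1] := mV.
  have : 0 < \sum_(B in V.2) #|B| by rewrite (big_setD1 B)//= addn_gt0 (ltn_trans _ B1).
  by have := card_marked; lia.
have B1 B : B \in V.1 -> #|B| = 1.
  move=> BV; have := card_marked; rewrite V20 [X in _ + X]big_set0 addn0.
  rewrite (big_setD1 B)//=; set S := (X in _ + X = _) => cV.
  have hS : #|V.1 :\ B| <= S.
    by rewrite /S -sum1_card; apply: leq_sum => C; rewrite in_setD1 => /andP[_ /V1].
  have cB := cardsD1 B V.1; rewrite BV add1n in cB.
  have arith (a b c d m : nat) : a + b = m -> c <= b -> m <= d -> d = c.+1 -> 0 < a -> a = 1.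
    by lia.
  exact: arith cV hS nV cB (V1 B BV).
apply/eqP; rewrite [V]surjective_pairing V20; congr (_, _); apply/setP => B.
apply/idP/imsetP => [BV|[i _ ->]].
  by have /eqP/cards1P[i ->] := B1 B BV; exists i.
have [B'] := marked_cover mV i; rewrite V20 setU0 => BV iB.
have /eqP/cards1P[j Bj] := B1 B' BV.
by move: iB; rewrite Bj inE => /eqP ->; rewrite -Bj.
Qed.

End marked_cards.

Section singleton_partition.
Import mathcomp.boot.finset.
Local Open Scope nat_scope.
Local Open Scope set_scope.
Variable n : nat.

Lemma singleton_blocks_marked : marked_partition (singleton_blocks n).
Proof.
apply/marked_partitionP; rewrite /singleton_blocks setU0 /=; split.
- by apply/imsetP => -[i _ /setP/(_ i)]; rewrite !inE eqxx.
- by move=> i; exists [set i]; rewrite ?inE//; apply: imset_f.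
- by move=> B C i /imsetP[j _ ->] /imsetP[k _ ->]; rewrite !inE => /eqP <- /eqP <-.
- by move=> B _; rewrite inE.
- by move=> B; rewrite inE.
Qed.

Lemma card_singleton_blocks1 : #|(singleton_blocks n).1| = n.
Proof. by rewrite card_imset ?card_ord//; exact: set1_inj. Qed.

Lemma bmax_set1 (i : 'I_n) : bmax [set i] = i.
Proof. by rewrite /bmax big_set1. Qed.

Lemma block_rank_singleton_blocks (i : 'I_n) : block_rank (singleton_blocks n).1 [set i] = i.
Proof.
rewrite /block_rank bmax_set1 -[RHS](@card_ord i).
have i_n : i <= n by exact: ltnW.
rewrite -(card_imset predT (f := fun j : 'I_i => [set widen_ord i_n j])); last first.
  by move=> j k /set1_inj/(congr1 val)/= jk; apply: val_inj.
congr #|pred_of_set _|; apply/setP => B; rewrite !inE.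
apply/andP/imsetP => [[/imsetP[j _ ->]]|[j _ ->]].
  rewrite bmax_set1 => ji; exists (Ordinal ji) => //.
  by congr [set _]; exact: val_inj.
rewrite bmax_set1; split; last exact: (ltn_ord j).
by apply/imsetP; exists (widen_ord i_n j).
Qed.

Context {R : realType} {T : completePseudoMetricType R}.
Variable sigma : {sigma_finite_measure set (borel T) -> \bar R}.
Variables (Q : T -> T -> R[i]) (lambda : R).
Local Open Scope ring_scope.

Lemma smearS_singleton_blocks (f : n.-tuple T -> R[i]) (s : n.-tuple T) :
  smearS sigma Q lambda f (singleton_blocks n) s = f s.
Proof.
have aE u : assembleS (singleton_blocks n) s u = s.
  apply: eq_from_tnth => i.
  have iS : [set i] \in (singleton_blocks n).1 by exact: imset_f.
  rewrite (tnth_assemble1 singleton_blocks_marked _ _ iS) ?set11//.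
  by rewrite block_rank_singleton_blocks -tnth_nth.
rewrite (@smearSE _ _ _ _ _ _ _ _ _ 0) ?cards0//.
have -> : lambda_exponent (singleton_blocks n) = 0%N.
  rewrite /lambda_exponent /= [X in (_ + X)%N]big_set0 big1// => B /imsetP[i _ ->].
  by rewrite cards1.
rewrite expr0 mul1r (@eq_cintegral _ _ _ (@sigman R T sigma 0) _ (fun=> f s)); last first.
  move=> u; rewrite aE /Qpartition big_set0 mul1r big1 ?mulr1// => B _.
  by rewrite big_pred0// => C; rewrite inE.
have d1 : @sigman R T sigma 0 classical_sets.setT = 1%E by exact: diracT.
rewrite /cintegral !(@integral_cst _ _ _ (@sigman R T sigma 0))//.
by apply: complex_ext; apply: (etrans (congr1 (fun x => fine (_ * x)%E) d1));
  rewrite mule1.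
Qed.

End singleton_partition.

(** * Bounded functions with compact support *)

Section bounded_functions.
Context {R : realType} {T : completePseudoMetricType R}.
Local Notation bT := (borel T).

Lemma Kclass_B0n n (K : set T) (f : n.-tuple T -> R[i]) : compact K ->
  Kclass K f -> B0n f.
Proof.
move=> cK [mf [C fC] fK]; split => //.
  (* C bounds the squared modulus, and C <= (|C| + 1)^2. *)
  exists (`|C| + 1) => t; apply/normc_le_normsq; first by rewrite addr_ge0.
  apply: (le_trans (fC t)); have := ler_norm C; have := normr_ge0 C; nra.
exists [set u | forall i, K (u i)].
  exact: (@tychonoff _ (fun _ : 'I_n => T) (fun=> K) (fun=> cK)).
by move=> t /existsNP[i ti]; exact: fK ti.
Qed.

(** The union of the n coordinate projections of the compact support is compact and controls every
    coordinate. *)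
Lemma B0n_Kclass n (f : n.-tuple T -> R[i]) : B0n f ->
  exists2 K : set T, compact K & Kclass K f.
Proof.
move=> [mf [C fC] [K cK fK]].
exists (\big[setU/set0]_(i < n) [set u i | u in K]).
  apply: bigsetU_compact => i _; apply: continuous_compact cK.
  by apply: continuous_subspaceT => u; exact: proj_continuous.
split => //.
  exists (C ^+ 2) => t; apply/normc_le_normsq => //.
  by have := le_trans (normr_ge0 _) (fC t); rewrite ler0c.
move=> t i ti; apply: fK => Kt; apply: ti.
by rewrite (bigD1 i)//=; left; exists (tnth t).
Qed.

Lemma supported_Kclass n (K : set T) (f : n.-tuple T -> R[i]) : Kclass K f ->
  supported_in [set u | forall i, K (u i)] f.
Proof. by move=> [_ _ fK] t /existsNP[i ti]; exact: fK ti. Qed.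

Lemma Kfield_B0 (K : set T) (f : T -> R) : compact K -> Kfield K f -> B0 f.
Proof. by move=> cK [mf fC fK]; split => //; exists K. Qed.

(** The difference is written as -1 * z + u j to fit the linearity lemmas for [Kclass] and
    [wick_sum]. *)
Lemma ccvg_normsqB (u : nat -> R[i]) (z : R[i]) : ccvg u z ->
  normsq (-1 * z + u j) @[j --> \oo] --> (0 : R).
Proof.
move=> [uRe uIm].
have B0 (v : nat -> R) (a : R) : v j @[j --> \oo] --> a ->
    (- a + v j) ^+ 2 @[j --> \oo] --> (0 : R).
  move=> va; have -> : (0 : R) = (- a + a) ^+ 2 by rewrite addNr expr0n.
  have D : (- a + v j) @[j --> \oo] --> - a + a by apply: cvgD => //; exact: cvg_cst.
  by under eq_fun do rewrite expr2; rewrite expr2; exact: cvgM.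
have -> : (fun j => normsq (-1 * z + u j)) = fun j =>
    (- complex.Re z + complex.Re (u j)) ^+ 2 + (- complex.Im z + complex.Im (u j)) ^+ 2.
  by apply/funext => j; rewrite /normsq mulN1r cReD cImD cReN cImN.
by rewrite -[X in _ --> X](addr0 0); apply: cvgD; exact: B0.
Qed.

End bounded_functions.

Lemma ecvg_sum0 {R : realType} N (a : nat -> nat -> \bar R) :
  (forall m, a m j @[j --> \oo] --> 0%E) ->
  (\sum_(m < N) a m j)%E @[j --> \oo] --> 0%E.
Proof.
move=> a0; elim: N => [|N IH].
  by under eq_fun do rewrite big_ord0; exact: cvg_cst.
rewrite (_ : (fun j => _) = fun j => (\sum_(m < N) a m j + a N j)%E); last first.
  by apply/funext => j; rewrite big_ord_recr.
by rewrite -[X in _ --> X]adde0; apply: cvgeD.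
Qed.

(** * Approximation of chaos vectors by polynomials *)

Section chaos_approximation.
Context {R : realType} {T : completePseudoMetricType R}.
Variable sigma : {sigma_finite_measure set (borel T) -> \bar R}.
Local Notation bT := (borel T).
Local Notation fvec := (fvec R T).
Hypothesis compact_fin : forall K : set T, compact K ->
  measurable (K : set bT) /\ (sigma K < +oo)%E.
Variable Q : T -> T -> R[i].
Hypothesis mQ : cmeasurable setT (fun z : bT * bT => Q z.1 z.2).
Hypothesis Qnorm : forall s t, normsq (Q s t) = 1.
Hypothesis Qconj : forall s t, Q s t = (Q t s)^*.
Variable lambda : R.
Variable K : set T.
Hypothesis cK : compact K.
Local Notation chaos := (chaos Q).
Local Notation wick_sum := (wick_sum sigma Q lambda).
Local Notation approximable := (approximable sigma Q lambda).

Let mK : measurable (K : set bT) := (compact_fin cK).1.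
Let Kfin : (sigma K < +oo)%E := (compact_fin cK).2.

Lemma bdd_wick_sum n (f : n.-tuple T -> R[i]) : bdd sigma n.+1 (wick_sum f).
Proof.
move=> m nm; apply: aeW => t.
have : forall V, marked_partition V ->
    chaos #|V.1| (smearS sigma Q lambda f V) (t : m.-tuple T) = 0.
  move=> V mV; rewrite chaos_neq//; apply/eqP => mE.
  by have := card_marked1_le mV; rewrite -mE leqNgt nm.
rewrite /wick_sum => H; elim/big_ind : (\sum_(V | _) _) => //.
by move=> F G; rewrite /GRing.add /= => -> ->; rewrite addr0.
Qed.

Lemma fnorm2_wick_sum_cvg0 n (f : nat -> n.-tuple T -> R[i]) (C : R) :
  (forall j, Kclass K (f j)) -> (forall j t, normsq (f j t) <= C) ->
  (forall t, normsq (f j t) @[j --> \oo] --> (0 : R)) ->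
  fnorm2 sigma (wick_sum (f j)) @[j --> \oo] --> 0%E.
Proof.
move=> fK fC f0.
have fE j := fnorm2E (is_fin_l2 (is_fin_wick_sum mK Kfin mQ Qnorm Qconj lambda (fK j)))
  (bdd_wick_sum (f j)).
rewrite (_ : (fun j => fnorm2 sigma (wick_sum (f j))) = fun j => \sum_(m < n.+1)
  ((m`!%:R)%:E * sqnorm (@sigman R T sigma m) (fun t : m.-tuple bT => wick_sum (f j) t)))%E.
  apply: (@ecvg_sum0 R n.+1 (fun m j => (m`!%:R)%:E *
    sqnorm (@sigman R T sigma m) (fun t : m.-tuple bT => wick_sum (f j) t))%E) => m.
  rewrite -[X in _ --> X](mule0 (m`!%:R)%:E); apply: cvgeZl => //.
  by have [_] := wick_sum_cvg0 mK Kfin mQ Qnorm lambda fK fC f0 m.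
by apply/funext => j; exact: fE.
Qed.

Lemma fnorm2_0 : fnorm2 sigma 0 = 0%E.
Proof.
have f0 := is_fin0 sigma Qnorm Qconj.
by have := fnorm2_is_finZ 0 f0; rewrite scale0r normsq0 mul0e.
Qed.

Lemma approximable_algebra n p : algebra_upto sigma Q lambda n p ->
  approximable n (p vacuum).
Proof. by move=> pn e e0; exists p; [exact: pn|rewrite subrr fnorm2_0 lte_fin]. Qed.

Lemma approximable_sum n (I : Type) (r : seq I) (P : pred I) (F : I -> fvec) :
  (forall i, P i -> is_fin sigma Q (F i)) -> (forall i, P i -> approximable n (F i)) ->
  approximable n (\sum_(i <- r | P i) F i).
Proof.
move=> fF aF.
(* Zero is taken as the difference of two vacuum vectors, the vacuum being the value of the empty
   monomial. *)
have a0 : approximable n 0.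
  have nilB (f : T -> R) : f \in [::] -> B0 f by [].
  have v0 := approximable_mono (leq0n n)
    (approximable_algebra (algebra_upto_monomial sigma Q lambda nilB)).
  have fv := vacuum_is_fin compact_fin mQ Qnorm Qconj.
  have := approximable_lin compact_fin mQ Qnorm Qconj (-1) fv fv v0 v0.
  by rewrite scaleN1r addNr.
elim: r => [|i r IH]; first by rewrite big_nil.
rewrite big_cons; have [Pi|_] := boolP (P i); last exact: IH.
rewrite -[F i]scale1r; apply: (approximable_lin compact_fin mQ Qnorm Qconj _).
- exact: fF.
- exact: is_fin_sum.
- exact: aF.
- exact: IH.
Qed.

(** For a product kernel the vector comes from a monomial of degree n, and a closure is stable under
    linear combinations and bounded limits of kernels. *)
Lemma approximable_wick_sum n (f : n.-tuple T -> R[i]) : Kclass K f ->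
  approximable n (wick_sum f).
Proof.
have fin g : Kclass K g -> is_fin sigma Q (wick_sum (g : n.-tuple T -> _)).
  exact: (is_fin_wick_sum mK Kfin mQ Qnorm Qconj lambda).
apply: (@Kclass_monotone_class R T K mK n (fun f => approximable n (wick_sum f))).
- move=> h hK; have hB (g : T -> R) : g \in [seq h i | i <- enum 'I_n] -> B0 g.
    by move=> /mapP[i _ ->]; exact: Kfield_B0 (hK i).
  have := algebra_upto_monomial sigma Q lambda hB; rewrite size_map size_enum_ord => an.
  apply: (feq_approximable compact_fin mQ Qnorm Qconj _ _ _ (approximable_algebra an)).
  + exact: (is_fin_algebra compact_fin mQ Qnorm Qconj (algebra_upto_algebra an)).
  + by apply: fin; exact: (Kclass_prod mK Kfin hK).
  + exact: (product_formula mK Kfin mQ Qnorm Qconj lambda hK).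
- move=> c g h gK hK ag ah; rewrite (wick_sum_lin mK Kfin mQ Qnorm lambda c gK hK).
  by apply: (approximable_lin compact_fin mQ Qnorm Qconj _) => //; exact: fin.
- move=> fj g C fjK gK fjC fjg afj.
  apply: (approximable_lim compact_fin mQ Qnorm Qconj (fin _ gK)) => e e0.
  have DK j : Kclass K (fun t => -1 * g t + fj j t) by exact: Kclass_lin.
  have [_ [D gD] _] := gK.
  have DC j t : normsq (-1 * g t + fj j t) <= 2 * (D + C).
    apply: le_trans (normsqD_le _ _) _; rewrite ler_pM2l// lerD//.
    by rewrite mulN1r normsqN.
  have := fnorm2_wick_sum_cvg0 DK DC (fun t => ccvg_normsqB (fjg t)).
  have e0' : nbhs (0%:E : \bar R) [set y | (y < e%:E)%E].
    by apply: open_nbhs_nbhs; split; [exact: open_ereal_lt_ereal|rewrite /= lte_fin].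
  move=> /(_ _ e0')[j _ /(_ j (leqnn j)) /= je].
  exists (wick_sum (fj j)); split; [exact: fin|exact: afj|].
  move: je; rewrite (wick_sum_lin mK Kfin mQ Qnorm lambda (-1) gK (fjK j)).
  by rewrite scaleN1r addrC.
Qed.

(* The partition into singletons contributes [chaos k g] itself to the expansion
   of the monomial with kernel g, and all others have fewer than k blocks marked +1. *)
Lemma chaos_approximable k (g : seq T -> R[i]) :
  Kclass K (fun s : k.-tuple T => g s) -> approximable k (chaos k g).
Proof.
elim/ltn_ind: k g => k IH g gK.
pose f : k.-tuple T -> R[i] := fun s => g s.
have SK V : marked_partition V ->
    Kclass K (fun s : #|V.1|.-tuple T => smearS sigma Q lambda f V s).
  by move=> mV; exact: (Kclass_smearS mK Kfin mQ Qnorm lambda mV gK erefl).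
pose S := \sum_(V : {set {set 'I_k}} * {set {set 'I_k}} |
    marked_partition V && (V != singleton_blocks k))
    chaos #|V.1| (smearS sigma Q lambda f V).
have E : chaos k g = -1 *: S + wick_sum f.
  rewrite /wick_sum (bigD1 (singleton_blocks k)) ?singleton_blocks_marked//= -/S.
  rewrite scaleN1r addrCA addNr addr0.
  rewrite card_singleton_blocks1; apply: eq_chaos => s sk.
  have skE : size s == k by exact/eqP.
  by rewrite -[s]/(tval (Tuple skE)) smearS_singleton_blocks.
have finV V : marked_partition V -> is_fin sigma Q (chaos #|V.1| (smearS sigma Q lambda f V)).
  by move=> mV; exact: (Kclass_is_fin_chaos mK Kfin mQ Qnorm Qconj (SK V mV)).
rewrite E; apply: (approximable_lin compact_fin mQ Qnorm Qconj _).
- by apply: (is_fin_sum Qnorm Qconj) => V /andP[mV _]; exact: finV.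
- exact: (is_fin_wick_sum mK Kfin mQ Qnorm Qconj lambda gK).
- apply: approximable_sum => V /andP[mV VS]; first exact: finV.
  have Vk := card_marked1_lt mV VS.
  exact: (approximable_mono (ltnW Vk) (IH _ Vk _ (SK V mV))).
- exact: approximable_wick_sum.
Qed.

End chaos_approximation.

(** * Monomial operators on the vacuum *)

Section monomial_extension.
Context {R : realType} {T : completePseudoMetricType R}.
Variable sigma : {sigma_finite_measure set (borel T) -> \bar R}.
Local Notation bT := (borel T).
Local Notation fvec := (fvec R T).
Hypothesis compact_fin : forall K : set T, compact K ->
  measurable (K : set bT) /\ (sigma K < +oo)%E.
Variable Q : T -> T -> R[i].
Hypothesis mQ : cmeasurable setT (fun z : bT * bT => Q z.1 z.2).
Hypothesis Qnorm : forall s t, normsq (Q s t) = 1.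
Hypothesis Qconj : forall s t, Q s t = (Q t s)^*.
Variable lambda : R.
Local Notation wick_sum := (wick_sum sigma Q lambda).
Local Notation fv := (vacuum_is_fin compact_fin mQ Qnorm Qconj).

(** Each field raises the degree by at most one, through its creation part. *)
Lemma bdd_field_monomial s : (forall f, f \in s -> B0 f) ->
  bdd sigma (size s).+1 (field_monomial sigma Q lambda s vacuum).
Proof.
elim: s => [_|f s IH sB] /=.
  by move=> n n1; apply: aeW => t; rewrite /vacuum gtn_eqF.
have sB' g : g \in s -> B0 g by move=> gs; apply: sB; rewrite inE gs orbT.
have fadm : admissible sigma f.
  by apply: (B0_admissible compact_fin); apply: sB; rewrite inE eqxx.
apply: (bdd_fieldop mQ Qnorm Qconj fadm lambda _ (IH sB')).
have := field_monomial_algebra sigma Q lambda sB'.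
exact: (is_fin_algebra compact_fin mQ Qnorm Qconj).
Qed.

Lemma bdd_algebra_upto n p : algebra_upto sigma Q lambda n p ->
  bdd sigma n.+1 (p vacuum).
Proof.
move=> [m [c [s [sB ->]]]].
elim/big_ind : (\sum_(i < m) _) => [k _|F G FN GN|i _].
- exact: aeq_refl.
- by rewrite -[F]scale1r; exact: bdd_lin.
- rewrite -[_ *: _]addr0; apply: bdd_lin; last by move=> k _; exact: aeq_refl.
  have [si sBi] := sB i.
  exact: bdd_le (leq_ltn_trans si (ltnSn n)) (bdd_field_monomial sBi).
Qed.

Variable W : forall n, (n.-tuple T -> R[i]) -> fvec -> fvec.
Hypothesis extW : is_monomial_extension sigma Q lambda W.

Lemma monomial_vacuum n (K : set T) (f : n.-tuple T -> R[i]) : compact K -> Kclass K f ->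
  feq sigma (W f vacuum) (wick_sum f).
Proof.
move=> cK; have [mK Kfin] := compact_fin cK; have [Wop Wprod Wlin Wlim] := extW.
have fW (g : n.-tuple T -> R[i]) : Kclass K g -> is_fin sigma Q (W g vacuum).
  by move=> gK; have [Wf _ _] := Wop _ _ (Kclass_B0n cK gK); exact: Wf fv.
have fw (g : n.-tuple T -> R[i]) : Kclass K g -> is_fin sigma Q (wick_sum g).
  exact: (is_fin_wick_sum mK Kfin mQ Qnorm Qconj lambda).
apply: (@Kclass_monotone_class R T K mK n (fun f => feq sigma (W f vacuum) (wick_sum f))).
- move=> h hK; apply: feq_trans (product_formula mK Kfin mQ Qnorm Qconj lambda hK).
  by apply: Wprod fv => i; exact: Kfield_B0 (hK i).
- move=> c g h gK hK Wg Wh; rewrite (wick_sum_lin mK Kfin mQ Qnorm lambda c gK hK).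
  apply: feq_trans (Wlin n c g h (Kclass_B0n cK gK) (Kclass_B0n cK hK) vacuum fv) _.
  exact: (feq_lin c Wg Wh).
- move=> fj g C fjK gK fjC fjg Wfj m.
  have nC j t : `|fj j t| <= (`|C| + 1)%:C.
    apply/normc_le_normsq; first by rewrite addr_ge0.
    by apply: (le_trans (fjC j t)); have := ler_norm C; have := normr_ge0 C; nra.
  have [_ conv] := Wlim n fj g (`|C| + 1) [set u | forall i, K (u i)]
    (fun j => Kclass_B0n cK (fjK j)) (Kclass_B0n cK gK)
    (@tychonoff _ (fun _ : 'I_n => T) (fun=> K) (fun=> cK))
    (fun j => supported_Kclass (fjK j)) nC fjg vacuum fv.
  pose a j (t : m.-tuple T) := (W (fj j) vacuum - W g vacuum) m t.
  have va : vanish sigma a.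
    split; last exact: conv.
    by move=> j; have [] := is_fin_l2 (is_finB Qnorm Qconj (fW _ (fjK j)) (fW _ gK)) m.
  have DK j : Kclass K (fun t => -1 * g t + fj j t) by exact: Kclass_lin.
  have [_ [D gD] _] := gK.
  have DC j t : normsq (-1 * g t + fj j t) <= 2 * (D + C).
    apply: le_trans (normsqD_le _ _) _; rewrite ler_pM2l// lerD//.
    by rewrite mulN1r normsqN.
  have vb := wick_sum_cvg0 mK Kfin mQ Qnorm lambda DK DC (fun t => ccvg_normsqB (fjg t)) m.
  have [_ v0] := vanish_lin (-1) va vb.
  have [mw _] := is_fin_l2 (is_finB Qnorm Qconj (fW _ gK) (fw _ gK)) m.
  have [mab _] := vanish_lin (-1) va vb.
  (* By the hypothesis on f_j, this combination of two vanishing sequences equals the difference of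
     [W g vacuum] and [wick_sum g] for every j; a constant sequence of norms that tends to 0 is
     0. *)
  have E j : sqnorm (@sigman R T sigma m)
      ((fun t => -1 * a j t + wick_sum (fun t => -1 * g t + fj j t) t) : m.-tuple bT -> R[i]) =
    sqnorm (@sigman R T sigma m) ((W g vacuum - wick_sum g) m : m.-tuple bT -> R[i]).
    apply: (ae_eq_sqnorm (mab j) mw).
    apply: ae_mono (Wfj j m) => t /= Wt.
    rewrite /a (wick_sum_lin mK Kfin mQ Qnorm lambda (-1) gK (fjK j)).
    rewrite -[LHS]/(-1 * (W (fj j) vacuum t - W g vacuum t) +
      (-1 * wick_sum g t + wick_sum (fj j) t)).
    rewrite -[RHS]/(W g vacuum t - wick_sum g t) Wt; ring.
  have D0 : sqnorm (@sigman R T sigma m)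
      ((W g vacuum - wick_sum g) m : m.-tuple bT -> R[i]) = 0%E.
    have v0' : cst (sqnorm (@sigman R T sigma m)
        ((W g vacuum - wick_sum g) m : m.-tuple bT -> R[i])) @ \oo --> 0%E.
      by apply: cvg_trans v0; apply: near_eq_cvg; apply: nearW => j; exact: E.
    exact: (cvg_unique (@ereal_hausdorff R) (cvg_cst _) v0').
  have := (sqnorm_eq0 (@sigman R T sigma m) mw).1 D0.
  apply: ae_mono => t /= /eqP; rewrite -[X in X == _]/(W g vacuum t - wick_sum g t).
  by rewrite subr_eq0 => /eqP.
Qed.

End monomial_extension.

(** Cauchy-Schwarz in abstract form: a and b are squared norms of x and y, m is the squared modulus
    of (x, y), and t scales the multiple of y subtracted from x. It serves both L and the Fock
    space. *)
Lemma quadratic_discriminant {R : realFieldType} (a b m : R) : 0 <= b -> 0 <= m ->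
  (forall t : R, 0 <= a - 2 * t * m + t ^+ 2 * m * b) -> m <= a * b.
Proof.
move=> b0 m0 H; have [b_gt0|b_le0] := ltP 0 b.
  have := H b^-1; rewrite -(pmulr_rge0 _ b_gt0).
  have -> : b * (a - 2 * b^-1 * m + b^-1 ^+ 2 * m * b) = a * b - m.
    by field; rewrite gt_eqF.
  by rewrite subr_ge0.
have bE : b = 0 by apply/eqP; rewrite eq_le b_le0 b0.
have [m_gt0|m_le0] := ltP 0 m; last by rewrite bE mulr0.
(* For b = 0 the expression is affine in t, and this t gives it the value -1. *)
have := H ((a + 1) / (2 * m)).
have -> : a - 2 * ((a + 1) / (2 * m)) * m + ((a + 1) / (2 * m)) ^+ 2 * m * b = -1.
  by rewrite bE mulr0 addr0; field; rewrite gt_eqF.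
by rewrite oppr_ge0 ler10.
Qed.

(** * Squared norms, closures and limits in a Hilbert space *)

Section hilbert_space.
Context {R : realType} (L : completeNormedModType R[i]) (ip : {dot L for Num.conj}).
Hypothesis normE : forall x : L, `|x| ^+ 2 = ip x x.
Implicit Types x y z : L.

(** The norm of L takes values in R[i]; estimates are carried out on this real number instead. *)
Definition nsq x : R := complex.Re (ip x x).

Lemma ip_lin (c : R[i]) x y z : ip (c *: x + y) z = c * ip x z + ip y z.
Proof. exact: linearPl. Qed.

Lemma ipC x y : ip x y = (ip y x)^*.
Proof. by rewrite hermC expr0 mul1r. Qed.

Lemma ip_linr (c : R[i]) x y z : ip z (c *: x + y) = c^* * ip z x + ip z y.
Proof. by rewrite ipC ip_lin rmorphD rmorphM /= -!ipC. Qed.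

Lemma ip0l x : ip 0 x = 0.
Proof. by have := ip_lin (-1) x x x; rewrite scaleN1r addNr mulN1r addNr. Qed.

Lemma ip0r x : ip x 0 = 0.
Proof. by rewrite ipC ip0l conjC0. Qed.

Lemma ipZl (c : R[i]) x y : ip (c *: x) y = c * ip x y.
Proof. by rewrite -[c *: x]addr0 ip_lin ip0l addr0. Qed.

Lemma ipZr (c : R[i]) x y : ip y (c *: x) = c^* * ip y x.
Proof. by rewrite -[c *: x]addr0 ip_linr ip0r addr0. Qed.

Lemma ip_nsq x : ip x x = (nsq x)%:C.
Proof.
have : 0 <= ip x x by rewrite -normE exprn_ge0.
by rewrite lecE /= => /andP[/eqP im _]; apply: complex_ext.
Qed.

Lemma nsq_ge0 x : 0 <= nsq x.
Proof. by have : 0 <= ip x x by [rewrite -normE exprn_ge0]; rewrite ip_nsq ler0c. Qed.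

Lemma nsq_eq0 x : nsq x = 0 -> x = 0.
Proof.
by move=> x0; have := normE x; rewrite ip_nsq x0 => /eqP; rewrite expf_eq0 /= normr_eq0 => /eqP.
Qed.

Lemma nsqZ (c : R[i]) x : nsq (c *: x) = normsq c * nsq x.
Proof.
by rewrite {1}/nsq ipZl ipZr mulrA mul_conjc_normsq ip_nsq -rmorphM.
Qed.

Lemma nsqN x : nsq (- x) = nsq x.
Proof. by rewrite -scaleN1r nsqZ normsqN normsq1 mul1r. Qed.

Lemma nsqD x y : nsq (x + y) = nsq x + nsq y + 2 * complex.Re (ip x y).
Proof.
have E : x + y = 1 *: x + y by rewrite scale1r.
rewrite {1}/nsq E ip_lin !ip_linr conjC1 !mul1r (ipC y x) !cReD cReJ -/(nsq x) -/(nsq y).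
ring.
Qed.

Lemma nsqD_le x y : nsq (x + y) <= 2 * (nsq x + nsq y).
Proof.
have := nsq_ge0 (x - y); rewrite nsqD nsqN nsqD.
have -> : complex.Re (ip x (- y)) = - complex.Re (ip x y).
  by rewrite -scaleN1r ipZr rmorphN /= conjC1 mulN1r cReN.
lra.
Qed.

Lemma normsq_ip_le x y : normsq (ip x y) <= nsq x * nsq y.
Proof.
apply: quadratic_discriminant; [exact: nsq_ge0|exact: normsq_ge0|] => t.
have := nsq_ge0 (x + (- t%:C * ip x y) *: y); rewrite nsqD nsqZ normsqM normsqN normsq_real.
rewrite ipZr rmorphM rmorphN /= conj_realc.
have -> : (- t%:C * (ip x y)^*) * ip x y = (- t * normsq (ip x y))%:C.
  by rewrite -mulrA [_^* * _]mulrC mul_conjc_normsq -rmorphN -rmorphM.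
by rewrite [complex.Re _]/=; nra.
Qed.

Lemma norm_lt_nsq x (e : R) : 0 < e -> `|x| < e%:C <-> nsq x < e ^+ 2.
Proof.
move=> e0; rewrite -(@ltr_pXn2r _ 2)// ?nnegrE ?normr_ge0 ?ler0c ?ltW//.
by rewrite normE ip_nsq -rmorphXn ltcR.
Qed.

Lemma posC_ex (e : R[i]) : 0 < e -> exists2 r : R, 0 < r & e = r%:C.
Proof.
move=> e0; have := e0; rewrite ltcE /= => /andP[/eqP im re].
by exists (complex.Re e) => //; apply: complex_ext.
Qed.

Lemma closure_nsqP (S : set L) x : closure S x <->
  forall e : R, 0 < e -> exists2 s, S s & nsq (x - s) < e.
Proof.
split=> [Sx e e0|H B].
  have se : 0 < Num.sqrt e by rewrite sqrtr_gt0.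
  have Bx : nbhs x (ball x (Num.sqrt e)%:C).
    by apply: nbhsx_ballx; rewrite ltcR.
  have [s [Ss xs]] := Sx _ Bx; exists s => //.
  move: xs; rewrite -ball_normE /= => /(norm_lt_nsq _ se).
  by rewrite sqr_sqrtr// ltW.
move=> /nbhs_ballP[e /= /posC_ex[r r0 ->] xB].
have [s Ss xs] := H _ (exprn_gt0 2 r0); exists s; split => //; apply: xB.
by rewrite -ball_normE /=; apply/norm_lt_nsq.
Qed.

Lemma cvg_nsqP (u : nat -> L) x : u j @[j --> \oo] --> x <->
  forall e : R, 0 < e -> \forall j \near \oo, nsq (x - u j) < e.
Proof.
split=> [ux e e0|H].
  have se : 0 < Num.sqrt e by rewrite sqrtr_gt0.
  have se' : 0 < (Num.sqrt e)%:C by rewrite ltcR.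
  move/cvgrPdist_lt : ux => /(_ _ se'); apply: filterS => j /(norm_lt_nsq _ se).
  by rewrite sqr_sqrtr// ltW.
apply/cvgrPdist_lt => e /posC_ex[r r0 ->].
by apply: filterS (H _ (exprn_gt0 2 r0)) => j /(norm_lt_nsq _ r0).
Qed.

Lemma cvgn_nsqP (u : nat -> L) :
  (forall e : R, 0 < e -> exists N : nat, forall j, (N <= j)%N -> nsq (u N - u j) < e) ->
  exists x, u j @[j --> \oo] --> x.
Proof.
move=> H; exists (lim (u @ \oo)); apply: cauchy_cvg; apply: cauchy_exP => e /posC_ex[r r0 ->].
have [N HN] := H _ (exprn_gt0 2 r0); exists (u N); exists N => // j /= Nj.
by rewrite -ball_normE /=; apply/norm_lt_nsq => //; exact: HN.
Qed.

End hilbert_space.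

(** * Transfer to the Hilbert space of the polynomials *)
Section realization.
Context {R : realType} {T : completePseudoMetricType R}.
Variable sigma : {sigma_finite_measure set (borel T) -> \bar R}.
Local Notation bT := (borel T).
Local Notation fvec := (fvec R T).
Hypothesis compact_fin : forall K : set T, compact K ->
  measurable (K : set bT) /\ (sigma K < +oo)%E.
Variable Q : T -> T -> R[i].
Hypothesis mQ : cmeasurable setT (fun z : bT * bT => Q z.1 z.2).
Hypothesis Qnorm : forall s t, normsq (Q s t) = 1.
Hypothesis Qconj : forall s t, Q s t = (Q t s)^*.
Variable lambda : R.
Variables (L : completeNormedModType R[i]) (ip : {dot L for Num.conj}).
Variable iota : (fvec -> fvec) -> L.
Hypothesis L2tau : is_L2tau sigma Q lambda ip iota.
Implicit Types (F G : fvec) (p q : fvec -> fvec) (x y z : L).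
Local Notation is_fin := (is_fin sigma Q).
Local Notation field_algebra := (field_algebra sigma Q lambda).
Local Notation algebra_upto := (algebra_upto sigma Q lambda).
Local Notation fip := (fip sigma).
Local Notation nsq := (nsq ip).

Let normE x : `|x| ^+ 2 = ip x x. Proof. by have [] := L2tau. Qed.
Let finA p : field_algebra p -> is_fin (p vacuum).
Proof. exact: (is_fin_algebra compact_fin mQ Qnorm Qconj). Qed.
Let fv := vacuum_is_fin compact_fin mQ Qnorm Qconj.

Definition fn2 F : R := fine (fnorm2 sigma F).

Lemma fn2_ge0 F : 0 <= fn2 F.
Proof. by rewrite fine_ge0// fnorm2_ge0. Qed.

Lemma fnorm2_fn2 F : is_fin F -> fnorm2 sigma F = (fn2 F)%:E.
Proof. by move=> fF; rewrite fineK//; exact: fnorm2_is_fin fF. Qed.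

Lemma fip_fn2 F : is_fin F -> fip F F = (fn2 F)%:C.
Proof.
by move=> fF; have [N FN] := is_fin_bdd fF; exact: fip_self (is_fin_l2 fF) FN.
Qed.

Lemma fn2D_le F G : is_fin F -> is_fin G -> fn2 (F + G) <= 2 * (fn2 F + fn2 G).
Proof.
move=> fF fG; rewrite -lee_fin -(fnorm2_fn2 (is_finD Qnorm Qconj fF fG)).
apply: le_trans (fnorm2_is_finD fF fG) _.
by rewrite (fnorm2_fn2 fF) (fnorm2_fn2 fG) -EFinD -EFinM.
Qed.

Lemma fn2Z (c : R[i]) F : is_fin F -> fn2 (c *: F) = normsq c * fn2 F.
Proof. by move=> fF; rewrite /fn2 (fnorm2_is_finZ c fF) (fnorm2_fn2 fF) -EFinM. Qed.

Lemma fn2B F G : is_fin F -> is_fin G -> fn2 (F - G) = fn2 (G - F).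
Proof.
move=> fF fG; rewrite -[F - G]opprB -scaleN1r fn2Z; last exact: (is_finB Qnorm Qconj).
by rewrite normsqN normsq1 mul1r.
Qed.

Lemma normsq_fip_le F G : is_fin F -> is_fin G -> normsq (fip F G) <= fn2 F * fn2 G.
Proof.
move=> fF fG; apply: quadratic_discriminant; [exact: fn2_ge0|exact: normsq_ge0|] => t.
pose c := - t%:C * fip F G; have fcG := is_fin_lin Qnorm Qconj c fG fF.
have := fn2_ge0 (c *: G + F); suff -> : fn2 (c *: G + F) =
    fn2 F - 2 * t * normsq (fip F G) + t ^+ 2 * normsq (fip F G) * fn2 G by [].
have F2 := is_fin_l2 fF; have G2 := is_fin_l2 fG.
have E : fip (c *: G + F) (c *: G + F) =
    c * (c^* * fip G G + fip G F) + (c^* * fip F G + fip F F).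
  apply: (etrans (fip_fin_linl c G2 F2 fcG)).
  by rewrite (fip_fin_linr c G2 F2 fG) (fip_fin_linr c G2 F2 fF).
have GF := fip_finC fG F2.
rewrite (fip_fn2 fcG) (fip_fn2 fG) (fip_fn2 fF) GF in E; move: E.
have -> : c^* = - t%:C * (fip F G)^* by rewrite /c rmorphM rmorphN /= conj_realc.
rewrite /c; move: (fip F G) (fn2 F) (fn2 G) (fn2 _) => w a b d.
move=> /(congr1 (fun z : R[i] => complex.Re z)).
by case: w => w1 w2; rewrite /normsq /= => ->; ring.
Qed.

(** tau(q^* p) = (q^* p Omega, Omega) = (p Omega, q Omega): the isometry behind I. *)
Lemma ip_iota p q : field_algebra p -> field_algebra q ->
  ip (iota p) (iota q) = fip (p vacuum) (q vacuum).
Proof.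
move=> ap aq; have [_ _ ipE _] := L2tau.
have [oq [q' aq' qq']] := field_algebra_operator_adjoint compact_fin mQ Qnorm Qconj aq.
rewrite (ipE _ _ _ ap aq qq') /tau /=.
have [_ q'E] := is_adjointC oq qq'; exact: (q'E _ _ (finA ap) fv).
Qed.

Lemma iota_lin (c : R[i]) p q : field_algebra p -> field_algebra q ->
  iota (fun F => c *: p F + q F) = c *: iota p + iota q.
Proof. by move=> ap aq; have [_ il _ _] := L2tau; exact: il. Qed.

Lemma field_algebra_lin (c : R[i]) p q : field_algebra p -> field_algebra q ->
  field_algebra (fun F => c *: p F + q F).
Proof.
move=> ap aq; exact: field_algebra_add (field_algebra_scale c ap) aq.
Qed.

Lemma nsq_iota p : field_algebra p -> nsq (iota p) = fn2 (p vacuum).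
Proof. by move=> ap; rewrite /nsq (ip_iota ap ap) (fip_fn2 (finA ap)). Qed.

Lemma nsq_iotaB p q : field_algebra p -> field_algebra q ->
  nsq (iota p - iota q) = fn2 (p vacuum - q vacuum).
Proof.
move=> ap aq; rewrite [iota p - _]addrC -scaleN1r -(iota_lin (-1) aq ap).
by rewrite (nsq_iota (field_algebra_lin (-1) aq ap)) scaleN1r addrC.
Qed.

(* x = I^-1 F, as an approximation by elements of the algebra. *)
Definition realizes x F : Prop := forall e : R, 0 < e ->
  exists p, [/\ field_algebra p, nsq (x - iota p) < e & fn2 (p vacuum - F) < e].

Lemma realizes_lin (c : R[i]) x y F G : is_fin F -> is_fin G ->
  realizes x F -> realizes y G -> realizes (c *: x + y) (c *: F + G).
Proof.
move=> fF fG xF yG e e0; pose d := e / (4 * (normsq c + 1)).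
have c0 := normsq_ge0 c.
have d0 : 0 < d by rewrite divr_gt0// mulr_gt0// ltr_wpDl.
have dE : 2 * (normsq c * d + d) = e / 2 by rewrite /d; field; rewrite gt_eqF// ltr_wpDl.
have [p [ap xp pF]] := xF _ d0; have [q [aq yq qG]] := yG _ d0.
have bound (a b : R) : 0 <= a -> 0 <= b -> a < d -> b < d -> 2 * (normsq c * a + b) < e.
  by move=> a0 b0 ad bd; nra.
exists (fun H => c *: p H + q H); split; first exact: field_algebra_lin.
  rewrite iota_lin// opprD addrACA -scalerBr.
  apply: le_lt_trans (nsqD_le normE _ _) _; rewrite nsqZ//.
  by apply: bound => //; exact: nsq_ge0.
rewrite opprD addrACA -scalerBr.
have fpF := is_finB Qnorm Qconj (finA ap) fF; have fqG := is_finB Qnorm Qconj (finA aq) fG.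
apply: le_lt_trans (fn2D_le (is_finZ Qnorm Qconj c fpF) fqG) _; rewrite (fn2Z c fpF).
by apply: bound => //; exact: fn2_ge0.
Qed.

Lemma small_eq0 (a C : R) : 0 <= a -> 0 <= C ->
  (forall e : R, 0 < e -> a <= C * e) -> a = 0.
Proof.
move=> a0 C0 H; apply/eqP; rewrite eq_le a0 andbT leNgt; apply/negP => a_gt0.
have d0 : 0 < a / (2 * (C + 1)) by rewrite divr_gt0// mulr_gt0// ltr_wpDl.
have := H _ d0; apply/negP; rewrite -ltNge mulrA ltr_pdivrMr; first nra.
by rewrite mulr_gt0// ltr_wpDl.
Qed.

Lemma realizes_unique x y F : is_fin F -> realizes x F -> realizes y F -> x = y.
Proof.
move=> fF xF yF; apply/eqP; rewrite -subr_eq0; apply/eqP/(nsq_eq0 normE).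
(* Three nested quasi-triangle inequalities, from x to y through [iota p] and [iota q] and between
   their vacuum vectors through F, give 2 (1 + 2 (2 (1 + 1) + 1)) = 22. *)
apply: (@small_eq0 _ 22) => [||e e0]; [exact: nsq_ge0| by []|].
have [p [ap xp pF]] := xF _ e0; have [q [aq yq qF]] := yF _ e0.
have fpF := is_finB Qnorm Qconj (finA ap) fF; have fFq := is_finB Qnorm Qconj fF (finA aq).
have h1 : nsq (x - y) <= 2 * (nsq (x - iota p) + nsq (iota p - y)).
  by have := nsqD_le normE (x - iota p) (iota p - y); rewrite addrA subrK.
have h2 : nsq (iota p - y) <= 2 * (nsq (iota p - iota q) + nsq (iota q - y)).
  by have := nsqD_le normE (iota p - iota q) (iota q - y); rewrite addrA subrK.
have h3 : nsq (iota q - y) = nsq (y - iota q) by rewrite -(nsqN normE) opprB.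
have h4 : fn2 (p vacuum - q vacuum) <= 2 * (fn2 (p vacuum - F) + fn2 (F - q vacuum)).
  by have := fn2D_le fpF fFq; rewrite addrA subrK.
rewrite (nsq_iotaB ap aq) h3 in h2; rewrite (fn2B fF (finA aq)) in h4.
have arith (a b c d f g h : R) : a <= 2 * (b + c) -> c <= 2 * (d + f) ->
    d <= 2 * (g + h) -> b < e -> g < e -> f < e -> h < e -> a <= 22 * e by lra.
exact: arith h1 h2 h4 xp pF yq qF.
Qed.

Lemma feq_realizes x F G : is_fin F -> is_fin G -> feq sigma F G ->
  realizes x F -> realizes x G.
Proof.
move=> fF fG FG xF e e0; have [p [ap xp pF]] := xF _ e0; exists p; split; [exact: ap|exact: xp|].
rewrite /fn2 -(feq_fnorm2 (F := p vacuum - F)).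
- exact: pF.
- exact: is_fin_l2 (is_finB Qnorm Qconj (finA ap) fF).
- exact: is_fin_l2 (is_finB Qnorm Qconj (finA ap) fG).
by move=> m; apply: ae_mono (FG m) => t /= FGt; congr (_ - _).
Qed.

Lemma I_graph_realizes x F : is_fin F -> I_graph sigma Q lambda iota x F -> realizes x F.
Proof.
move=> fF [_ [p [ap px pF]]] e e0.
have e0' : nbhs (0%:E : \bar R) [set y | (y < e%:E)%E].
  by apply: open_nbhs_nbhs; split; [exact: open_ereal_lt_ereal|rewrite /= lte_fin].
have [j [/= j1 j2]] := filter_ex (filterI ((cvg_nsqP normE _ _).1 px _ e0) (pF _ e0')).
exists (p j); split => //; move: j2; rewrite (fnorm2_fn2 (is_finB Qnorm Qconj (finA (ap j)) fF)).
by rewrite lte_fin.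
Qed.

Lemma realizes_I_graph x F : is_fin F -> realizes x F -> I_graph sigma Q lambda iota x F.
Proof.
move=> fF xF; split; first exact: is_fin_fock.
have inv0 j : 0 < j.+1%:R^-1 :> R by rewrite invr_gt0.
have [p pP] := choice (fun j => xF _ (inv0 j)).
exists p; split; first by move=> j; have [] := pP j.
  apply/(cvg_nsqP normE) => e e0; have := near_infty_natSinv_lt (PosNum e0).
  by apply: filterS => j; apply: lt_trans; have [] := pP j.
apply: (@squeeze_cvge _ _ _ _ (cst 0%E) _ (fun j => (j.+1%:R^-1)%:E)).
- apply: nearW => j; have [apj _ pF] := pP j; rewrite fnorm2_ge0 /=.
  by rewrite (fnorm2_fn2 (is_finB Qnorm Qconj (finA apj) fF)) lee_fin ltW.
- exact: cvg_cst.
- by apply: cvg_EFin; [exact: nearW|exact: cvg_harmonic].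
Qed.

(** [I_inv] is a choice, and [realizes_unique] shows that every admissible choice is x. *)
Lemma I_inv_realizes x F : is_fin F -> realizes x F -> I_inv sigma Q lambda iota F = x.
Proof.
move=> fF xF; rewrite /I_inv; case: xgetP => [y _ yF|/(_ x)].
  exact: realizes_unique fF (I_graph_realizes fF yF) xF.
by case; exact: realizes_I_graph.
Qed.

Lemma MPP n x : MP sigma Q lambda iota n x <->
  forall e : R, 0 < e -> exists2 p, algebra_upto n p & nsq (x - iota p) < e.
Proof.
split=> [/(closure_nsqP normE) H e /H[_ [p pn <-] xp]|H]; first by exists p.
by apply/(closure_nsqP normE) => e /H[p pn xp]; exists (iota p) => //; exists p.
Qed.

Lemma MP_mono n m x : (n <= m)%N -> MP sigma Q lambda iota n x -> MP sigma Q lambda iota m x.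
Proof.
by move=> nm /MPP H; apply/MPP => e /H[p pn xp]; exists p => //; exact: algebra_upto_mono pn.
Qed.

Lemma MP_lin n (c : R[i]) x y : MP sigma Q lambda iota n x -> MP sigma Q lambda iota n y ->
  MP sigma Q lambda iota n (c *: x + y).
Proof.
move=> /MPP Hx /MPP Hy; apply/MPP => e e0; pose d := e / (4 * (normsq c + 1)).
have c0 := normsq_ge0 c.
have d0 : 0 < d by rewrite divr_gt0// mulr_gt0// ltr_wpDl.
have dE : 2 * (normsq c * d + d) = e / 2 by rewrite /d; field; rewrite gt_eqF// ltr_wpDl.
have [p pn xp] := Hx _ d0; have [q qn yq] := Hy _ d0.
exists (fun H => c *: p H + q H); first exact: algebra_upto_lin.
rewrite (iota_lin c (algebra_upto_algebra pn) (algebra_upto_algebra qn)) opprD addrACA -scalerBr.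
apply: le_lt_trans (nsqD_le normE _ _) _; rewrite nsqZ//.
have := nsq_ge0 normE (x - iota p); have := nsq_ge0 normE (y - iota q); nra.
Qed.

Lemma MP_sum n (I : Type) (r : seq I) (P : pred I) (X : I -> L) :
  MP sigma Q lambda iota n 0 -> (forall i, P i -> MP sigma Q lambda iota n (X i)) ->
  MP sigma Q lambda iota n (\sum_(i <- r | P i) X i).
Proof.
move=> M0 MX; elim/big_ind : _ => // x y Mx My.
by rewrite -[x]scale1r; exact: MP_lin.
Qed.

(** Polynomials whose vacuum vectors converge to F form, by the isometry, a Cauchy sequence in L;
    its limit lies in [MP n] and realizes F. *)
Lemma approximable_realized n F : is_fin F -> approximable sigma Q lambda n F ->
  exists2 x, realizes x F & MP sigma Q lambda iota n x.
Proof.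
move=> fF aF.
have inv0 j : 0 < j.+1%:R^-1 :> R by rewrite invr_gt0.
have H j : exists p, algebra_upto n p /\ fn2 (p vacuum - F) < j.+1%:R^-1.
  have [p pn pF] := aF _ (inv0 j); exists p; split; first exact: pn.
  move: pF; rewrite (fnorm2_fn2 (is_finB Qnorm Qconj (finA (algebra_upto_algebra pn)) fF)).
  by rewrite lte_fin.
have [p pP] := choice H.
have ap j : field_algebra (p j) by have [pn _] := pP j; exact: algebra_upto_algebra pn.
have [x ux] : exists x, iota (p j) @[j --> \oo] --> x.
  apply: (cvgn_nsqP normE) => e e0; have e4 : 0 < e / 4 by rewrite divr_gt0.
  have [N _ HN] := near_infty_natSinv_lt (PosNum e4); exists N => j Nj.
  rewrite (nsq_iotaB (ap N) (ap j)).
  have h := fn2D_le (is_finB Qnorm Qconj (finA (ap N)) fF) (is_finB Qnorm Qconj fF (finA (ap j))).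
  rewrite addrA subrK (fn2B fF (finA (ap j))) in h.
  have [_ h1] := pP N; have [_ h2] := pP j.
  have h3 : N.+1%:R^-1 < e / 4 by exact: HN N (leqnn N).
  have h4 : j.+1%:R^-1 < e / 4 by exact: HN j Nj.
  have arith (a b c : R) : a <= 2 * (b + c) -> b < e / 4 -> c < e / 4 -> a < e by lra.
  exact: arith h (lt_trans h1 h3) (lt_trans h2 h4).
exists x.
  move=> e e0; have near1 := near_infty_natSinv_lt (PosNum e0).
  have [j [/= j1 j2]] := filter_ex (filterI ((cvg_nsqP normE _ _).1 ux _ e0) near1).
  by exists (p j); split => //; have [_ h] := pP j; exact: lt_trans h j2.
apply/MPP => e e0; have [j j1] := filter_ex ((cvg_nsqP normE _ _).1 ux _ e0).
by exists (p j) => //; have [] := pP j.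
Qed.

(** Orthogonality is given only against vacuum vectors of polynomials. It passes to the limit twice,
    first in the approximation of x, then in that of z. *)
Lemma realizes_orthogonal n x z F : is_fin F -> realizes x F ->
  (forall q, algebra_upto n q -> fip F (q vacuum) = 0) ->
  MP sigma Q lambda iota n z -> ip x z = 0.
Proof.
move=> fF xF Fq /MPP zn.
have iota0 q : algebra_upto n q -> ip x (iota q) = 0.
  move=> qn; have aq := algebra_upto_algebra qn.
  apply: normsq_eq0; apply: (@small_eq0 _ (2 * (nsq (iota q) + fn2 (q vacuum)))).
  - exact: normsq_ge0.
  - by rewrite mulr_ge0// addr_ge0// ?fn2_ge0// nsq_ge0.
  move=> e e0; have [p [ap xp pF]] := xF _ e0.
  have E : ip x (iota q) = ip (x - iota p) (iota q) + fip (p vacuum - F) (q vacuum).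
    have -> : fip (p vacuum - F) (q vacuum) = ip (iota p) (iota q).
      rewrite (ip_iota ap aq) [p vacuum - F]addrC -scaleN1r.
      apply: (etrans (fip_fin_linl (-1) (is_fin_l2 fF) (is_fin_l2 (finA ap)) (finA aq))).
      by rewrite (Fq _ qn) mulr0 add0r.
    by rewrite -[x - iota p]addrC -scaleN1r ip_lin mulN1r addrAC addNr add0r.
  rewrite E; apply: le_trans (normsqD_le _ _) _.
  have h1 := normsq_ip_le normE (x - iota p) (iota q).
  have h2 := normsq_fip_le (is_finB Qnorm Qconj (finA ap) fF) (finA aq).
  have n1 := nsq_ge0 normE (iota q); have n2 := fn2_ge0 (q vacuum).
  rewrite -mulrA ler_pM2l// mulrDl lerD//.
    by apply: le_trans h1 _; rewrite mulrC ler_wpM2l// ltW.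
  by apply: le_trans h2 _; rewrite mulrC ler_wpM2l// ltW.
apply: normsq_eq0; apply: (@small_eq0 _ (nsq x)); [exact: normsq_ge0|exact: nsq_ge0|] => e e0.
have [q qn zq] := zn _ e0.
have -> : ip x z = ip x (z - iota q).
  rewrite [z - _]addrC -scaleN1r ip_linr (iota0 _ qn) mulr0 add0r//.
apply: le_trans (normsq_ip_le normE _ _) _.
by rewrite ler_wpM2l ?nsq_ge0// ltW.
Qed.

End realization.

(** * Wick products as projections *)

Section wick_products.
Context {R : realType} {T : completePseudoMetricType R}.
Variable sigma : {sigma_finite_measure set (borel T) -> \bar R}.
Local Notation bT := (borel T).
Local Notation fvec := (fvec R T).
Hypothesis compact_fin : forall K : set T, compact K ->
  measurable (K : set bT) /\ (sigma K < +oo)%E.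
Variable Q : T -> T -> R[i].
Hypothesis mQ : cmeasurable setT (fun z : bT * bT => Q z.1 z.2).
Hypothesis Qnorm : forall s t, normsq (Q s t) = 1.
Hypothesis Qconj : forall s t, Q s t = (Q t s)^*.
Variable lambda : R.
Variables (L : completeNormedModType R[i]) (ip : {dot L for Num.conj}).
Variable iota : (fvec -> fvec) -> L.
Hypothesis L2tau : is_L2tau sigma Q lambda ip iota.
Variable W : forall n, (n.-tuple T -> R[i]) -> fvec -> fvec.
Hypothesis extW : is_monomial_extension sigma Q lambda W.
Variable K : set T.
Hypothesis cK : compact K.
Local Notation chaos := (chaos Q).
Local Notation smearS := (smearS sigma Q lambda).
Local Notation realizes := (realizes sigma Q lambda ip iota).
Local Notation MP := (MP sigma Q lambda iota).

Let mK : measurable (K : set bT) := (compact_fin cK).1.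
Let Kfin : (sigma K < +oo)%E := (compact_fin cK).2.

Lemma realizes0 : realizes 0 0.
Proof.
have [normE _ _ _] := L2tau.
have f0 := is_fin0 sigma Qnorm Qconj.
have a0 := field_algebra_scale (0 : R[i]) (field_algebra_one sigma Q lambda).
have i0 : iota (fun F => 0 *: idfun F) = 0.
  apply: (nsq_eq0 normE); rewrite (nsq_iota compact_fin mQ Qnorm Qconj L2tau a0).
  by rewrite scale0r /fn2 (fnorm2_0 sigma Qnorm Qconj).
move=> e e0; exists (fun F => 0 *: idfun F); split; first exact: a0.
  by rewrite i0 subr0 /nsq ip0l.
by rewrite scale0r subr0 /fn2 (fnorm2_0 sigma Qnorm Qconj).
Qed.

Lemma realizes_sum (I : Type) (r : seq I) (P : pred I) (y : I -> L) (F : I -> fvec) :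
  (forall i, P i -> is_fin sigma Q (F i)) -> (forall i, P i -> realizes (y i) (F i)) ->
  realizes (\sum_(i <- r | P i) y i) (\sum_(i <- r | P i) F i).
Proof.
move=> fF yF; elim: r => [|i r IH]; first by rewrite !big_nil; exact: realizes0.
rewrite !big_cons; have [Pi|_] := boolP (P i); last exact: IH.
rewrite -[y i]scale1r -[F i]scale1r.
exact: (realizes_lin compact_fin mQ Qnorm Qconj L2tau 1 (fF i Pi)
  (is_fin_sum Qnorm Qconj r fF) (yF i Pi) IH).
Qed.

Lemma chaos_realized k (g : seq T -> R[i]) : Kclass K (fun s : k.-tuple T => g s) ->
  exists2 x, realizes x (chaos k g) & MP k x.
Proof.
move=> gK; apply: (approximable_realized compact_fin mQ Qnorm Qconj L2tau).
  exact: (Kclass_is_fin_chaos mK Kfin mQ Qnorm Qconj gK).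
exact: (chaos_approximable compact_fin mQ Qnorm Qconj lambda cK gK).
Qed.

Lemma fip_chaos_low k n (g : seq T -> R[i]) q : (n < k)%N ->
  Kclass K (fun s : k.-tuple T => g s) -> algebra_upto sigma Q lambda n q ->
  fip sigma (chaos k g) (q vacuum) = 0.
Proof.
move=> nk gK qn.
have fg := Kclass_is_fin_chaos mK Kfin mQ Qnorm Qconj gK.
have fq := is_fin_algebra compact_fin mQ Qnorm Qconj (algebra_upto_algebra qn).
rewrite (fipEr (is_fin_l2 fg) (is_fin_l2 fq) (bdd_algebra_upto compact_fin mQ Qnorm Qconj qn)).
rewrite big1// => m _; rewrite chaos_neq; last by rewrite ltn_eqF// (leq_ltn_trans _ nk)// -ltnS.
by rewrite ip20 mulr0.
Qed.

Section one_function.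
Variables (n : nat) (f : n.-tuple T -> R[i]).
Hypothesis fK : Kclass K f.

Lemma smear_realized : exists y : {set {set 'I_n}} * {set {set 'I_n}} -> L,
  forall V, marked_partition V ->
    realizes (y V) (chaos #|V.1| (smearS f V)) /\ MP #|V.1| (y V).
Proof.
have H V : exists x, marked_partition V ->
    realizes x (chaos #|V.1| (smearS f V)) /\ MP #|V.1| x.
  have [mV|_] := boolP (marked_partition V); last by exists 0.
  have [x x1 x2] := chaos_realized (Kclass_smearS mK Kfin mQ Qnorm lambda mV fK erefl).
  by exists x.
by have [y yP] := choice H; exists y.
Qed.

Variable y : {set {set 'I_n}} * {set {set 'I_n}} -> L.
Hypothesis yV : forall V, marked_partition V ->
  realizes (y V) (chaos #|V.1| (smearS f V)) /\ MP #|V.1| (y V).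

Lemma monomial_elt_sum : monomial_elt sigma Q lambda iota W f =
  \sum_(V : {set {set 'I_n}} * {set {set 'I_n}} | marked_partition V) y V.
Proof.
have [Wop _ _ _] := extW; have [Wf _ _] := Wop _ _ (Kclass_B0n cK fK).
have fW := Wf _ (vacuum_is_fin compact_fin mQ Qnorm Qconj).
have fw := is_fin_wick_sum mK Kfin mQ Qnorm Qconj lambda fK.
apply: (I_inv_realizes compact_fin mQ Qnorm Qconj L2tau fW).
have Ww := monomial_vacuum compact_fin mQ Qnorm Qconj extW cK fK.
apply: (feq_realizes compact_fin mQ Qnorm Qconj fw fW (feq_sym Ww)).
apply: realizes_sum => V mV; last by have [] := yV mV.
have SK := Kclass_smearS mK Kfin mQ Qnorm lambda mV fK erefl.
exact: (Kclass_is_fin_chaos mK Kfin mQ Qnorm Qconj SK).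
Qed.

End one_function.

(** The difference of two candidates is orthogonal to both of them, hence to itself. *)
Lemma orth_proj_unique (S : set L) x y : S y ->
  (forall z, S z -> ip (x - y) z = 0) -> orth_proj ip S x = y.
Proof.
have [normE _ _ _] := L2tau.
move=> Sy yS; rewrite /orth_proj; case: xgetP => [z _ [Sz zS]|/(_ y)]; last by case.
apply/eqP; rewrite -subr_eq0; apply/eqP/(nsq_eq0 normE).
have E : z - y = -1 *: (x - z) + (x - y) by rewrite scaleN1r opprB addrA subrK.
have D w : (forall s, S s -> ip w s = 0) -> ip w (z - y) = 0.
  by move=> wS; rewrite [z - y]addrC -scaleN1r ip_linr !wS// mulr0 addr0.
by rewrite /nsq {1}E ip_lin (D _ zS) (D _ yS) mulr0 addr0.
Qed.

Lemma MP0 m : MP m 0.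
Proof.
have nilB (h : T -> R) : h \in [::] -> B0 h by [].
have a1 := algebra_upto_mono (leq0n m) (algebra_upto_monomial sigma Q lambda nilB).
have M1 : MP m (iota (field_monomial sigma Q lambda [::])).
  by apply: subset_closure; exists (field_monomial sigma Q lambda [::]).
have := MP_lin L2tau (c := -1) M1 M1.
by rewrite scaleN1r addNr.
Qed.

Lemma wickE k (g : seq T -> R[i]) x : Kclass K (fun s : k.-tuple T => g s) ->
  realizes x (chaos k g) ->
  wick sigma Q lambda ip iota W (fun s : k.-tuple T => g s) = x.
Proof.
move=> gK xg; pose f : k.-tuple T -> R[i] := fun s => g s.
have fg := Kclass_is_fin_chaos mK Kfin mQ Qnorm Qconj gK.
have [y yV] := smear_realized (f := f) gK.
have E0 : chaos #|(singleton_blocks k).1| (smearS f (singleton_blocks k)) = chaos k g.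
  rewrite card_singleton_blocks1; apply: eq_chaos => s sk.
  have skE : size s == k by exact/eqP.
  by rewrite -[s]/(tval (Tuple skE)) smearS_singleton_blocks.
have [y0 M0] := yV _ (singleton_blocks_marked k).
have yx : y (singleton_blocks k) = x.
  by rewrite E0 in y0; exact: (realizes_unique compact_fin mQ Qnorm Qconj L2tau fg y0 xg).
have Mx : MP k x by rewrite -yx -{1}(card_singleton_blocks1 k).
pose S := \sum_(V : {set {set 'I_k}} * {set {set 'I_k}} |
  marked_partition V && (V != singleton_blocks k)) y V.
have mE : monomial_elt sigma Q lambda iota W f - x = S.
  rewrite (monomial_elt_sum (f := f) gK yV).
  rewrite (bigD1 (singleton_blocks k)) ?singleton_blocks_marked//=.
  by rewrite yx -/S [x + S]addrC addrK.
have low V : marked_partition V && (V != singleton_blocks k) -> (#|V.1| < k)%N.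
  by move=> /andP[mV V0]; exact: card_marked1_lt mV V0.
have orth m z : (m < k)%N -> MP m z -> ip x z = 0.
  move=> mk; apply: (realizes_orthogonal compact_fin mQ Qnorm Qconj L2tau fg xg) => q.
  exact: (fip_chaos_low mk gK).
have Ox : OP sigma Q lambda ip iota k x.
  by case: (k) Mx orth => // m Mx orth; split => // z; exact: orth.
apply: orth_proj_unique => // z Oz; rewrite -/f mE ipC.
suff -> : ip z S = 0 by rewrite conjC0.
(* [OP] at 0 is [MP] at 0 and carries no orthogonality; but for k = 0 the partition into singletons
   is the only one, so S is an empty sum. *)
have [k0|[m km]] : k = 0%N \/ exists m, k = m.+1.
  by case: (k) => [|m]; [left|right; exists m].
  rewrite /S big_pred0 ?ip0r// => V; apply/negbTE/negP => /low lV.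
  by have := leq_trans lV (eq_leq k0).
have zM w : MP m w -> ip z w = 0 by move: w; move: Oz; rewrite km => -[].
apply: zM; apply: (MP_sum L2tau); first exact: MP0.
move=> V VS; have /andP[mV _] := VS.
by apply: (MP_mono L2tau _ (yV _ mV).2); exact: leq_trans (low V VS) (eq_leq km).
Qed.

Theorem wick_rule n (f : n.-tuple T -> R[i]) : Kclass K f ->
  monomial_elt sigma Q lambda iota W f =
  \sum_(V : {set {set 'I_n}} * {set {set 'I_n}} | marked_partition V)
     wick sigma Q lambda ip iota W (smear sigma Q lambda f (V := V)).
Proof.
move=> fK; have [y yV] := smear_realized fK.
rewrite (monomial_elt_sum fK yV); apply: eq_bigr => V mV; apply: esym.
exact: (wickE (Kclass_smearS mK Kfin mQ Qnorm lambda mV fK erefl) (yV V mV).1).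
Qed.

End wick_products.

(** * Reductions from the topological hypotheses *)

Section reductions.
Context {R : realType} {T : completePseudoMetricType R}.
Local Notation bT := (borel T).

(** The measure is repacked with its sigma-finiteness, so that the equality with nu can be
    substituted in every hypothesis that mentions mu. *)
Lemma sigma_finite_measure_ex (mu : {measure set bT -> \bar R}) : sigma_finite setT mu ->
  exists nu : {sigma_finite_measure set bT -> \bar R}, mu = nu.
Proof.
case: mu => m [c1 c2] sf.
pose mu : {measure set bT -> \bar R} := Measure.Pack (Measure.Class c2).
have ssf : sfinite_measure mu by exact: sfinite_measure_sigma_finite sf.
by exists (SigmaFiniteMeasure.Pack (SigmaFiniteMeasure.Class c2
  (isSFinite.Axioms_ _ _ _ ssf) (isSigmaFinite.Axioms_ _ _ _ sf))).
Qed.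

Lemma radon_compact_fin (mu : {measure set bT -> \bar R}) : hausdorff_space T -> radon mu ->
  forall K : set T, compact K -> measurable (K : set bT) /\ (mu K < +oo)%E.
Proof.
move=> hT [muK _] K cK; split; last exact: muK.
rewrite -[K]setCK; apply: measurableC; apply: sub_sigma_algebra.
exact: closed_openC (compact_closed hT cK).
Qed.

(* A separable locally compact space is sigma-compact: every point lies in a
   ball of radius 1/(j+1) around a point of the dense sequence which is contained
   in a compact set. *)
Lemma radon_sigma_finite (mu : {measure set bT -> \bar R}) : polish T ->
  locally_compact [set: T] -> radon mu -> sigma_finite setT mu.
Proof.
move=> [hT [D cD dD]] lcT rmu; have compact_fin := radon_compact_fin hT rmu.
have /countable_injP[g ginj] := cD.
pose E i := xget point [set x | D x /\ g x = i].
have EP x : D x -> E (g x) = x.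
  move=> Dx; rewrite /E; case: xgetP => [y _ [Dy gy]|/(_ x)]; last by case.
  by apply: ginj; rewrite ?inE.
pose C x (j : nat) : set T := xget set0 [set K | compact K /\ ball x j.+1%:R^-1 `<=` K].
have CK x j : compact (C x j).
  by rewrite /C; case: xgetP => [K _ []|_] //; exact: compact0.
pose F k : set T := if (unpickle k : option (nat * nat)) is Some (i, j) then C (E i) j else set0.
have FK k : compact (F k).
  by rewrite /F; case: unpickle => [[i j]|]; [exact: CK|exact: compact0].
exists F; last by move=> k; exact: compact_fin.
apply/esym/seteqP; split => // y _.
have [U + [cU _]] := lcT y I; rewrite /within /= => Uy.
have /nbhs_ballP[e /= e0 eU] : nbhs y U by apply: filterS Uy => x; exact.
have [j _ /(_ j (leqnn j)) /= je] := near_infty_natSinv_lt (PosNum (divr_gt0 e0 (ltr0n R 2))).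
pose r : R := j.+1%:R^-1; have r0 : 0 < r by rewrite invr_gt0.
have [|x [/interior_subset yx Dx]] := dD (ball y r)° _ (open_interior _).
  by exists y; exact: nbhsx_ballx.
exists (pickle (g x, j)) => //; rewrite /F pickleK EP//.
rewrite /C; case: xgetP => [V _ [_ VB]|/(_ U)]; first by apply: VB; exact: ball_sym.
case; split => // z xz; apply: eU; apply: (@le_ball _ _ _ (r + r)).
  by rewrite [e](splitr e) lerD// ltW.
exact: ball_triangle yx xz.
Qed.

Lemma kernel_facts (mu : {measure set bT -> \bar R}) (A : set (bT * bT)) (Q : T -> T -> R[i]) :
  commutation_kernel mu A Q ->
  [/\ cmeasurable setT (fun z : bT * bT => Q z.1 z.2), forall s t, normsq (Q s t) = 1
    & forall s t, Q s t = (Q t s)^*].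
Proof.
move=> [[mA _ Asym _] [[mRe mIm] Qnorm Qconj Q1]]; split.
(* A function measurable off the measurable set A and constant on A is measurable; on A the real
   part of Q is 1 and the imaginary part is 0. *)
- have ext (h : bT * bT -> R) (c : R) : measurable_fun (~` A) h ->
      (forall z, A z -> h z = c) -> measurable_fun setT h.
    move=> mh hA; rewrite -(setvU A) setUC.
    apply/(measurable_funU h mA (measurableC mA)); split => //.
    apply: (eq_measurable_fun (cst c)); last exact: measurable_cst.
    by move=> z; rewrite inE => /hA.
  split; [apply: (ext _ 1) => //|apply: (ext _ 0) => //];
    by move=> [s t] /= /Q1 ->.
- move=> s t; have [Ast|Ast] := pselect (A (s, t)); first by rewrite Q1// normsq1.
  have := normsqE (Q s t); rewrite Qnorm// expr1n => /(congr1 (fun z => complex.Re z)).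
  by [].
- move=> s t; have [Ast|Ast] := pselect (A (s, t)); last exact: Qconj.
  by rewrite !Q1 ?conjC1//; exact: Asym.
Qed.

End reductions.

Theorem theorem4p7 (R : realType) (T : completePseudoMetricType R)
    (sigma : {measure set (borel T) -> \bar R})
    (A : set (borel T * borel T)) (Q : T -> T -> R[i]) (lambda : R)
    (L : completeNormedModType R[i]) (ip : {dot L for Num.conj})
    (iota : (fvec R T -> fvec R T) -> L)
    (W : forall n, (n.-tuple T -> R[i]) -> fvec R T -> fvec R T)
    (polishT : polish T) (lcT : locally_compact [set: T])
    (radon_sigma : radon sigma) (non_atomic_sigma : non_atomic sigma)
    (kernelQ : commutation_kernel sigma A Q)
    (L2tau : is_L2tau sigma Q lambda ip iota)
    (extW : is_monomial_extension sigma Q lambda W)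
    (n : nat) (f : n.-tuple T -> R[i]) (B0f : B0n f) :
  monomial_elt sigma Q lambda iota W f =
  \sum_(V : {set {set 'I_n}} * {set {set 'I_n}} | marked_partition V)
     wick sigma Q lambda ip iota W (smear sigma Q lambda f (V := V)).
Proof.
have [mQ Qnorm Qconj] := kernel_facts kernelQ.
have compact_fin := radon_compact_fin polishT.1 radon_sigma.
have [nu sigmaE] := sigma_finite_measure_ex (radon_sigma_finite polishT lcT radon_sigma).
subst sigma; have [K cK fK] := B0n_Kclass B0f.
exact: (wick_rule compact_fin mQ Qnorm Qconj L2tau extW cK fK).
Qed.
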